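(* Let $\mathcal N$ be an $L$-finite structure and let $\{\mathcal M_\alpha\}_{\alpha\le\lambda(\mathcal N)}$ be a Tarski hierarchy over $\mathcal N$. Then $\lambda(\mathcal N)$ is countable. Furthermore, $\lambda(\mathcal N)=Ord(\mathcal N)$, and $\mathcal M_{\lambda(\mathcal N)}$ is the minimal structure containing all sets implicitly definable in $\mathcal N$; that is, every set implicitly definable in $\mathcal N$ is definable in $\mathcal M_{\lambda(\mathcal N)}$, and $\mathcal D(\mathcal M_{\lambda(\mathcal N)})\subseteq\mathcal D(\mathcal M')$ for every structure $\mathcal M'$ in which all sets implicitly definable in $\mathcal N$ are definable.
   Context: Structures. An $n$-ary predicate ($n>0$) is a pair $\langle A,n\rangle$ with $A\subseteq\omega^n$; an $n$-ary function symbol ($n\ge 0$) is a pair $\langle f,n\rangle$ with $f:\omega^n\to\omega$ total. Symbols are thus inherently interpreted over $\omega$. Let $\mathbf A=\{=,<,S,+,\cdot\}$ with the usual interpretation. A structure is a set $\mathcal M$ of predicates and function symbols with $\mathbf A\subseteq\mathcal M$; it is $L$-finite iff it is a finite set. $\mathcal M+Y$ denotes $\mathcal M\cup Y$ (relations are identified with the corresponding predicates). A set $X\subseteq\omega^k$ is definable in $\mathcal M$ iff it is the extension of a first-order formula (variables ranging over $\omega$) with symbols from $\mathcal M$. $\mathcal D(\mathcal M)$ is the set of all $X\subseteq\omega$ definable in $\mathcal M$. Universal predicates. For $G\subseteq\omega^2$ let $G(n,.)=\{m\in\omega: G(n,m)\}$. $G\subseteq\omega^2$ is a universal predicate for $\mathcal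 M$ iff $\mathcal D(\mathcal M)\subseteq\{G(n,.):n\in\omega\}$. $P_0$ is a canonic universal predicate for $\mathcal M$ iff $P_0$ is a universal predicate for $\mathcal M$ and, for every universal predicate $P$ for $\mathcal M$, $P_0$ is definable in $\mathcal M+P$. Tarski hierarchy. A Tarski hierarchy over a countable structure $\mathcal N$ is a sequence of structures $\{\mathcal M_\alpha\}_{\alpha\le\lambda(\mathcal N)}$ such that (1) $\mathcal M_0=\mathcal N$; (2) for every $\alpha<\lambda(\mathcal N)$, $\mathcal M_\alpha$ has a canonic universal predicate and $\mathcal M_{\alpha+1}=\mathcal M_\alpha\cup\{P_\alpha\}$, where $P_\alpha$ is a canonic universal predicate for $\mathcal M_\alpha$; (3) $\mathcal M_\beta=\bigcup_{\gamma<\beta}\mathcal M_\gamma$ for every limit ordinal $\beta\le\lambda(\mathcal N)$; (4) $\lambda(\mathcal N)$ is the maximum ordinal satisfying (1)–(3), i.e. the sequence cannot be continued because $\mathcal M_{\lambda(\mathcal N)}$ has no canonic universal predicate. Ordinals. A relation $\rho\subseteq\omega^2$ is a linear ordering iff it is reflexive, transitive, antisymmetric and total on $Rng(\rho)$ (so orderings are non-strict); it is a representation of an ordinal $\alpha$ iff its strict part well-orders $Rng(\rho)$ in order type $\alpha$. An ordinal is definable in $\mathcal N$ iff it has a representation definable in $\mathcal N$. $Ord(\mathcal N)$ is the smallest ordinal not definable in $\mathcal N$. Implicit definability. For $\lambda=\langle k_1,\dots,k_s\rangle\in\omega^{<\omega}$, $P(\omega^\lambda)$ is the set of tuples $\langle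 X_1,\dots,X_s\rangle$ with $X_i\subseteq\omega^{k_i}$. A formula scheme in $\mathcal M$ is a formula with symbols from $\mathcal M$ which may contain free second-order (relation) variables but no second-order quantifiers. A set $B\subseteq\omega^k$ is implicitly definable in $\mathcal M$ iff there are $\lambda$, $A\in P(\omega^\lambda)$ and a formula scheme in $\mathcal M$ without free first-order variables whose unique solution in $P(\omega^\lambda)$ is $A$, such that $B$ is definable in $\mathcal M+A$ (i.e. $\mathcal M$ with the components of $A$ added as predicates). *)

(* Defs.v *)
(* MathComp + mathcomp-classical: [set T] is [T -> Prop], with extensional
   Leibniz equality. *)
From mathcomp Require Import all_boot.
From mathcomp Require Import boolp classical_sets functions cardinality.

Set Implicit Arguments.
Unset Strict Implicit.
Unset Printing Implicit Defensive.

Local Open Scope classical_set_scope.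

(* Symbols carry their interpretation over omega.  Arity 0 is excluded for
   predicates in [structure] below, not here, so that 0-ary components of a
   tuple in P(omega^lam) can be adjoined to a language. *)
Inductive symbol : Type :=
| Pred (n : nat) (A : set (n.-tuple nat))
| Func (n : nat) (f : n.-tuple nat -> nat).

Definition rel2 (r : nat -> nat -> Prop) : set (2.-tuple nat) :=
  [set t | r (tnth t ord0) (tnth t ord_max)].

Definition fun2 (f : nat -> nat -> nat) (t : 2.-tuple nat) : nat :=
  f (tnth t ord0) (tnth t ord_max).

Definition arithmetic : set symbol :=
  [set Pred (rel2 (fun x y => x = y))] `|`
  [set Pred (rel2 (fun x y => x < y))] `|`
  [set Func (fun t : 1.-tuple nat => (thead t).+1)] `|`
  [set Func (fun2 addn)] `|`
  [set Func (fun2 muln)].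

Record structure : Type := Structure {
  symbols :> set symbol;
  arithmetic_sub : arithmetic `<=` symbols;
  pred_arity_gt0 : forall n (A : set (n.-tuple nat)), symbols (Pred A) -> 0 < n
}.

(* Terms and formulas are well scoped: those indexed by [m] have their free
   first-order variables among x_0, ..., x_(m-1). *)
Inductive term (m : nat) : Type :=
| Var (i : 'I_m)
| App (n : nat) (f : n.-tuple nat -> nat) (args : 'I_n -> term m).

(* Formula schemes with second-order variables X_0, ..., X_(size lam - 1), the
   i-th one of arity [nth 0 lam i]; first-order formulas are the case
   [lam = [::]].  [Ex] binds x_0 and shifts the other variables. *)
Inductive formula (lam : seq nat) (m : nat) : Type :=
| Atom (n : nat) (A : set (n.-tuple nat)) (args : 'I_n -> term m)
| RelVar (i : 'I_(size lam)) (args : 'I_(nth 0 lam i) -> term m)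
| Not (phi : formula lam m)
| And (phi psi : formula lam m)
| Ex (phi : formula lam m.+1).

Fixpoint term_over (L : set symbol) m (t : term m) : Prop :=
  match t with
  | Var _ => True
  | App n f args => L (Func f) /\ forall i : 'I_n, term_over L (args i)
  end.

Fixpoint formula_over (L : set symbol) lam m (phi : formula lam m) : Prop :=
  match phi with
  | Atom n A args => L (Pred A) /\ forall i : 'I_n, term_over L (args i)
  | RelVar i args => forall j, term_over L (args j)
  | Not phi => formula_over L phi
  | And phi psi => formula_over L phi /\ formula_over L psi
  | Ex phi => formula_over L phi
  end.

Fixpoint eval m (v : m.-tuple nat) (t : term m) : nat :=
  match t with
  | Var i => tnth v i
  | App n f args => f [tuple eval v (args i) | i < n]
  end.

(* P(omega^lam) *)
Definition relations (lam : seq nat) : Type :=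
  forall i : 'I_(size lam), set ((nth 0 lam i).-tuple nat).

Fixpoint sat lam (R : relations lam) m (phi : formula lam m) :
    m.-tuple nat -> Prop :=
  match phi with
  | Atom n A args => fun v => A [tuple eval v (args i) | i < n]
  | RelVar i args => fun v => R i [tuple eval v (args j) | j < nth 0 lam i]
  | Not phi => fun v => ~ sat R phi v
  | And phi psi => fun v => sat R phi v /\ sat R psi v
  | Ex phi => fun v => exists a : nat, sat R phi [tuple of a :: v]
  end.

Definition no_relations : relations [::] := fun=> set0.

Definition definable (L : set symbol) k (X : set (k.-tuple nat)) : Prop :=
  exists phi : formula [::] k,
    formula_over L phi /\ X = [set t | sat no_relations phi t].

Definition definable_sets (L : set symbol) : set (set nat) :=
  [set X | definable L [set t : 1.-tuple nat | X (thead t)]].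

Definition add_pred (L : set symbol) k (A : set (k.-tuple nat)) : set symbol :=
  L `|` [set Pred A].

Definition add_relations (L : set symbol) lam (A : relations lam) :
    set symbol :=
  L `|` range (fun i : 'I_(size lam) => Pred (A i)).

Definition L_finite (M : structure) : Prop := finite_set (symbols M).

Definition section (G : set (2.-tuple nat)) (n : nat) : set nat :=
  [set m | G [tuple n; m]].

Definition universal (L : set symbol) (G : set (2.-tuple nat)) : Prop :=
  definable_sets L `<=` range (section G).

Definition canonic_universal (L : set symbol) (P0 : set (2.-tuple nat)) :
    Prop :=
  universal L P0 /\
  forall P : set (2.-tuple nat), universal L P -> definable (add_pred L P) P0.

Definition implicitly_definable (L : set symbol) k (B : set (k.-tuple nat)) :
    Prop :=
  exists (lam : seq nat) (A : relations lam) (phi : formula lam 0),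
    [/\ formula_over L phi,
        forall A' : relations lam, sat A' phi [tuple] <-> A' = A &
        definable (add_relations L A) B].

(* Ordinals are represented by strictly well-ordered types and compared through
   order isomorphisms onto initial segments. *)
Record ord_type : Type := OrdType {
  carrier :> Type;
  olt : carrier -> carrier -> Prop;
  olt_trans : forall x y z, olt x y -> olt y z -> olt x z;
  olt_total : forall x y, [\/ olt x y, x = y | olt y x];
  olt_wf : well_founded olt
}.

Definition ord_le (a b : ord_type) : Prop :=
  exists f : a -> b,
    (forall x y, olt x y <-> olt (f x) (f y)) /\
    (forall x (z : b), olt z (f x) -> exists y, z = f y).

Definition Rng (rho : set (2.-tuple nat)) : set nat :=
  [set y | exists x, rho [tuple x; y]].

(* Reflexivity is imposed on the whole field of [rho], which therefore coincides
   with [Rng rho]. *)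
Definition linear_ordering (rho : set (2.-tuple nat)) : Prop :=
  [/\ forall x y, rho [tuple x; y] -> rho [tuple x; x] /\ rho [tuple y; y],
      forall x y z, rho [tuple x; y] -> rho [tuple y; z] -> rho [tuple x; z],
      forall x y, rho [tuple x; y] -> rho [tuple y; x] -> x = y &
      forall x y, Rng rho x -> Rng rho y -> rho [tuple x; y] \/ rho [tuple y; x]].

(* The order isomorphism with [a] makes the strict part of [rho] a well-ordering
   of [Rng rho], of order type [a]. *)
Definition represents (rho : set (2.-tuple nat)) (a : ord_type) : Prop :=
  linear_ordering rho /\
  exists f : a -> nat,
    [/\ injective f, range f = Rng rho &
        forall x y, olt x y <-> rho [tuple f x; f y] /\ f x <> f y].

Definition definable_ordinal (L : set symbol) (a : ord_type) : Prop :=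
  exists rho, definable L rho /\ represents rho a.

(* [is_Ord L a] : a = Ord(L) *)
Definition is_Ord (L : set symbol) (a : ord_type) : Prop :=
  ~ definable_ordinal L a /\
  forall b : ord_type, ~ definable_ordinal L b -> ord_le a b.

(* The ordinals alpha <= lambda are the elements of [option lambda]: [Some x] is
   the order type of the elements below [x], and [None] is lambda itself. *)
Definition idx_lt (lambda : ord_type) (i j : option lambda) : Prop :=
  match i, j with
  | Some x, Some y => olt x y
  | Some _, None => True
  | None, _ => False
  end.

Definition is_zero (lambda : ord_type) (i : option lambda) : Prop :=
  forall j, ~ idx_lt j i.

Definition is_succ (lambda : ord_type) (i j : option lambda) : Prop :=
  idx_lt i j /\ forall k, ~ (idx_lt i k /\ idx_lt k j).

Definition is_limit (lambda : ord_type) (j : option lambda) : Prop :=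
  ~ is_zero j /\
  forall i, idx_lt i j -> exists k, idx_lt i k /\ idx_lt k j.

Record tarski_hierarchy (N : structure) (lambda : ord_type)
    (M : option lambda -> structure) : Prop := TarskiHierarchy {
  th_countable : countable (symbols N);
  th_zero : forall i, is_zero i -> symbols (M i) = symbols N;
  th_succ : forall i j, is_succ i j ->
    exists P : set (2.-tuple nat),
      canonic_universal (M i) P /\ symbols (M j) = add_pred (M i) P;
  th_limit : forall j, is_limit j ->
    symbols (M j) = \bigcup_(i in [set i | idx_lt i j]) symbols (M i);
  th_maximal : ~ exists P : set (2.-tuple nat), canonic_universal (M None) P
}.

(* Main.v *)
Require Import Defs.
From mathcomp Require Import all_boot.
From mathcomp Require Import boolp classical_sets functions cardinality.
From mathcomp Require Import zify.
From Stdlib Require Cantor.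

Set Implicit Arguments.
Unset Strict Implicit.
Unset Printing Implicit Defensive.

Local Open Scope classical_set_scope.

(** Why the theorem is true.

    Everything is done with number-coded formulas ([truth]) over the symbols of
    [N] and countably many further relations, the rows of an oracle; [dfn] says
    that one code defines a whole family of relations.  The formulas of the
    statement are translated into codes by [dfn_sat] and back by [dfn_scheme].

    Iterated truth.  Along a well-founded relation [r] definable in [N], truth can
    be iterated: row [c] is the truth predicate for [N] with the rows [d] such
    that [r d c] ([hierarchy]).  If [r] is a copy of an ordinal, then every level
    [M o] up to that ordinal, the ordinal included, has the same definable sets as
    the rows below [o] ([level_ok_all]), and it has a canonic universal predicate
    ([level_canonic]): the proper initial parts of the iteration are sections of
    every universal predicate for [M o], and the inductive clauses, which are
    first-order, recognize them among all sections, because well-foundedness makes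
    their solution unique.  Since the hierarchy stops at [lambda], the ordinal
    [lambda] is not definable in [N].

    The converse rests on a basis theorem, [class_basis]: if [M o] is a level whose
    ordinal is not definable in [N], and [X] is first-order definable from every
    member of some nonempty first-order class of sets, then [X] is definable in
    [M o].  The class is the set of branches of a definable tree of truth values
    with witnesses, and countably many definitions of [X] cover the branches, so by
    Baire category one definition is correct on a neighbourhood ([baire]).  There,
    no two branches disagree about any [m]; the tree of attempts to find such
    a pair is well-founded, and its Kleene-Brouwer order is a definable
    well-ordering, which must be shorter than [o] ([wellorder_below]).  A recursion
    along this order decides [X] ([rank_root]), and it is carried out inside [M o]
    ([rec_definable]).

    This gives the rest.  Let [o] be the first ordinal that is not definable.  The
    sets that satisfy [universal_class] form a first-order class, and each of them
    yields a universal predicate for [M o]; a canonic universal predicate would be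
    definable from each of them, hence in [M o], which diagonalization excludes
    ([undefinable_no_canonic]).  Therefore [o] is [lambda], and [lambda] is
    [Ord(N)]; it is countable, because the ordinals below it have definable copies.
    A set implicitly definable in [N] is definable from the only member of
    a first-order class, hence in [M lambda] ([implicit_definable]).  Conversely,
    a set definable in [M lambda] can be read off an iterated truth predicate along
    a definable well-ordering, which is the only solution of its inductive clauses
    ([top_implicit]). *)

(** * Coding pairs, sequences and valuations by numbers *)

Definition pr (a b : nat) : nat := Cantor.to_nat (a, b).
Definition p1 (x : nat) : nat := (Cantor.of_nat x).1.
Definition p2 (x : nat) : nat := (Cantor.of_nat x).2.

Lemma p1K a b : p1 (pr a b) = a.
Proof. by rewrite /p1 /pr Cantor.cancel_of_to. Qed.

Lemma p2K a b : p2 (pr a b) = b.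
Proof. by rewrite /p2 /pr Cantor.cancel_of_to. Qed.

Lemma prK x : pr (p1 x) (p2 x) = x.
Proof. by rewrite /pr /p1 /p2 -surjective_pairing Cantor.cancel_to_of. Qed.

Lemma prE a b : pr a b * 2 = b * 2 + (b + a) * (b + a).+1.
Proof. exact: (Cantor.to_nat_spec a b). Qed.

Lemma pr_ge a b : b + a <= pr a b.
Proof. by apply/leP; exact: (Cantor.to_nat_non_decreasing a b). Qed.

Lemma p1_le x : p1 x <= x.
Proof. by have := pr_ge (p1 x) (p2 x); rewrite prK; lia. Qed.

Lemma p2_le x : p2 x <= x.
Proof. by have := pr_ge (p1 x) (p2 x); rewrite prK; lia. Qed.

Lemma pr_inj a b c d : pr a b = pr c d -> a = c /\ b = d.
Proof. by move=> e; rewrite -(p1K a b) -{2}(p2K a b) e p1K p2K. Qed.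

Definition cns (a x : nat) : nat := (pr a x).+1.

Definition code (s : seq nat) : nat := foldr cns 0 s.

Definition tl (x : nat) : nat := p2 x.-1.

Lemma tl_cns a x : tl (cns a x) = x.
Proof. by rewrite /tl /cns p2K. Qed.

Lemma tl0 : tl 0 = 0.
Proof. by have := p2_le 0; rewrite /tl /=; lia. Qed.

Fixpoint dec_fuel (n x : nat) : seq nat :=
  match n, x with
  | n'.+1, y.+1 => p1 y :: dec_fuel n' (p2 y)
  | _, _ => [::]
  end.

Definition dec (x : nat) : seq nat := dec_fuel x x.

Lemma code_dec_fuel n x : x <= n -> code (dec_fuel n x) = x.
Proof.
elim: n x => [|n IH] [|x] //= le; rewrite IH ?prK ?/cns ?prK //.
by have := p2_le x; lia.
Qed.

Lemma decK x : code (dec x) = x.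
Proof. exact: code_dec_fuel. Qed.

Lemma code_inj : injective code.
Proof.
elim=> [|a s IH] [|b t] //= [] /pr_inj [-> e]; by rewrite (IH t).
Qed.

Lemma codeK s : dec (code s) = s.
Proof. by apply: code_inj; rewrite decK. Qed.

Lemma dec_cns a x : dec (cns a x) = a :: dec x.
Proof. by rewrite -{1}(decK x) -[cns a _]/(code (a :: dec x)) codeK. Qed.

Definition env (x i : nat) : nat := nth 0 (dec x) i.

Definition len (x : nat) : nat := size (dec x).

Lemma dec_tl x : dec (tl x) = behead (dec x).
Proof.
case: (posnP x) => [->|]; first by rewrite tl0.
rewrite -{1 2}(decK x); case: (dec x) => [|a s] //= _.
by rewrite tl_cns codeK.
Qed.

Lemma dec_iter_tl n x : dec (iter n tl x) = drop n (dec x).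
Proof.
by elim: n => [|n IH]; rewrite ?drop0 //= dec_tl IH -drop1 drop_drop.
Qed.

Lemma env_iter x i : env x i = p1 (iter i tl x).-1.
Proof.
rewrite /env -[i in LHS]addn0 -nth_drop -dec_iter_tl.
set y := iter i tl x; rewrite -{2}(decK y).
case: (dec y) => [|a s] /=; last by rewrite p1K.
by have := p1_le 0; lia.
Qed.

Lemma iter_tl_eq0 n x : (iter n tl x = 0) <-> (len x <= n).
Proof.
have E y : y = 0 <-> dec y = [::].
  by split=> [->|e] //; rewrite -(decK y) e.
rewrite E dec_iter_tl; split=> [e|]; last exact: drop_oversize.
by have := size_drop n (dec x); rewrite e /len /=; lia.
Qed.

Definition scons (a : nat) (v : nat -> nat) (i : nat) : nat :=
  if i is j.+1 then v j else a.

Lemma scons_eta v : scons (v 0) (fun i => v i.+1) = v.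
Proof. by apply/funext; case. Qed.

Lemma nth_scons a s : nth 0 (a :: s) = scons a (nth 0 s).
Proof. by apply/funext; case. Qed.

Lemma env_cns a x : env (cns a x) = scons a (env x).
Proof. by apply/funext=> i; rewrite /env dec_cns nth_scons. Qed.

Lemma env_code s : env (code s) = nth 0 s.
Proof. by apply/funext=> i; rewrite /env codeK. Qed.

Definition pre (f : nat -> nat) (n : nat) : nat := code (mkseq f n).

Lemma len_pre f n : len (pre f n) = n.
Proof. by rewrite /len /pre codeK size_mkseq. Qed.

Lemma env_pre f n k : k < n -> env (pre f n) k = f k.
Proof. by move=> lt; rewrite /pre env_code nth_mkseq. Qed.

Lemma pre_env x : pre (env x) (len x) = x.
Proof. by rewrite /pre /env /len mkseq_nth decK. Qed.

Lemma eq_pre f g n : (forall k, k < n -> f k = g k) -> pre f n = pre g n.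
Proof.
move=> e; congr code; apply: (@eq_from_nth _ 0); rewrite !size_mkseq // => i lt.
by rewrite !nth_mkseq ?e.
Qed.

(** * Truth of coded formulas *)

(** Every number is a code, so that the clauses of a truth definition need no
    syntactic side conditions.  The index [c] of the relation [P c] in an atom is
    part of the code; the argument list refers to the valuation with 0 put in
    front, which makes the constant 0 available. *)
Fixpoint truth_fuel (P : nat -> seq nat -> Prop) (n e : nat)
    (v : nat -> nat) : Prop :=
  match n, e with
  | n'.+1, e'.+1 =>
    let q := e' %/ 4 in
    match e' %% 4 with
    | 0 => ~ truth_fuel P n' q v
    | 1 => truth_fuel P n' (p1 q) v /\ truth_fuel P n' (p2 q) v
    | 2 => exists a, truth_fuel P n' q (scons a v)
    | _ => P (p1 q) (map (scons 0 v) (dec (p2 q)))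
    end
  | _, _ => False
  end.

Definition truth P e v := truth_fuel P e e v.

Definition cneg (q : nat) : nat := (q * 4).+1.
Definition cand (a b : nat) : nat := (pr a b * 4 + 1).+1.
Definition cex (q : nat) : nat := (q * 4 + 2).+1.
Definition catm (c l : nat) : nat := (pr c l * 4 + 3).+1.

Lemma truth_fuelE P n e v : e <= n -> truth_fuel P n e v = truth P e v.
Proof.
rewrite /truth; suff H m1 m2 : forall e v, e <= m1 -> e <= m2 ->
    truth_fuel P m1 e v = truth_fuel P m2 e v by move=> le; exact: H.
elim: m1 m2 => [|m1 IH] [|m2] [|e'] // u l1 l2 /=.
have ql : e' %/ 4 <= e' by lia.
have q1 := p1_le (e' %/ 4); have q2 := p2_le (e' %/ 4).
case: (e' %% 4) => [|[|[|?]]] //.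
- by rewrite (IH m2) //; lia.
- by rewrite (IH m2) ?(IH m2 (p2 _)) //; lia.
- by congr ex; apply/funext=> a; rewrite (IH m2) //; lia.
Qed.

Lemma truth0 P v : truth P 0 v = False. Proof. by []. Qed.

Lemma truth_neg P q v : truth P (cneg q) v = ~ truth P q v.
Proof.
rewrite /truth /cneg /= modnMl mulnK // truth_fuelE //; lia.
Qed.

Lemma truth_and P a b v :
  truth P (cand a b) v = (truth P a v /\ truth P b v).
Proof.
rewrite /truth /cand /= modnMDl divnMDl // addn0 p1K p2K.
by rewrite !truth_fuelE //; have := pr_ge a b; lia.
Qed.

Lemma truth_ex P q v : truth P (cex q) v = exists a, truth P q (scons a v).
Proof.
rewrite /truth /cex /= modnMDl divnMDl // addn0.
by congr ex; apply/funext=> a; rewrite truth_fuelE //; lia.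
Qed.

Lemma truth_atm P c l v :
  truth P (catm c l) v = P c (map (scons 0 v) (dec l)).
Proof. by rewrite /truth /catm /= modnMDl divnMDl // addn0 p1K p2K. Qed.

Definition truthE := (truth0, truth_neg, truth_and, truth_ex, truth_atm).

Lemma code_ind (K : nat -> Prop) :
  K 0 -> (forall q, K q -> K (cneg q)) ->
  (forall a b, K a -> K b -> K (cand a b)) ->
  (forall q, K q -> K (cex q)) -> (forall c l, K (catm c l)) ->
  forall e, K e.
Proof.
move=> k0 kn ka kx kt e.
have [n] := ubnP e; elim: n e => // n IH [|e] // lt.
have ql : e %/ 4 <= e by lia.
have q1 := p1_le (e %/ 4); have q2 := p2_le (e %/ 4).
have D := divn_eq e 4; move: (ltn_pmod e (isT : 0 < 4)) D.
have IH' q : q <= e %/ 4 -> K q by move=> ?; apply: IH; lia.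
case: (e %% 4) => [|[|[|[|?]]]] // _.
- by rewrite addn0 => ->; apply: kn; exact: IH'.
- by move=> ->; rewrite -(prK (e %/ 4)); apply: ka; exact: IH'.
- by move=> ->; apply: kx; exact: IH'.
- by move=> ->; rewrite -(prK (e %/ 4)); exact: kt.
Qed.

Lemma code_lt a b q : [/\ q < cneg q, a < cand a b, b < cand a b & q < cex q].
Proof. by have := pr_ge a b; split; rewrite /cneg /cand /cex; lia. Qed.

(** * Uniform definability *)

Definition oracle := nat -> nat -> nat -> Prop.

(** A finite language that contains arithmetic, with its symbols turned into
    relations on sequences (padded with zeros).  Finiteness and bounded arities
    are what makes [brow] itself definable, see [ndef_brow]. *)
Record base : Type := Base {
  brow : nat -> seq nat -> Prop;
  brow_fin : exists r, forall c y, r <= c -> ~ brow c y;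
  brow_arity : forall c, exists n, forall y,
    brow c y <-> brow c (mkseq (nth 0 y) n);
  brow_eq : exists c, forall y, brow c y <-> nth 0 y 0 = nth 0 y 1;
  brow_lt : exists c, forall y, brow c y <-> nth 0 y 0 < nth 0 y 1;
  brow_succ : exists c, forall y, brow c y <-> nth 0 y 0 = (nth 0 y 1).+1;
  brow_add : exists c, forall y,
    brow c y <-> nth 0 y 0 = nth 0 y 1 + nth 0 y 2;
  brow_mul : exists c, forall y,
    brow c y <-> nth 0 y 0 = nth 0 y 1 * nth 0 y 2
}.

(** The row index of an atom is a constant of the formula.  An oracle thus adds
    its rows as separate binary relations, without making the map from [c] to
    row [c] definable; the language at a limit level is of this kind. *)
Definition rows (B : base) (Z : oracle) (c : nat) (y : seq nat) : Prop :=
  if odd c then Z c./2 (nth 0 y 0) (nth 0 y 1) else brow B c./2 y.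

Section Dfn.
Variable B : base.

(** One code defines the whole family [X]; the index [i] is in applications a
    varying oracle, a tuple of second-order values, or trivial. *)
Definition dfn (I : Type) (Zf : I -> oracle) (X : I -> (nat -> nat) -> Prop) :=
  exists e, forall i v, X i v <-> truth (rows B (Zf i)) e v.

Definition dff (I : Type) (Zf : I -> oracle) (F : I -> (nat -> nat) -> nat) :=
  dfn Zf (fun i v => v 0 = F i (fun k => v k.+1)).

Section Closure.
Variables (I : Type) (Zf : I -> oracle).
Notation dfn := (dfn Zf).
Notation dff := (dff Zf).

Lemma dfn_truth e : dfn (fun i v => truth (rows B (Zf i)) e v).
Proof. by exists e. Qed.

Lemma dfn_ext X Y : (forall i v, X i v <-> Y i v) -> dfn X -> dfn Y.
Proof. by move=> h [e he]; exists e => i v; rewrite -he -h. Qed.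

Lemma dfn_not X : dfn X -> dfn (fun i v => ~ X i v).
Proof. by case=> e he; exists (cneg e) => i v; rewrite truth_neg he. Qed.

Lemma dfn_and X Y : dfn X -> dfn Y -> dfn (fun i v => X i v /\ Y i v).
Proof.
by case=> e he [d hd]; exists (cand e d) => i v; rewrite truth_and he hd.
Qed.

Lemma dfn_ex (Q : I -> nat -> (nat -> nat) -> Prop) :
  dfn (fun i v => Q i (v 0) (fun k => v k.+1)) ->
  dfn (fun i v => exists a, Q i a v).
Proof.
case=> e he; exists (cex e) => i v; rewrite truth_ex.
by split=> -[a h]; exists a; [rewrite -he | move: h; rewrite -he].
Qed.

Lemma dfn_or X Y : dfn X -> dfn Y -> dfn (fun i v => X i v \/ Y i v).
Proof.
move=> hX hY.
apply: (dfn_ext _ (dfn_not (dfn_and (dfn_not hX) (dfn_not hY)))) => i v.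
by rewrite -not_orP notK.
Qed.

Lemma dfn_imp X Y : dfn X -> dfn Y -> dfn (fun i v => X i v -> Y i v).
Proof.
move=> hX hY; apply: (dfn_ext _ (dfn_or (dfn_not hX) hY)) => i v.
by rewrite implyE.
Qed.

Lemma dfn_iff X Y : dfn X -> dfn Y -> dfn (fun i v => X i v <-> Y i v).
Proof. by move=> hX hY; apply: dfn_and; apply: dfn_imp. Qed.

Lemma dfn_all (Q : I -> nat -> (nat -> nat) -> Prop) :
  dfn (fun i v => Q i (v 0) (fun k => v k.+1)) ->
  dfn (fun i v => forall a, Q i a v).
Proof.
move=> h; have := dfn_not (@dfn_ex (fun i a v => ~ Q i a v) (dfn_not h)).
apply: dfn_ext => i v; split=> [H a|H [a]]; last exact.
by apply: contrapT => n; apply: H; exists a.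
Qed.

(** Renaming acts on the argument lists of the atoms. *)
Lemma dfn_rename X (r : nat -> nat) :
  dfn X -> dfn (fun i v => X i (fun k => v (r k))).
Proof.
case=> e he.
suff [d hd] : exists d, forall i v, truth (rows B (Zf i)) d v <->
    truth (rows B (Zf i)) e (fun k => v (r k)).
  by exists d => i v; rewrite hd he.
elim/code_ind: e r {X he} => [|q IH|a b IHa IHb|q IH|c l] r.
- by exists 0.
- by have [d hd] := IH r; exists (cneg d) => i v; rewrite !truthE hd.
- have [d hd] := IHa r; have [d' hd'] := IHb r.
  by exists (cand d d') => i v; rewrite !truthE hd hd'.
- have [d hd] := IH (fun k => if k is j.+1 then (r j).+1 else 0).
  exists (cex d) => i v; rewrite !truthE.
  have E a : scons a (fun k => v (r k)) =
      (fun k => scons a v (if k is j.+1 then (r j).+1 else 0)).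
    by apply/funext; case.
  by split=> -[a]; exists a; [rewrite E -hd | rewrite hd -E].
- pose r' k := if k is j.+1 then (r j).+1 else 0.
  exists (catm c (code (map r' (dec l)))) => i v; rewrite !truthE codeK.
  rewrite -map_comp (@eq_map _ _ _ (scons 0 (fun k => v (r k)))) //.
  by case.
Qed.

Lemma dff_lift F : dff F -> dff (fun i v => F i (fun k => v k.+1)).
Proof.
pose r k := if k is j.+1 then j.+2 else 0.
move=> h; apply: (dfn_ext _ (dfn_rename r h)) => i v /=.
by rewrite /r.
Qed.

Lemma dfn_sub1 (Q : I -> nat -> (nat -> nat) -> Prop) F :
  dfn (fun i v => Q i (v 0) (fun k => v k.+1)) -> dff F ->
  dfn (fun i v => Q i (F i v) v).
Proof.
move=> hQ hF; have := @dfn_ex (fun i a v => a = F i v /\ Q i a v)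
  (dfn_and hF hQ).
by apply: dfn_ext => i v; split=> [[a [->]] //|h]; exists (F i v).
Qed.

Lemma dfn_atom_aux c (Fs : seq (I -> (nat -> nat) -> nat)) (l : seq nat) :
  foldr and True (map dff Fs) ->
  dfn (fun i v => rows B (Zf i) c
    (map (scons 0 v) l ++ map (fun F => F i v) Fs)).
Proof.
elim: {Fs}(size Fs) {-2}Fs (erefl (size Fs)) l => [|n IH] [|F Fs] // sz l.
  move=> _; exists (catm c (code l)) => i v.
  by rewrite truth_atm codeK cats0.
case: sz => sz [hF hFs].
pose up (G : I -> (nat -> nat) -> nat) i (v : nat -> nat) := G i (fun k => v k.+1).
pose r k := if k is j.+1 then j.+2 else 0.
have hFs' : foldr and True (map dff (map up Fs)).
  elim: Fs hFs {IH sz} => //= G Fs IH [hG hFs]; split; last exact: IH.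
  exact: dff_lift.
have := IH (map up Fs) _ (map r l ++ [:: 1]) hFs'.
rewrite size_map => /(_ sz) h.
have := @dfn_sub1 (fun i a v => rows B (Zf i) c
  (map (scons 0 v) l ++ a :: map (fun F => F i v) Fs)) F _ hF.
apply; apply: dfn_ext h => i v.
rewrite map_cat -catA /= -!map_comp.
suff -> : [seq (scons 0 v \o r) i0 | i0 <- l] =
          [seq scons 0 (fun k => v k.+1) i0 | i0 <- l] by [].
by apply: eq_map; case.
Qed.

Lemma dfn_atom c (Fs : seq (I -> (nat -> nat) -> nat)) :
  foldr and True (map dff Fs) ->
  dfn (fun i v => rows B (Zf i) c (map (fun F => F i v) Fs)).
Proof. exact: (@dfn_atom_aux c Fs [::]). Qed.

Lemma dfn_base (R : seq nat -> Prop) :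
  (exists c, forall y, brow B c y <-> R y) ->
  exists c, forall i y, rows B (Zf i) c y <-> R y.
Proof.
case=> c hc; exists c.*2 => i y.
by rewrite /rows odd_double doubleK.
Qed.

Lemma dfn_eqv j k : dfn (fun i v => v j = v k).
Proof.
have [c hc] := dfn_base (brow_eq B).
exists (catm c (code [:: j.+1; k.+1])) => i v.
by rewrite truth_atm codeK hc.
Qed.

Lemma dff0 : dff (fun i v => 0).
Proof.
have [c hc] := dfn_base (brow_eq B).
exists (catm c (code [:: 1; 0])) => i v.
by rewrite truth_atm codeK hc.
Qed.

Lemma dff_var k : dff (fun i v => v k).
Proof. exact: dfn_eqv. Qed.

Lemma dfn_subst X (F : nat -> I -> (nat -> nat) -> nat) :
  dfn X -> (forall k, dff (F k)) -> dfn (fun i v => X i (fun k => F k i v)).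
Proof.
case=> e he hF.
apply: (dfn_ext (X := fun i v => truth (rows B (Zf i)) e (fun k => F k i v))).
  by move=> i v; rewrite he.
elim/code_ind: e F hF {X he} => [|q IH|a b IHa IHb|q IH|c l] F hF.
- by exists 0.
- by apply: dfn_ext (dfn_not (IH F hF)) => i v; rewrite truthE.
- by apply: dfn_ext (dfn_and (IHa F hF) (IHb F hF)) => i v; rewrite truthE.
- pose F' k i v := if k is j.+1 then F j i (fun k => v k.+1) else v 0.
  have hF' k : dff (F' k).
    by case: k => [|k]; [exact: dff_var | exact: dff_lift].
  pose Q i a v := truth (rows B (Zf i)) q (scons a (fun k => F k i v)).
  apply: (@dfn_ext (fun i v => exists a, Q i a v)).
    by move=> i v; rewrite truthE.
  apply: dfn_ex; apply: dfn_ext (IH F' hF') => i v; rewrite /Q.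
  by rewrite (_ : scons _ _ = fun k => F' k i v) //; apply/funext; case.
- have := @dfn_atom c (map (fun k i v => scons 0 (fun k => F k i v) k)
    (dec l)) _.
  move=> H; apply: dfn_ext (H _) => [i v|].
    by rewrite truthE -map_comp.
  elim: (dec l) => //= k s IHs; split=> //; case: k => [|k]; last exact: hF.
  exact: dff0.
Qed.

End Closure.
End Dfn.

Definition udfn (B : base) (X : oracle -> (nat -> nat) -> Prop) : Prop :=
  dfn B id X.

Definition ndef (B : base) (X : (nat -> nat) -> Prop) : Prop :=
  udfn B (fun _ v => X v).

Section Apply.
Variables (B : base) (I : Type) (Zf : I -> oracle).
Notation dfn := (dfn B Zf).
Notation dff := (dff B Zf).
Implicit Types F G K : I -> (nat -> nat) -> nat.

Lemma dfn_pull (X : oracle -> (nat -> nat) -> Prop) :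
  udfn B X -> dfn (fun i v => X (Zf i) v).
Proof. by case=> e he; exists e. Qed.

Lemma dfn_app (X : oracle -> (nat -> nat) -> Prop) F G K :
  udfn B X -> dff F -> dff G -> dff K ->
  dfn (fun i v => X (Zf i) (scons (F i v) (scons (G i v) (fun _ => K i v)))).
Proof.
move=> hX hF hG hK.
pose A k := match k with 0 => F | 1 => G | _ => K end.
apply: dfn_ext (@dfn_subst _ _ _ _ A (dfn_pull hX) _) => [i v|].
  by rewrite (_ : scons _ _ = fun k => A k i v) //; apply/funext=> -[|[|k]].
by move=> [|[|k]].
Qed.

Lemma dfn_pred1 (R : nat -> Prop) F :
  ndef B (fun v => R (v 0)) -> dff F -> dfn (fun i v => R (F i v)).
Proof. by move=> hR hF; exact: (dfn_app hR hF hF hF). Qed.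

Lemma dfn_rel2 (R : nat -> nat -> Prop) F G :
  ndef B (fun v => R (v 0) (v 1)) -> dff F -> dff G ->
  dfn (fun i v => R (F i v) (G i v)).
Proof. by move=> hR hF hG; exact: (dfn_app hR hF hG hG). Qed.

Lemma dfn_rel3 (R : nat -> nat -> nat -> Prop) F G K :
  ndef B (fun v => R (v 0) (v 1) (v 2)) -> dff F -> dff G -> dff K ->
  dfn (fun i v => R (F i v) (G i v) (K i v)).
Proof. by move=> hR hF hG hK; exact: (dfn_app hR hF hG hK). Qed.

Lemma dff_fun1 (g : nat -> nat) F :
  ndef B (fun v => v 0 = g (v 1)) -> dff F -> dff (fun i v => g (F i v)).
Proof.
move=> hg hF; apply: (@dfn_rel2 (fun a b => a = g b)) => //; first exact: dff_var.
exact: dff_lift.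
Qed.

Lemma dff_fun2 (g : nat -> nat -> nat) F G :
  ndef B (fun v => v 0 = g (v 1) (v 2)) -> dff F -> dff G ->
  dff (fun i v => g (F i v) (G i v)).
Proof.
move=> hg hF hG; apply: (@dfn_rel3 (fun a b c => a = g b c)) => //.
- exact: dff_var.
- exact: dff_lift.
- exact: dff_lift.
Qed.

Lemma dfn_eq F G : dff F -> dff G -> dfn (fun i v => F i v = G i v).
Proof. by apply: (@dfn_rel2 eq); exact: dfn_eqv. Qed.

Lemma dfn_lt F G : dff F -> dff G -> dfn (fun i v => F i v < G i v).
Proof.
apply: (@dfn_rel2 (fun a b => a < b)).
have [c hc] := dfn_base id (brow_lt B).
by exists (catm c (code [:: 1; 2])) => i v; rewrite truth_atm codeK hc.
Qed.

Lemma dff_succ F : dff F -> dff (fun i v => (F i v).+1).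
Proof.
apply: dff_fun1; have [c hc] := dfn_base id (brow_succ B).
by exists (catm c (code [:: 1; 2])) => i v; rewrite truth_atm codeK hc.
Qed.

Lemma dff_add F G : dff F -> dff G -> dff (fun i v => F i v + G i v).
Proof.
apply: dff_fun2; have [c hc] := dfn_base id (brow_add B).
by exists (catm c (code [:: 1; 2; 3])) => i v; rewrite truth_atm codeK hc.
Qed.

Lemma dff_mul F G : dff F -> dff G -> dff (fun i v => F i v * G i v).
Proof.
apply: dff_fun2; have [c hc] := dfn_base id (brow_mul B).
by exists (catm c (code [:: 1; 2; 3])) => i v; rewrite truth_atm codeK hc.
Qed.

Lemma dfn_le F G : dff F -> dff G -> dfn (fun i v => F i v <= G i v).
Proof. by move=> hF hG; apply: dfn_ext (dfn_lt hF (dff_succ hG)). Qed.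

Lemma dff_const n : dff (fun _ _ => n).
Proof. by elim: n => [|n IH]; [exact: dff0 | exact: dff_succ]. Qed.

Lemma dfn_true : dfn (fun _ _ => True).
Proof. by apply: dfn_ext (dfn_eqv _ _ 0 0). Qed.

Lemma dfn_false : dfn (fun _ _ => False).
Proof. by apply: dfn_ext (dfn_not dfn_true) => i v; split. Qed.

Lemma dfn_const (A : Prop) : dfn (fun _ _ => A).
Proof.
case: (pselect A) => a; first by apply: dfn_ext dfn_true.
by apply: dfn_ext dfn_false.
Qed.

Lemma dfn_oracle c F G : dff F -> dff G ->
  dfn (fun i v => Zf i c (F i v) (G i v)).
Proof.
move=> hF hG.
apply: dfn_ext (@dfn_atom _ _ Zf c.*2.+1 [:: F; G] _) => // i v.
by rewrite /rows /= odd_double /= uphalf_double.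
Qed.

End Apply.

(** Definability goals are proved by recursion on the shape of the formula.
    These hooks are redefined when lemmas about further operations become
    available. *)
Ltac dfn_pair := fail.
Ltac dfn_list := fail.
Ltac dfn_syntax := fail.

Ltac dfn_step :=
  cbn beta;
  first
  [ assumption
  | match goal with
    | |- dfn _ _ (fun i v => _ /\ _) => apply: dfn_and
    | |- dfn _ _ (fun i v => _ \/ _) => apply: dfn_or
    | |- dfn _ _ (fun i v => ~ _) => apply: dfn_not
    | |- dfn _ _ (fun i v => _ <-> _) => apply: dfn_iff
    | |- dfn _ _ (fun i v => _ -> _) => apply: dfn_imp
    | |- dfn _ _ (fun i v => forall _, _) => apply: dfn_all
    | |- dfn _ _ (fun i v => exists _, _) => apply: dfn_ex
    | |- dfn _ _ (fun i v => is_true (_ < _)) => apply: dfn_lt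
    | |- dfn _ _ (fun i v => is_true (_ <= _)) => apply: dfn_le
    | |- dfn _ _ (fun i v => @eq nat _ _) => apply: dfn_eq
    | |- ndef _ _ => rewrite /ndef
    | |- udfn _ _ => rewrite /udfn
    end
  | match goal with
    | |- dff _ _ (fun i v => v _) => apply: dff_var
    | |- dff _ _ (fun i v => S _) => apply: dff_succ
    | |- dff _ _ (fun i v => _ + _) => apply: dff_add
    | |- dff _ _ (fun i v => _ * _) => apply: dff_mul
    end
  | dfn_pair
  | dfn_list
  | dfn_syntax
  | match goal with
    | |- dff _ _ _ => solve [apply: dff_const]
    | |- dfn _ _ _ => solve [apply: dfn_const]
    end ].
Ltac dfn_tac := repeat dfn_step.


Lemma dff_pr B I (Zf : I -> oracle) F G : dff B Zf F -> dff B Zf G ->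
  dff B Zf (fun i v => pr (F i v) (G i v)).
Proof.
apply: dff_fun2.
apply: (@dfn_ext _ _ _ (fun _ v =>
  v 0 * 2 = v 2 * 2 + (v 2 + v 1) * (v 2 + v 1).+1)); last by dfn_tac.
move=> _ v; split=> [e|->]; last exact: prE.
by have := prE (v 1) (v 2); lia.
Qed.

Ltac dfn_pair ::= match goal with
  | |- dff _ _ (fun i v => pr _ _) => apply: dff_pr
  end.

Lemma dff_p1 B I (Zf : I -> oracle) F :
  dff B Zf F -> dff B Zf (fun i v => p1 (F i v)).
Proof.
apply: dff_fun1.
apply: (@dfn_ext _ _ _ (fun _ v => exists b, v 1 = pr (v 0) b)); last by dfn_tac.
move=> _ v; split=> [[b ->]|->]; first by rewrite p1K.
by exists (p2 (v 1)); rewrite prK.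
Qed.

Lemma dff_p2 B I (Zf : I -> oracle) F :
  dff B Zf F -> dff B Zf (fun i v => p2 (F i v)).
Proof.
apply: dff_fun1.
apply: (@dfn_ext _ _ _ (fun _ v => exists b, v 1 = pr b (v 0))); last by dfn_tac.
move=> _ v; split=> [[b ->]|->]; first by rewrite p2K.
by exists (p1 (v 1)); rewrite prK.
Qed.

Lemma dff_pred B I (Zf : I -> oracle) F :
  dff B Zf F -> dff B Zf (fun i v => (F i v).-1).
Proof.
apply: dff_fun1; apply: (@dfn_ext _ _ _ (fun _ v => v 1 = (v 0).+1 \/
  v 1 = 0 /\ v 0 = 0)); last by dfn_tac.
by move=> _ v; split; lia.
Qed.

Lemma dff_cns B I (Zf : I -> oracle) F G : dff B Zf F -> dff B Zf G ->
  dff B Zf (fun i v => cns (F i v) (G i v)).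
Proof. by move=> hF hG; rewrite /cns; dfn_tac. Qed.

Ltac dfn_pair ::= match goal with
  | |- dff _ _ (fun i v => pr _ _) => apply: dff_pr
  | |- dff _ _ (fun i v => p1 _) => apply: dff_p1
  | |- dff _ _ (fun i v => p2 _) => apply: dff_p2
  | |- dff _ _ (fun i v => cns _ _) => apply: dff_cns
  | |- dff _ _ (fun i v => _.-1) => apply: dff_pred
  end.

Lemma dff_tl B I (Zf : I -> oracle) F :
  dff B Zf F -> dff B Zf (fun i v => tl (F i v)).
Proof. by move=> hF; rewrite /tl; dfn_tac. Qed.

(** Goedel's coding of finite sets: [j] is in the set coded by [<m, <c, d>>]
    when [j < m] and [1 + (j + 1) * d] divides [c]. *)
Definition fmem (j w : nat) : Prop :=
  j < p1 w /\ exists k, k * (j.+1 * p2 (p2 w)).+1 = p1 (p2 w).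

Lemma coprime_goedel m j k : j < m -> k < m -> j != k ->
  coprime (j.+1 * m`!).+1 (k.+1 * m`!).+1.
Proof.
wlog lt : j k / j < k => [H jm km ne|jm km _].
  by case: (ltngtP j k) ne => // lt _; [|rewrite coprime_sym]; apply: H => //; lia.
rewrite /coprime; set g := gcdn _ _.
have gj : g %| (j.+1 * m`!).+1 by exact: dvdn_gcdl.
have gk : g %| (k.+1 * m`!).+1 by exact: dvdn_gcdr.
have cop : coprime g m`!.
  have : coprime (j.+1 * m`!).+1 m`!.
    by rewrite -addn1 /coprime gcdnC gcdnMDl gcdn1.
  exact: coprime_dvdl.
have : g %| (k - j) * m`!.
  have -> : (k - j) * m`! = (k.+1 * m`!).+1 - (j.+1 * m`!).+1.
    by rewrite subSS -mulnBl subSS.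
  exact: dvdn_sub.
rewrite Gauss_dvdl // => gd.
have gf : g %| m`!.
  apply: dvdn_trans gd _; apply: dvdn_fact; lia.
by move: cop; rewrite /coprime (gcdn_idPl gf).
Qed.

Lemma fmem_surj (m : nat) (Q : pred nat) :
  exists w, forall j, fmem j w <-> j < m /\ Q j.
Proof.
pose c := \prod_(j < m | Q j) (j.+1 * m`!).+1.
exists (pr m (pr c m`!)) => j; rewrite /fmem !(p1K, p2K).
have H : (exists k, k * (j.+1 * m`!).+1 = c) <-> (j.+1 * m`!).+1 %| c.
  by split=> [[k e]|/dvdnP [k e]]; [apply/dvdnP; exists k | exists k].
split=> -[jm].
  move/H => d; split=> //; apply: contraT => nQ.
  have : coprime (j.+1 * m`!).+1 c.
    rewrite /c; elim/big_ind: _ => [|a b|i Qi]; first exact: coprimen1.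
      by rewrite coprimeMr => -> ->.
    apply: coprime_goedel => //; apply/eqP=> e.
    by move: nQ; rewrite e Qi.
  rewrite /coprime (gcdn_idPl d) => /eqP [].
  by have := fact_gt0 m; nia.
move=> Qj; split=> //; apply/H.
by rewrite /c (bigD1 (Ordinal jm)) //= dvdn_mulr.
Qed.

(** The graph of the recursion is contained in every coded set that contains its
    start and is closed under its steps, and it is itself such a set. *)
Lemma dff_iter B (g : nat -> nat) I (Zf : I -> oracle) F G :
  ndef B (fun v => v 0 = g (v 1)) -> dff B Zf F -> dff B Zf G ->
  dff B Zf (fun i v => iter (F i v) g (G i v)).
Proof.
move=> hg; apply: (@dff_fun2 _ _ _ (fun n x => iter n g x)).
apply: (@dfn_ext _ _ _ (fun _ v => forall w, fmem (pr 0 (v 2)) w ->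
  (forall i a, i < v 1 -> fmem (pr i a) w -> fmem (pr i.+1 (g a)) w) ->
  fmem (pr (v 1) (v 0)) w)); last first.
  have h J (Zg : J -> oracle) F' : dff B Zg F' -> dff B Zg (fun i v => g (F' i v)).
    by move=> hF'; apply: (dff_fun1 hg).
  rewrite /fmem; dfn_tac; apply: h; dfn_tac.
move=> _ v; move: (v 0) (v 1) (v 2) => y n x; split=> [H|-> w w0 ws]; last first.
  elim: {-2}n (leqnn n) => //= k IH kn.
  by apply: ws => //; apply: IH; lia.
pose m := (\sum_(i < n.+1) pr i (iter i g x)).+1.
have [w hw] := fmem_surj m
  (fun j => (p1 j <= n) && (p2 j == iter (p1 j) g x)).
have bd i : i <= n -> pr i (iter i g x) < m.
  move=> le; rewrite /m ltnS (bigD1 (inord i)) //= inordK ?ltnS //.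
  exact: leq_addr.
have h0 : fmem (pr 0 x) w.
  by apply/hw; rewrite p1K p2K eqxx; split=> //; exact: (bd 0).
have hs i a : i < n -> fmem (pr i a) w -> fmem (pr i.+1 (g a)) w.
  move=> lt; rewrite !hw !p1K !p2K => -[_ /andP [_ /eqP ->]].
  by rewrite /= eqxx lt; split=> //; apply: (bd i.+1).
by have /hw [_] := H w h0 hs; rewrite p1K p2K => /andP [_ /eqP].
Qed.

Lemma dff_env B I (Zf : I -> oracle) F G : dff B Zf F -> dff B Zf G ->
  dff B Zf (fun i v => env (F i v) (G i v)).
Proof.
apply: dff_fun2; apply: (@dfn_ext _ _ _ (fun _ v =>
  v 0 = p1 (iter (v 2) tl (v 1)).-1)) => [_ v|]; first by rewrite env_iter.
dfn_tac; apply: dff_iter; dfn_tac; apply: dff_tl; dfn_tac.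
Qed.

Lemma dff_len B I (Zf : I -> oracle) F : dff B Zf F ->
  dff B Zf (fun i v => len (F i v)).
Proof.
apply: dff_fun1; apply: (@dfn_ext _ _ _ (fun _ v =>
  forall n, v 0 <= n <-> iter n tl (v 1) = 0)) => [_ v|].
  split=> [H|-> n]; last by split=> /iter_tl_eq0.
  apply/eqP; rewrite eqn_leq; apply/andP; split.
    by apply/H/iter_tl_eq0.
  by apply/iter_tl_eq0/H.
dfn_tac; apply: dff_iter; dfn_tac; apply: dff_tl; dfn_tac.
Qed.

Ltac dfn_list ::= match goal with
  | |- dff _ _ (fun i v => env _ _) => apply: dff_env
  | |- dff _ _ (fun i v => len _) => apply: dff_len
  end.

(** * Substituting definable sets for oracles *)

Section SubstOracle.
Variables (B : base) (I : Type) (Zf : I -> oracle).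

Lemma dff_nth_args (l : seq nat) j :
  dff B Zf (fun i v => nth 0 (map (scons 0 v) l) j).
Proof.
case: (ltnP j (size l)) => h; last first.
  by rewrite /dff; under eq_fun do under eq_fun do
    rewrite nth_default ?size_map //; exact: dff_const.
rewrite /dff; under eq_fun do under eq_fun do rewrite (nth_map 0) //.
case: (nth 0 l j) => [|k] /=; first exact: dff_const.
exact: dff_var.
Qed.

Lemma dfn_subst_oracle (X : oracle -> (nat -> nat) -> Prop)
    (Y : I -> (nat -> nat) -> oracle) :
  udfn B X ->
  (forall c, dfn B Zf (fun i v => Y i (fun k => v k.+2) c (v 0) (v 1))) ->
  dfn B Zf (fun i v => X (Y i v) v).
Proof.
case=> e he hY.
apply: (@dfn_ext _ _ _ (fun i v => truth (rows B (Y i v)) e v)).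
  by move=> i v; rewrite he.
elim/code_ind: e Y hY {X he} => [|q IH|a b IHa IHb|q IH|c l] Y hY.
- by exists 0.
- by apply: dfn_ext (dfn_not (IH Y hY)) => i v; rewrite truthE.
- by apply: dfn_ext (dfn_and (IHa Y hY) (IHb Y hY)) => i v; rewrite truthE.
- pose Q i a v := truth (rows B (Y i v)) q (scons a v).
  apply: (@dfn_ext _ _ _ (fun i v => exists a, Q i a v)).
    by move=> i v; rewrite truthE.
  apply: dfn_ex; rewrite /Q.
  have := IH (fun i v => Y i (fun k => v k.+1)).
  move=> H; apply: dfn_ext (H _) => [i v|d]; first by rewrite scons_eta.
  exact: (dfn_rename (fun k => match k with 0 => 0 | 1 => 1 | k'.+2 => k'.+3 end)
            (hY d)).
- case oc: (odd c); last first.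
    exists (catm c l) => i v; rewrite !truthE /rows oc.
    by [].
  pose F k (i : I) v := match k with
    | 0 => nth 0 (map (scons 0 v) (dec l)) 0
    | 1 => nth 0 (map (scons 0 v) (dec l)) 1
    | k'.+2 => v k' end.
  apply: dfn_ext (@dfn_subst _ _ _ _ F (hY c./2) _) => [i v|].
    by rewrite truthE /rows oc.
  by move=> [|[|k]]; rewrite /F; [exact: dff_nth_args | exact: dff_nth_args |
    exact: dff_var].
Qed.

(** Used for conditions on the sections of a universal predicate, which vary with
    the valuation. *)
Lemma dfn_sets (Phi : (nat -> Prop) -> (nat -> Prop) -> nat -> Prop)
    (Y Y' : I -> (nat -> nat) -> nat -> Prop) F :
  udfn B (fun Z v => Phi (fun w => Z 0 w 0) (fun w => Z 1 w 0) (v 0)) ->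
  dfn B Zf (fun i v => Y i (fun k => v k.+1) (v 0)) ->
  dfn B Zf (fun i v => Y' i (fun k => v k.+1) (v 0)) ->
  dff B Zf F ->
  dfn B Zf (fun i v => Phi (Y i v) (Y' i v) (F i v)).
Proof.
move=> hPhi hY hY' hF.
pose A k := if k is k'.+1 then fun (i : I) v => v k' else F.
have hA k : dff B Zf (A k) by case: k => [|k] //; exact: dff_var.
pose O i (v : nat -> nat) c a (b : nat) :=
  if c == 0 then Y i (fun k => v k.+1) a else Y' i (fun k => v k.+1) a.
have := @dfn_subst_oracle _ O hPhi.
move=> H; apply: (dfn_subst (H _) hA) => c; rewrite /O.
pose r k := if k is k'.+1 then k'.+3 else 0.
case: (c == 0); last exact: (dfn_rename r hY').
exact: (dfn_rename r hY).
Qed.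

End SubstOracle.

Lemma dfn_oracle_id B c F G :
  dff B id F -> dff B id G -> dfn B id (fun Z v => Z c (F Z v) (G Z v)).
Proof. exact: (@dfn_oracle B oracle id). Qed.

(** * Truth definitions *)

Section Arguments.
Variable B : base.

(** The arguments, coded by [l], of an atom evaluated at the valuation coded
    by [x]. *)
Definition lookup (l x : nat) : nat := code (map (scons 0 (env x)) (dec l)).

Lemma dec_lookup l x : dec (lookup l x) = map (scons 0 (env x)) (dec l).
Proof. exact: codeK. Qed.

Lemma dff_lookup I (Zf : I -> oracle) F G : dff B Zf F -> dff B Zf G ->
  dff B Zf (fun i v => lookup (F i v) (G i v)).
Proof.
apply: dff_fun2; apply: (@dfn_ext _ _ _ (fun _ v => len (v 0) = len (v 1) /\
  forall k, k < len (v 1) -> (env (v 1) k = 0 /\ env (v 0) k = 0) \/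
    exists j, env (v 1) k = j.+1 /\ env (v 0) k = env (v 2) j));
  last by dfn_tac.
move=> _ v; move: (v 0) (v 1) (v 2) => z l x.
have E k : k < len l -> nth 0 (map (scons 0 (env x)) (dec l)) k =
    scons 0 (env x) (env l k) by move=> lt; rewrite (nth_map 0).
split=> [[le H]|->].
  rewrite -(decK z); congr code; apply: (@eq_from_nth _ 0).
    by rewrite size_map.
  move=> k; rewrite [size _]le => lt; rewrite E //.
  by case: (H k lt) => [[-> e]|[j [-> e]]].
rewrite /len dec_lookup size_map; split=> // k lt.
rewrite {2 4}/env dec_lookup E //.
by case: (env l k) => [|j]; [left | right; exists j].
Qed.

Lemma ndef_brow : ndef B (fun v => brow B (v 0) (dec (v 1))).
Proof.
have [r hr] := brow_fin B.
suff H n : ndef B (fun v => v 0 < n /\ brow B (v 0) (dec (v 1))).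
  apply: dfn_ext (H r) => _ v; split=> [[] //|h]; split=> //.
  by case: ltnP => // le; case: (hr _ (dec (v 1)) le).
elim: n => [|n IH]; first by apply: dfn_ext (dfn_false _ _) => _ v; split=> [|[]].
apply: (@dfn_ext _ _ _ (fun _ v => (v 0 < n /\ brow B (v 0) (dec (v 1))) \/
  (v 0 = n /\ brow B n (dec (v 1))))).
  move=> _ v; split=> [[[lt h]|[-> h]]|[lt h]]; try by split=> //; lia.
  move: lt; rewrite ltnS leq_eqVlt => /orP [/eqP e|lt]; last by left.
  by right; rewrite e in h.
apply: dfn_or => //; apply: dfn_and; first by dfn_tac.
have [m hm] := brow_arity B n.
pose Fs := map (fun k (_ : oracle) (v : nat -> nat) => env (v 1) k) (iota 0 m).
apply: dfn_ext (@dfn_atom _ _ id n.*2 Fs _).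
  move=> Z v; rewrite /rows odd_double doubleK /Fs -map_comp (hm (dec _)).
  by [].
by rewrite /Fs; elim: (iota 0 m) => //= k s IHs; split=> //; dfn_tac.
Qed.

Lemma dfn_brow I (Zf : I -> oracle) F G : dff B Zf F -> dff B Zf G ->
  dfn B Zf (fun i v => brow B (F i v) (dec (G i v))).
Proof. exact: (dfn_rel2 (R := fun c y => brow B c (dec y)) ndef_brow). Qed.

End Arguments.

Ltac dfn_syntax ::= match goal with
  | |- dff _ _ (fun i v => lookup _ _) => apply: dff_lookup
  | |- dfn _ _ (fun i v => brow _ _ (dec _)) => apply: dfn_brow
  | |- dfn _ _ (fun i v => i _ _ _) => apply: dfn_oracle_id
  end.

Section Tarski.
Variable B : base.

(** Tarski's inductive clauses, where [W e x] stands for the truth of [e] at the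
    valuation coded by [x].  The bound [n] on the codes is there because a level
    defines the parts of its truth predicate for boundedly many codes, but not
    the truth predicate itself. *)
Definition tarski (Z : oracle) (n : nat) (W : nat -> nat -> Prop) : Prop :=
  (forall x, ~ W 0 x) /\
  (forall q x, cneg q <= n -> (W (cneg q) x <-> ~ W q x)) /\
  (forall a b x, cand a b <= n -> (W (cand a b) x <-> W a x /\ W b x)) /\
  (forall q x, cex q <= n -> (W (cex q) x <-> exists a, W q (cns a x))) /\
  (forall c l x, catm (c + c) l <= n ->
     (W (catm (c + c) l) x <-> brow B c (dec (lookup l x)))) /\
  (forall c l x, catm (c + c).+1 l <= n ->
     (W (catm (c + c).+1 l) x <-> Z c (env (lookup l x) 0) (env (lookup l x) 1))).

Lemma rows_even Z c y : rows B Z (c + c) y = brow B c y.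
Proof. by rewrite /rows addnn odd_double doubleK. Qed.

Lemma rows_odd Z c y : rows B Z (c + c).+1 y = Z c (nth 0 y 0) (nth 0 y 1).
Proof. by rewrite /rows /= addnn odd_double /= uphalf_double. Qed.

Lemma tarski_truth Z n W : tarski Z n W ->
  forall e x, e <= n -> (W e x <-> truth (rows B Z) e (env x)).
Proof.
move=> [t0 [tn [ta [tx [tb to]]]]] e.
elim/code_ind: e => [|q IH|a b IHa IHb|q IH|c l] x le; rewrite truthE.
- by split=> // /t0.
- rewrite tn // IH //.
  by have [h _ _ _] := code_lt 0 0 q; lia.
- have [_ h1 h2 _] := code_lt a b 0.
  by rewrite ta // IHa ?IHb //; lia.
- have [_ _ _ h] := code_lt 0 0 q.
  rewrite tx //; split=> -[a wa]; exists a; move: wa; rewrite IH ?env_cns //; lia.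
- have := odd_double_half c; case: (odd c); rewrite -addnn => e; rewrite -e in le *.
    by rewrite to // rows_odd -dec_lookup.
  by rewrite add0n in le *; rewrite tb // rows_even -dec_lookup.
Qed.

Lemma truth_tarski Z n W :
  (forall e x, e <= n -> (W e x <-> truth (rows B Z) e (env x))) -> tarski Z n W.
Proof.
move=> H.
split=> [x|]; first by rewrite H.
split=> [q x le|].
  have [h _ _ _] := code_lt 0 0 q.
  by rewrite !H ?truthE //; lia.
split=> [a b x le|].
  have [_ h h' _] := code_lt a b 0.
  by rewrite !H ?truthE //; lia.
split=> [q x le|].
  have [_ _ _ h] := code_lt 0 0 q.
  rewrite !H ?truthE //; split=> -[a wa]; exists a; move: wa;
    by rewrite H ?env_cns //; lia.
split=> c l x le; rewrite H // truthE -dec_lookup ?rows_odd ?rows_even //.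
Qed.


Definition oracle_of (T : nat -> Prop) : oracle := fun d a b => T (pr d (pr a b)).

Definition tarski_set (W T : nat -> Prop) (n : nat) : Prop :=
  tarski (oracle_of T) n (fun e x => W (pr e x)).

Lemma udfn_tarski_set :
  udfn B (fun Z v => tarski_set (fun w => Z 0 w 0) (fun w => Z 1 w 0) (v 0)).
Proof.
by rewrite /tarski_set /tarski /oracle_of /cneg /cand /cex /catm; dfn_tac.
Qed.

(** * Iterated truth along a relation *)

Definition level (r : nat -> nat -> Prop) (H : nat -> nat -> nat -> Prop)
    (c : nat) : oracle := fun d a b => r d c /\ H d a b.

Definition hierarchy r H := forall c e x,
  H c e x <-> truth (rows B (level r H c)) e (env x).

Lemma hierarchy_exists r : well_founded r -> exists H, hierarchy r H.
Proof.
move=> wf.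
pose step c (rec : forall d, r d c -> nat -> nat -> Prop) e x :=
  truth (rows B (fun d a b => exists h : r d c, rec d h a b)) e (env x).
exists (Fix wf (fun _ => nat -> nat -> Prop) step) => c e x.
rewrite Fix_eq /step => [|{}c f g fg].
  set L := (fun _ _ _ => _); set L' := level _ _ _.
  suff -> : L = L' by [].
  apply/funext=> d; apply/funext=> a; apply/funext=> b; apply/propext.
  by rewrite /L /L'; split=> [[h]|[h]] k; [split | exists h].
have -> : f = g by apply: functional_extensionality_dep => d;
  apply: functional_extensionality_dep => h.
by [].
Qed.

Definition hier_at (W T : nat -> Prop) (c : nat) : Prop :=
  forall n, tarski (fun d a b => T (pr d c) /\ W (pr d (pr a b))) n
    (fun e x => W (pr c (pr e x))).

Lemma udfn_hier_at :
  udfn B (fun Z v => hier_at (fun w => Z 0 w 0) (fun w => Z 1 w 0) (v 0)).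
Proof.
by rewrite /hier_at /tarski /cneg /cand /cex /catm; dfn_tac.
Qed.

Definition triple_set (H : nat -> nat -> nat -> Prop) (w : nat) : Prop :=
  H (p1 w) (p1 (p2 w)) (p2 (p2 w)).

Lemma triple_setE H c e x : triple_set H (pr c (pr e x)) = H c e x.
Proof. by rewrite /triple_set !(p1K, p2K). Qed.

Definition pair_set (r : nat -> nat -> Prop) (w : nat) : Prop := r (p1 w) (p2 w).

Lemma pair_setE r a b : pair_set r (pr a b) = r a b.
Proof. by rewrite /pair_set p1K p2K. Qed.

Lemma hier_atP W T c : hier_at W T c <-> forall e x, W (pr c (pr e x)) <->
  truth (rows B (fun d a b => T (pr d c) /\ W (pr d (pr a b)))) e (env x).
Proof.
split=> [h e x|h n]; first by apply: (tarski_truth (h e)).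
by apply: truth_tarski => e x _.
Qed.

(** By induction along [r]: once the earlier rows agree, the clauses at [c] leave
    only the truth predicate over them. *)
Lemma hier_unique r H W (T D : nat -> Prop) : well_founded r -> hierarchy r H ->
  (forall d c, T (pr d c) <-> r d c) -> (forall d c, r d c -> D c -> D d) ->
  (forall c, D c -> hier_at W T c) ->
  forall c, D c -> forall e x, W (pr c (pr e x)) <-> H c e x.
Proof.
move=> wf hH hT hD hW c; elim/(well_founded_ind wf): c => c IH Dc e x.
have /hier_atP -> := hW c Dc; rewrite hH.
suff -> : (fun d a b => T (pr d c) /\ W (pr d (pr a b))) = level r H c by [].
apply/funext=> d; apply/funext=> a; apply/funext=> b; apply/propext.
by rewrite /level hT; split=> -[h]; rewrite (IH d h (hD _ _ h Dc)).
Qed.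

Lemma hierarchy_hier_at r H T c : hierarchy r H ->
  (forall d c, T (pr d c) <-> r d c) -> hier_at (triple_set H) T c.
Proof.
move=> hH hT; apply/hier_atP => e x; rewrite triple_setE hH.
suff -> : (fun d a b => T (pr d c) /\ triple_set H (pr d (pr a b))) =
  level r H c by [].
apply/funext=> d; apply/funext=> a; apply/funext=> b; apply/propext.
by rewrite /level hT triple_setE.
Qed.

(** Through these atoms a row of an iterated truth predicate contains all earlier
    rows, uniformly, see [hierarchy_row]. *)
Definition row_atom (c : nat) : nat := catm (c + c).+1 (code [:: 1; 2]).

Lemma truth_row_atom Z c v : truth (rows B Z) (row_atom c) v = Z c (v 0) (v 1).
Proof. by rewrite truth_atm codeK rows_odd. Qed.

Lemma hierarchy_row r H c d e x : hierarchy r H ->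
  H c (row_atom d) (cns e (cns x 0)) <-> r d c /\ H d e x.
Proof. by move=> hH; rewrite hH truth_row_atom !env_cns. Qed.

End Tarski.

(** * Formulas and their codes *)

Definition vtup n (v : nat -> nat) : n.-tuple nat := [tuple v i | i < n].

Lemma nth_vtup n v i : i < n -> nth 0 (vtup n v) i = v i.
Proof.
by move=> lt; rewrite -[i]/(nat_of_ord (Ordinal lt)) -tnth_nth tnth_mktuple.
Qed.

Lemma eq_vtup n v w : (forall i, i < n -> v i = w i) -> vtup n v = vtup n w.
Proof. by move=> e; apply: eq_from_tnth => i; rewrite !tnth_mktuple e. Qed.

Lemma vtup_nth n (t : n.-tuple nat) : vtup n (nth 0 t) = t.
Proof. by apply: eq_from_tnth => i; rewrite tnth_mktuple -tnth_nth. Qed.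

Lemma vtup_scons n a v : [tuple of a :: vtup n v] = vtup n.+1 (scons a v).
Proof.
apply: eq_from_tnth => i; rewrite tnth_mktuple (tnth_nth 0) /=.
by case: i => -[|i] //= lt; rewrite nth_vtup.
Qed.

(** A symbol as a relation on finite sequences; function symbols become their
    graphs. *)
Definition symbol_rel (s : symbol) (v : nat -> nat) : Prop :=
  match s with
  | Pred n A => A (vtup n v)
  | Func n f => v 0 = f (vtup n (fun k => v k.+1))
  end.

Record base_for (N : set symbol) (B : base) : Prop := BaseFor {
  base_symbol : forall s, N s ->
    exists c, forall y, brow B c y <-> symbol_rel s (nth 0 y);
  base_row : forall c, (forall y, ~ brow B c y) \/
    exists2 s, N s & forall y, brow B c y <-> symbol_rel s (nth 0 y)
}.

Lemma base_for_exists (N : structure) : L_finite N -> exists B, base_for N B.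
Proof.
move=> /(@finite_seqP {classic symbol}) [s hs].
have Ns x : symbols N x <-> x \in (s : seq {classic symbol}) by rewrite hs.
pose dflt : symbol := Pred (set0 : set (0.-tuple nat)).
pose row c y := c < size s /\ symbol_rel (nth dflt s c) (nth 0 y).
have row_sym x : symbols N x -> exists c, forall y, row c y <-> symbol_rel x (nth 0 y).
  move=> /Ns /(nthP (dflt : {classic symbol})) [c lt e]; exists c => y.
  by rewrite /row e; split=> [[]|].
have req : exists c, forall y, row c y <-> nth 0 y 0 = nth 0 y 1.
  have [|c hc] := row_sym (Pred (rel2 (fun x y => x = y))).
    by apply: arithmetic_sub; do 4! left.
  by exists c => y; rewrite hc /= /rel2 /= !tnth_mktuple.
have rlt : exists c, forall y, row c y <-> nth 0 y 0 < nth 0 y 1.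
  have [|c hc] := row_sym (Pred (rel2 (fun x y => x < y))).
    by apply: arithmetic_sub; do 3! left; right.
  by exists c => y; rewrite hc /= /rel2 /= !tnth_mktuple.
have rsucc : exists c, forall y, row c y <-> nth 0 y 0 = (nth 0 y 1).+1.
  have [|c hc] := row_sym (Func (fun t : 1.-tuple nat => (thead t).+1)).
    by apply: arithmetic_sub; do 2! left; right.
  by exists c => y; rewrite hc /= /thead !tnth_mktuple.
have radd : exists c, forall y, row c y <-> nth 0 y 0 = nth 0 y 1 + nth 0 y 2.
  have [|c hc] := row_sym (Func (fun2 addn)).
    by apply: arithmetic_sub; left; right.
  by exists c => y; rewrite hc /= /fun2 !tnth_mktuple.
have rmul : exists c, forall y, row c y <-> nth 0 y 0 = nth 0 y 1 * nth 0 y 2.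
  have [|c hc] := row_sym (Func (fun2 muln)).
    by apply: arithmetic_sub; right.
  by exists c => y; rewrite hc /= /fun2 !tnth_mktuple.
have rfin : exists r, forall c y, r <= c -> ~ row c y.
  by exists (size s) => c y le [lt _]; lia.
have rar c : exists n, forall y, row c y <-> row c (mkseq (nth 0 y) n).
  rewrite /row; case: (nth dflt s c) => n X; exists n.+1 => y; rewrite /symbol_rel.
    by rewrite (@eq_vtup n (nth 0 y) (nth 0 (mkseq (nth 0 y) n.+1))) // => i lt;
      rewrite nth_mkseq //; lia.
  rewrite nth_mkseq //.
  rewrite (@eq_vtup n _ (fun k => nth 0 (mkseq (nth 0 y) n.+1) k.+1)) // => i lt.
  by rewrite nth_mkseq.
exists (Base rfin rar req rlt rsucc radd rmul); split=> //= c.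
case: (ltnP c (size s)) => h; last by left=> y [lt _]; lia.
right; exists (nth dflt s c); first by apply/Ns; exact: mem_nth.
by move=> y; rewrite /row; split=> [[]|].
Qed.

Section FormulasToCodes.
Variables (B : base) (I : Type) (Zf : I -> oracle) (L : set symbol).
Hypothesis symbol_dfn : forall s, L s -> dfn B Zf (fun _ v => symbol_rel s v).

Lemma dff_eval m (t : term m) : term_over L t ->
  dff B Zf (fun _ v => eval (vtup m v) t).
Proof.
elim: t => [i _|n f args IH [Lf hargs]] /=.
  rewrite /dff; under eq_fun do under eq_fun do rewrite tnth_mktuple.
  exact: dff_var.
pose F k (i : I) (v : nat -> nat) := if k is k'.+1 then
  (if insub k' is Some j then eval (vtup m (fun l => v l.+1)) (args j) else 0)
  else v 0.
apply: dfn_ext (@dfn_subst _ _ _ _ F (symbol_dfn Lf) _) => [i v|[|k]] /=.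
- rewrite (_ : vtup n _ = [tuple eval (vtup m (fun k => v k.+1)) (args j) | j < n]) //.
  by apply: eq_from_tnth => j; rewrite !tnth_mktuple /F valK.
- exact: dff_var.
rewrite /F; case: insubP => [j _ _|_]; last exact: dff_const.
exact: (dff_lift (F := fun _ v => eval (vtup m v) (args j)) (IH _ (hargs _))).
Qed.

Lemma dfn_sat lam (A : I -> relations lam) :
  (forall j, dfn B Zf (fun i v => A i j (vtup _ v))) ->
  forall m (phi : formula lam m), formula_over L phi ->
  dfn B Zf (fun i v => sat (A i) phi (vtup m v)).
Proof.
move=> hA m phi.
have args_dfn n k (args : 'I_n -> term k) (X : I -> n.-tuple nat -> Prop) :
    dfn B Zf (fun i v => X i (vtup n v)) -> (forall j, term_over L (args j)) ->
    dfn B Zf (fun i v => X i [tuple eval (vtup k v) (args j) | j < n]).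
  move=> hX hargs.
  pose F l (i : I) (v : nat -> nat) :=
    if insub l is Some j then eval (vtup k v) (args j) else 0.
  apply: dfn_ext (@dfn_subst _ _ _ _ F hX _) => [i v|l] /=.
    rewrite (_ : vtup n _ = [tuple eval (vtup k v) (args j) | j < n]) //.
    by apply: eq_from_tnth => j; rewrite !tnth_mktuple /F valK.
  rewrite /F; case: insubP => [j _ _|_]; last exact: dff_const.
  exact: dff_eval.
elim: phi => {m} /= [m n X args [LX hargs]|m j args hargs|m phi IH h|
    m phi IH psi IH' [h h']|m phi IH h].
- exact: (args_dfn _ _ _ (fun _ => X) (symbol_dfn LX)).
- exact: (args_dfn _ _ _ (fun i => A i j)).
- by apply: dfn_not; exact: IH.
- by apply: dfn_and; [exact: IH | exact: IH'].
- apply: dfn_ex; apply: dfn_ext (IH h) => i v.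
  by rewrite vtup_scons scons_eta.
Qed.

Lemma dfn_definable k (X : set (k.-tuple nat)) :
  definable L X -> dfn B Zf (fun _ v => X (vtup k v)).
Proof.
move=> [phi [h ->]].
by apply: (@dfn_sat [::] (fun _ => no_relations)) => // -[].
Qed.

End FormulasToCodes.

(** Definability by one formula scheme, uniformly in its second-order arguments. *)
Definition scheme_def (L : set symbol) lam k
    (X : relations lam -> k.-tuple nat -> Prop) : Prop :=
  exists2 phi : formula lam k, formula_over L phi &
    forall A t, sat A phi t <-> X A t.

Lemma scheme_definable L k (X : set (k.-tuple nat)) :
  scheme_def L (fun (_ : relations [::]) => X) <-> definable L X.
Proof.
split=> [[phi h e]|[phi [h e]]]; exists phi => //.
  by split=> //; apply/seteqP; split=> t /=; rewrite e.
move=> A t; rewrite e /= (_ : A = no_relations) //.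
by apply: functional_extensionality_dep => -[].
Qed.

Section CodesToFormulas.

Fixpoint term_rename m k (r : 'I_m -> 'I_k) (t : term m) : term k :=
  match t with
  | Var i => Var (r i)
  | App n f args => App f (fun j => term_rename r (args j))
  end.

Definition lift_rename m k (r : 'I_m -> 'I_k) (i : 'I_m.+1) : 'I_k.+1 :=
  if unlift ord0 i is Some j then lift ord0 (r j) else ord0.

Fixpoint formula_rename lam m (phi : formula lam m) :
    forall k, ('I_m -> 'I_k) -> formula lam k :=
  match phi with
  | Atom n A args => fun k r => Atom _ A (fun j => term_rename r (args j))
  | RelVar i args => fun k r => RelVar (fun j => term_rename r (args j))
  | Not phi => fun k r => Not (formula_rename phi r)
  | And phi psi => fun k r => And (formula_rename phi r) (formula_rename psi r)
  | Ex phi => fun k r => Ex (formula_rename phi (lift_rename r))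
  end.

Lemma term_rename_over L m k (r : 'I_m -> 'I_k) t :
  term_over L t -> term_over L (term_rename r t).
Proof. by elim: t => //= n f args IH [Lf h]; split=> // i; apply: IH. Qed.

Lemma formula_rename_over L lam m (phi : formula lam m) k (r : 'I_m -> 'I_k) :
  formula_over L phi -> formula_over L (formula_rename phi r).
Proof.
elim: phi k r => {m} /= [m n A args|m i args|m phi IH|m phi IH psi IH'|m phi IH] k r.
- by move=> [LA h]; split=> // i; exact: term_rename_over.
- by move=> h j; exact: term_rename_over.
- exact: IH.
- by move=> [h h']; split; [exact: IH | exact: IH'].
- exact: IH.
Qed.

Lemma eval_rename m k (r : 'I_m -> 'I_k) t (v : k.-tuple nat) :
  eval v (term_rename r t) = eval [tuple tnth v (r i) | i < m] t.
Proof.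
elim: t => [i|n f args IH] /=; first by rewrite tnth_mktuple.
by congr f; apply: eq_from_tnth => i; rewrite !tnth_mktuple IH.
Qed.

Lemma sat_rename lam (A : relations lam) m (phi : formula lam m) k
    (r : 'I_m -> 'I_k) (v : k.-tuple nat) :
  sat A (formula_rename phi r) v <-> sat A phi [tuple tnth v (r i) | i < m].
Proof.
have E m' k' (r' : 'I_m' -> 'I_k') (w : k'.-tuple nat) n (args : 'I_n -> term m') :
    [tuple eval w (term_rename r' (args j)) | j < n] =
    [tuple eval [tuple tnth w (r' i) | i < m'] (args j) | j < n].
  by apply: eq_from_tnth => i; rewrite !tnth_mktuple eval_rename.
elim: phi k r v => {m} /= [m n X args|m i args|m phi IH|m phi IH psi IH'|m phi IH] k r v.
- by rewrite E.
- by rewrite E.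
- by rewrite IH.
- by rewrite IH IH'.
- have E' a : [tuple tnth [tuple of a :: v] (lift_rename r i) | i < m.+1] =
      [tuple of a :: [tuple tnth v (r i) | i < m]].
    apply: eq_from_tnth => i; rewrite tnth_mktuple /lift_rename.
    case: unliftP => [j ->|->]; last by rewrite !tnth0.
    by rewrite !tnthS tnth_mktuple.
  by split=> -[a]; exists a; [rewrite -E' -IH | rewrite IH E'].
Qed.

Variables (B : base) (N L : set symbol) (lam : seq nat)
  (Zf : relations lam -> oracle).
Hypotheses (NB : base_for N B) (NL : N `<=` L) (arithL : arithmetic `<=` L).
Hypothesis oracle_def : forall d, scheme_def L
  (fun A (t : 2.-tuple nat) => Zf A d (tnth t ord0) (tnth t ord_max)).

Lemma scheme_not k (X : relations lam -> k.-tuple nat -> Prop) :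
  scheme_def L X -> scheme_def L (fun A t => ~ X A t).
Proof. by move=> [phi h e]; exists (Not phi) => //= A t; rewrite e. Qed.

Lemma scheme_and k (X Y : relations lam -> k.-tuple nat -> Prop) :
  scheme_def L X -> scheme_def L Y -> scheme_def L (fun A t => X A t /\ Y A t).
Proof.
by move=> [phi h e] [psi h' e']; exists (And phi psi) => //= A t; rewrite e e'.
Qed.

Lemma scheme_ex k (X : relations lam -> k.+1.-tuple nat -> Prop) :
  scheme_def L X -> scheme_def L (fun A t => exists a, X A [tuple of a :: t]).
Proof.
move=> [phi h e]; exists (Ex phi) => //= A t.
by split=> -[a]; exists a; [rewrite -e | rewrite e].
Qed.

(** Variables may be permuted, identified and replaced by 0; the number 0 is
    obtained from the order. *)
Lemma scheme_vars m (X : relations lam -> m.-tuple nat -> Prop) k (r : nat -> nat) :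
  scheme_def L X ->
  scheme_def L (fun A (t : k.-tuple nat) =>
    X A (vtup m (fun j => scons 0 (nth 0 t) (r j)))).
Proof.
move=> [phi h e].
pose rho (j : 'I_m) : 'I_k.+1 := insubd ord0 (r j).
pose zero : formula lam k.+1 := Not (Ex (Atom lam (rel2 (fun x y => x < y))
  (fun i : 'I_2 => if i == ord0 then Var ord0 else Var (lift ord0 ord0)))).
have zeroE A a (t : k.-tuple nat) : sat A zero [tuple of a :: t] <-> a = 0.
  rewrite /= /rel2 /=; split=> [H|-> [b]].
    apply/eqP; rewrite -leqn0 leqNgt; apply/negP => a0; apply: H; exists 0.
    by rewrite !tnth_mktuple /= !(tnth_nth 0).
  by rewrite !tnth_mktuple /= !(tnth_nth 0).
exists (Ex (And zero (formula_rename phi rho))).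
  split; last exact: formula_rename_over.
  split; first by apply: arithL; do 3! left; right.
  by move=> i; case: (i == ord0).
move=> A t; have -> : X A (vtup m (fun j => scons 0 (nth 0 t) (r j))) <->
    sat A (formula_rename phi rho) [tuple of 0 :: t].
  rewrite sat_rename e.
  suff -> : vtup m (fun j => scons 0 (nth 0 t) (r j)) =
    [tuple tnth [tuple of 0 :: t] (rho i) | i < m] by [].
  apply: eq_from_tnth => j; rewrite !tnth_mktuple /rho (tnth_nth 0) -nth_scons.
  rewrite val_insubd; case: ltnP => //= le.
  by rewrite nth_default //= size_tuple.
split=> [[a [/zeroE -> h']] //|h']; exists 0; split=> //.
exact/zeroE.
Qed.

Lemma scheme_iff k (X Y : relations lam -> k.-tuple nat -> Prop) :
  (forall A t, X A t <-> Y A t) -> scheme_def L X -> scheme_def L Y.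
Proof. by move=> h [phi o e]; exists phi => // A t; rewrite e h. Qed.

Lemma scheme_false k : scheme_def L (fun (_ : relations lam) (_ : k.-tuple nat) => False).
Proof.
have T : scheme_def L (fun (_ : relations lam) (t : 1.-tuple nat) =>
    tnth t ord0 = tnth t ord0).
  exists (Atom lam (rel2 eq) (fun _ : 'I_2 => Var ord0)).
    by split=> //; apply: arithL; do 4! left.
  by move=> A t; rewrite /= /rel2 /= !tnth_mktuple.
by apply: scheme_iff (scheme_not (scheme_vars k id T)) => A t; split=> // [[]].
Qed.

Lemma scheme_symbol s n : N s ->
  scheme_def L (fun (_ : relations lam) (t : n.-tuple nat) => symbol_rel s (nth 0 t)).
Proof.
case: s => m X NX.
  have D : scheme_def L (fun (_ : relations lam) (t : m.-tuple nat) => X t).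
    exists (Atom lam X (fun j => Var j)); first by split=> //; exact: NL.
    move=> A t /=; suff -> : [tuple tnth t i | i < m] = t by [].
    by apply: eq_from_tnth => i; rewrite tnth_mktuple.
  exact: scheme_vars n succn D.
have D : scheme_def L (fun (_ : relations lam) (t : m.+1.-tuple nat) =>
    tnth t ord0 = X [tuple tnth t (lift ord0 j) | j < m]).
  exists (Atom lam (rel2 eq) (fun i : 'I_2 => if i == ord0 then Var ord0 else
    App X (fun j => Var (lift ord0 j)))).
    split; first by apply: arithL; do 4! left.
    by move=> i; case: (i == ord0) => //; split=> //; exact: NL.
  move=> A t; rewrite /= /rel2 /= !tnth_mktuple //.
apply: scheme_iff (scheme_vars n succn D) => A t /=.
rewrite tnth_mktuple /=.
suff -> : [tuple tnth (vtup m.+1 (fun j => nth 0 t j)) (lift ord0 j) | j < m] =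
  vtup m (fun k => nth 0 t k.+1) by [].
by apply: eq_from_tnth => j; rewrite !tnth_mktuple.
Qed.

Lemma scheme_truth e k :
  scheme_def L (fun A (t : k.-tuple nat) => truth (rows B (Zf A)) e (nth 0 t)).
Proof.
elim/code_ind: e k => [|q IH|a b IHa IHb|q IH|c l] k.
- exact: scheme_false.
- by apply: scheme_iff (scheme_not (IH k)) => A t; rewrite truthE.
- by apply: scheme_iff (scheme_and (IHa k) (IHb k)) => A t; rewrite truthE.
- apply: scheme_iff (scheme_ex (IH k.+1)) => A t; rewrite truthE.
  by split=> -[a]; rewrite -?nth_scons => h; exists a; rewrite -?nth_scons.
pose s := dec l.
have R n : n = size s -> scheme_def L (fun A (t : n.-tuple nat) => rows B (Zf A) c t).
  move=> _; rewrite /rows; case: (odd c).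
    apply: scheme_iff (scheme_vars n succn (oracle_def c./2)) => A t.
    by rewrite !tnth_mktuple.
  have [h|[x Nx h]] := base_row NB c./2.
    by apply: scheme_iff (scheme_false n) => A t; split=> // /h.
  by apply: scheme_iff (scheme_symbol n Nx) => A t; rewrite h.
apply: scheme_iff (scheme_vars k (nth 0 s) (R _ erefl)) => A t.
rewrite truthE (_ : tval (vtup _ _) = map (scons 0 (nth 0 t)) s) //.
apply: (@eq_from_nth _ 0); rewrite ?size_tuple ?size_map // => i lt.
by rewrite nth_vtup // (nth_map 0).
Qed.

Lemma dfn_scheme (X : relations lam -> (nat -> nat) -> Prop) k :
  dfn B Zf X -> scheme_def L (fun A (t : k.-tuple nat) => X A (nth 0 t)).
Proof.
by move=> [e he]; apply: scheme_iff (scheme_truth e k) => A t; rewrite he.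
Qed.

End CodesToFormulas.

Lemma definable_dfn B (N L : set symbol) (Z : oracle) (X : (nat -> nat) -> Prop) k :
  base_for N B -> N `<=` L -> arithmetic `<=` L ->
  (forall d, definable L [set t : 2.-tuple nat | Z d (tnth t ord0) (tnth t ord_max)]) ->
  dfn B (fun _ : unit => Z) (fun _ v => X v) ->
  definable L [set t : k.-tuple nat | X (nth 0 t)].
Proof.
move=> NB NL aL hZ [e he]; apply/scheme_definable.
apply: (@dfn_scheme B N L [::] (fun _ => Z) NB NL aL _ (fun _ => X)) => [d|].
  by apply/scheme_definable; exact: hZ.
by exists e => _ v; rewrite (he tt).
Qed.

(** * The levels of a Tarski hierarchy *)

Lemma wf_min (T : Type) (R : T -> T -> Prop) (Q : T -> Prop) :
  well_founded R -> (exists x, Q x) ->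
  exists x, Q x /\ forall y, R y x -> ~ Q y.
Proof.
move=> wf [x Qx]; apply: contrapT => H.
elim/(well_founded_ind wf): x Qx => x IH Qx; apply: H; by exists x.
Qed.

Lemma term_over_mono (L L' : set symbol) m (t : term m) :
  L `<=` L' -> term_over L t -> term_over L' t.
Proof.
move=> LL'; elim: t => //= n f args IH [Lf ha].
by split=> [|i]; [exact: LL' | exact: IH].
Qed.

Lemma formula_over_mono (L L' : set symbol) lam m (phi : formula lam m) :
  L `<=` L' -> formula_over L phi -> formula_over L' phi.
Proof.
move=> LL'; elim: phi => //= {m} [m n A args [LA ha]|m i args ha j|m p IH q IH' [h h']].
- by split=> [|i]; [exact: LL' | exact: term_over_mono (ha i)].
- exact: term_over_mono (ha j).
- by split; [exact: IH | exact: IH'].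
Qed.

Lemma definable_mono (L L' : set symbol) k (X : set (k.-tuple nat)) :
  L `<=` L' -> definable L X -> definable L' X.
Proof.
by move=> LL' [phi [h e]]; exists phi; split=> //; exact: formula_over_mono h.
Qed.

Lemma vtup2 v : vtup 2 v = [tuple v 0; v 1].
Proof.
apply: eq_from_tnth => -[[|[|//]] lt]; rewrite tnth_mktuple (tnth_nth 0) //=.
Qed.

Lemma tuple2_eta (t : 2.-tuple nat) : [tuple tnth t ord0; tnth t ord_max] = t.
Proof.
apply: eq_from_tnth => -[[|[|//]] lt]; rewrite (tnth_nth 0) /=;
  congr tnth; exact: val_inj.
Qed.

Lemma add_binary_arith (L : structure) (P : set (2.-tuple nat)) :
  arithmetic `<=` add_pred L P.
Proof. exact: subset_trans (@arithmetic_sub L) (@subsetUl _ _ _). Qed.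

Lemma add_binary_arity (L : structure) (P : set (2.-tuple nat)) n
  (A : set (n.-tuple nat)) : add_pred L P (Pred A) -> 0 < n.
Proof.
case=> [|/(congr1 (fun s => if s is Pred k _ then k else 0)) /= -> //].
exact: pred_arity_gt0.
Qed.

Definition add_binary (L : structure) (P : set (2.-tuple nat)) : structure :=
  Structure (@add_binary_arith L P) (@add_binary_arity L P).

Lemma definable_symbol (L : set symbol) n (P : set (n.-tuple nat)) :
  L (Pred P) -> definable L P.
Proof.
move=> LP; exists (Atom _ P (fun i => Var i)); split=> //.
apply/seteqP; split=> t /=;
  by rewrite (_ : [tuple tnth t i | i < n] = t) //;
    apply: eq_from_tnth => i; rewrite tnth_mktuple.
Qed.

Section Index.
Variable lambda : ord_type.
Implicit Types i j k : option lambda.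

Lemma olt_irr (x : lambda) : ~ olt x x.
Proof.
by elim/(well_founded_ind (@olt_wf lambda)): x => x IH h; exact: (IH x h h).
Qed.

Lemma idx_trans i j k : idx_lt i j -> idx_lt j k -> idx_lt i k.
Proof. by case: i j k => [i|] [j|] [k|] //=; exact: olt_trans. Qed.

Lemma idx_total i j : [\/ idx_lt i j, i = j | idx_lt j i].
Proof.
case: i j => [i|] [j|] /=; [|by constructor 1|by constructor 3|by constructor 2].
case: (olt_total i j) => h; [constructor 1|constructor 2|constructor 3] => //.
by rewrite h.
Qed.

Lemma idx_wf : well_founded (@idx_lt lambda).
Proof.
have S x : Acc (@idx_lt lambda) (Some x).
  elim/(well_founded_ind (@olt_wf lambda)): x => x IH.
  by apply: Acc_intro => -[y|] h; [exact: IH | case: h].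
case=> [x|]; first exact: S.
by apply: Acc_intro => -[y|] h; [exact: S | case: h].
Qed.

Lemma idx_succ (i : lambda) : exists j, is_succ (Some i) j.
Proof.
have [j [ij h]] := @wf_min _ _ (fun j => idx_lt (Some i) j) idx_wf
  (ex_intro _ None I).
by exists j; split=> // k [ik kj]; exact: (h k kj).
Qed.

Lemma succ_le (i j k : option lambda) : is_succ i j -> idx_lt i k -> j = k \/ idx_lt j k.
Proof.
by move=> [ij h] ik; case: (idx_total j k) => [|->|kj]; [right|left|case: (h k)].
Qed.

Lemma idx_cases k :
  [\/ is_zero k, exists i : lambda, is_succ (Some i) k | is_limit k].
Proof.
case: (pselect (is_zero k)) => z; first by constructor 1.
case: (pselect (exists i : lambda, is_succ (Some i) k)) => s; first by constructor 2.
constructor 3; split=> // -[i|] // ik.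
apply: contrapT => H; apply: s; exists i; split=> // j h; apply: H; by exists j.
Qed.

Lemma not_zero k : ~ is_zero k -> exists i : lambda, idx_lt (Some i) k.
Proof.
by move=> z; apply: contrapT => H; apply: z => -[i|] // h; apply: H; exists i.
Qed.

End Index.

Section Levels.
Variables (N : structure) (lambda : ord_type) (M : option lambda -> structure).
Hypothesis hM : tarski_hierarchy N M.

Lemma M_mono i k : idx_lt i k -> M i `<=` M k.
Proof.
elim/(well_founded_ind (@idx_wf lambda)): k i => k IH i ik.
case: (idx_cases k) => [z|[j jk]|lim]; first by case: (z i).
- have [P [_ ->]] := th_succ hM jk; apply: subset_trans (@subsetUl _ _ _).
  have [jk' no] := jk.
  case: (idx_total i (Some j)) => [ij|-> //|ji]; first exact: IH.
  by case: (no i).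
- by rewrite (th_limit hM lim) => s Ms; exists i.
Qed.

Lemma N_sub_M k : N `<=` M k.
Proof.
elim/(well_founded_ind (@idx_wf lambda)): k => k IH.
case: (pselect (is_zero k)) => z; first by rewrite (th_zero hM z).
have [i ik] := not_zero z.
exact: subset_trans (IH _ ik) (M_mono ik).
Qed.

Variable B : base.
Hypothesis NB : base_for N B.

Lemma definable_of_dfn (L : structure) (Z : oracle) (X : (nat -> nat) -> Prop) k :
  N `<=` L ->
  (forall d, definable L [set t : 2.-tuple nat | Z d (tnth t ord0) (tnth t ord_max)]) ->
  dfn B (fun _ : unit => Z) (fun _ v => X v) ->
  definable L [set t : k.-tuple nat | X (nth 0 t)].
Proof. by move=> NL hZ hX; exact: (definable_dfn k NB NL (@arithmetic_sub L) hZ hX). Qed.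

(** [rho] is the non-strict order of the ordinal [o], copied to the natural
    numbers along [f]; [f] matters only below [o]. *)
Record ord_copy (o : option lambda) (rho : nat -> nat -> Prop) (f : lambda -> nat) :
    Prop := OrdCopy {
  copy_le : forall j k, idx_lt (Some j) o -> idx_lt (Some k) o ->
    (rho (f j) (f k) <-> j = k \/ olt j k);
  copy_field : forall c d, rho c d -> exists j k,
    [/\ idx_lt (Some j) o, idx_lt (Some k) o, c = f j & d = f k]
}.

Definition ndef2 (r : nat -> nat -> Prop) : Prop := ndef B (fun v => r (v 0) (v 1)).

Lemma dfn_ndef2 r : ndef2 r -> forall I (Zf : I -> oracle) F G,
  dff B Zf F -> dff B Zf G -> dfn B Zf (fun i v => r (F i v) (G i v)).
Proof. by move=> hr I Zf F G; exact: (dfn_rel2 (R := r)). Qed.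

Definition strict (rho : nat -> nat -> Prop) c d := rho c d /\ c <> d.

Lemma ndef2_strict rho : ndef2 rho -> ndef2 (strict rho).
Proof. by move=> h; rewrite /ndef2 /strict; dfn_tac. Qed.

(** The first-order condition that singles out, among the sections of a universal
    predicate, those that agree with iterated truth up to [c]. *)
Definition hgood (r : nat -> nat -> Prop) (W : nat -> Prop) (c : nat) : Prop :=
  forall d, d = c \/ r d c -> hier_at B W (pair_set r) d.

Lemma dfn_hgood r I (Zf : I -> oracle) (Y : I -> (nat -> nat) -> nat -> Prop) F :
  ndef2 r -> dfn B Zf (fun i v => Y i (fun k => v k.+1) (v 0)) -> dff B Zf F ->
  dfn B Zf (fun i v => hgood r (Y i v) (F i v)).
Proof.
move=> hr hY hF.
apply: (@dfn_sets _ _ _ (fun W _ c => hgood r W c) Y Y F) => //.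
rewrite /hgood; have hr' := dfn_ndef2 hr; dfn_tac.
apply: (@dfn_sets _ _ _ (fun W T c => hier_at B W T c)
  (fun Z v w => Z 0 w 0) (fun _ _ => pair_set r)); try by dfn_tac.
  exact: udfn_hier_at.
by rewrite /pair_set; apply: hr'; dfn_tac.
Qed.

Lemma dfn_truth_upto I (Zf : I -> oracle) n :
  dfn B Zf (fun i v => p1 (v 0) <= n /\
    truth (rows B (Zf i)) (p1 (v 0)) (env (p2 (v 0)))).
Proof.
have one e : dfn B Zf (fun i v => p1 (v 0) = e /\
    truth (rows B (Zf i)) e (env (p2 (v 0)))).
  apply: dfn_and; first by dfn_tac.
  apply: (dfn_subst (F := fun k _ v => env (p2 (v 0)) k) (dfn_truth _ _ e)).
  by move=> k; dfn_tac.
elim: n => [|n IH].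
  by apply: dfn_ext (one 0) => i v; rewrite leqn0; split=> -[/eqP e h]; rewrite e in h *.
apply: dfn_ext (dfn_or IH (one n.+1)) => i v; split=> [[[le h]|[e h]]|[]].
- by split=> //; lia.
- by rewrite e.
rewrite leq_eqVlt => /orP [/eqP e|lt] h; last by left.
by right; rewrite -e.
Qed.

Lemma base_symbol_dfn s I (Zf : I -> oracle) : symbols N s ->
  dfn B Zf (fun _ v => symbol_rel s v).
Proof.
move=> Ns; have [c hc] := base_symbol NB Ns.
have [n hn] : exists n, forall v w, (forall i, i < n -> v i = w i) ->
    symbol_rel s v <-> symbol_rel s w.
  case: (s) => n X; exists n.+1 => v w e /=.
    by rewrite (@eq_vtup n v w) // => i lt; apply: e; lia.
  by rewrite e // (@eq_vtup n _ (fun k => w k.+1)) // => i lt; apply: e.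
exists (catm (c + c) (code (map succn (iota 0 n)))) => i v.
rewrite truth_atm codeK rows_even hc -map_comp; apply: hn => k lt.
by rewrite (nth_map 0) ?size_iota // nth_iota.
Qed.

Section Represented.
Variables (o0 : option lambda) (rho : nat -> nat -> Prop) (f : lambda -> nat).
Hypotheses (hrep : ord_copy o0 rho f) (hrho : ndef2 rho).

Notation lt := (strict rho).

Lemma copy_lt j k : idx_lt (Some j) o0 -> idx_lt (Some k) o0 ->
  (lt (f j) (f k) <-> olt j k).
Proof.
move=> jo ko; rewrite /strict (copy_le hrep jo ko); split=> [[[->|] //]|jk].
split; [by right | move=> e].
have : rho (f k) (f j) by rewrite -e; apply/(copy_le hrep jo jo); left.
rewrite (copy_le hrep ko jo) => -[e'|kj]; first by rewrite e' in jk; exact: olt_irr jk.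
exact: olt_irr (olt_trans jk kj).
Qed.

Lemma copy_inj j k : idx_lt (Some j) o0 -> idx_lt (Some k) o0 -> f j = f k -> j = k.
Proof.
move=> jo ko e; case: (olt_total j k) => // h.
  by have [_ []] := (copy_lt jo ko).2 h.
by have [_ []] := (copy_lt ko jo).2 h.
Qed.

Lemma lt_below j c : idx_lt (Some j) o0 ->
  (lt c (f j) <-> exists2 k, olt k j & c = f k).
Proof.
move=> jo; split=> [h|[k kj ->]]; last first.
  by apply/copy_lt => //; exact: (@idx_trans _ _ (Some j)).
have [k [_ [ko _ e _]]] := copy_field hrep h.1.
by exists k => //; rewrite e in h; apply/(copy_lt ko jo).
Qed.

Lemma lt_wf : well_founded lt.
Proof.
have A j : idx_lt (Some j) o0 -> Acc lt (f j).
  elim/(well_founded_ind (@olt_wf lambda)): j => j IH jo.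
  constructor=> c /(lt_below _ jo) [k kj ->]; apply: IH => //.
  exact: (@idx_trans _ _ (Some j)).
move=> c; constructor=> d h.
by have [k [_ [ko _ -> _]]] := copy_field hrep h.1; exact: A.
Qed.

Lemma lt_trans c d e : lt c d -> lt d e -> lt c e.
Proof.
move=> h h'; have [i [j [io jo ei ej]]] := copy_field hrep h.1.
have [_ [k [_ ko _ ek]]] := copy_field hrep h'.1; subst.
move: h h'; rewrite !copy_lt //; exact: olt_trans.
Qed.

Variable H : nat -> nat -> nat -> Prop.
Hypothesis hH : hierarchy B lt H.

Definition below (o : option lambda) (c : nat) : Prop :=
  exists2 j, idx_lt (Some j) o & c = f j.

Definition level_oracle (o : option lambda) : oracle :=
  fun c a b => below o c /\ H c a b.

Notation Zo := level_oracle.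

Lemma level_Zo j : idx_lt (Some j) o0 -> level lt H (f j) = Zo (Some j).
Proof.
move=> jo; apply/funext=> d; apply/funext=> a; apply/funext=> b; apply/propext.
by rewrite /level /level_oracle lt_below.
Qed.

Lemma H_truth j e x : idx_lt (Some j) o0 ->
  H (f j) e x <-> truth (rows B (Zo (Some j))) e (env x).
Proof. by move=> jo; rewrite hH level_Zo. Qed.

Definition le0 (o : option lambda) : Prop := o = o0 \/ idx_lt o o0.

Lemma le0_lt i o : idx_lt i o -> le0 o -> idx_lt i o0.
Proof. by move=> io [<- //|]; exact: idx_trans. Qed.

Lemma dfn_below o : le0 o -> forall I (Zf : I -> oracle) F, dff B Zf F ->
  dfn B Zf (fun i v => below o (F i v)).
Proof.
move=> oo I Zf F; apply: (dfn_pred1 (R := below o)).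
case: oo => [->|].
  apply: (dfn_ext _ (dfn_ndef2 hrho (dff_var _ _ 0) (dff_var _ _ 0))) => _ v.
  split=> [/(copy_field hrep) [j [_ [jo _ e _]]]|[j jo ->]]; first by exists j.
  by apply/(copy_le hrep) => //; left.
case: o => [i|] // io.
have h := dfn_ndef2 (ndef2_strict hrho).
apply: (dfn_ext _ (h _ _ _ _ (dff_var _ _ 0) (dff_const _ _ (f i)))) => _ v.
by rewrite lt_below.
Qed.

(** Expresses, symbol by symbol, that [M o] and the rows below [o] have the same
    definable sets. *)
Definition level_ok (o : option lambda) : Prop :=
  (forall s, symbols (M o) s -> dfn B (fun _ : unit => Zo o) (fun _ v => symbol_rel s v)) /\
  (forall j, idx_lt (Some j) o ->
    definable (M o) [set t : 2.-tuple nat | H (f j) (tnth t ord0) (tnth t ord_max)]).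

Lemma definable_false (L : structure) k : definable L [set _ : k.-tuple nat | False].
Proof. by apply/scheme_definable; apply: scheme_false; exact: arithmetic_sub. Qed.

Lemma level_rows_definable o (L : structure) d : level_ok o -> M o `<=` L ->
  definable L [set t : 2.-tuple nat | Zo o d (tnth t ord0) (tnth t ord_max)].
Proof.
move=> [_ h] sub; case: (pselect (below o d)) => b; last first.
  rewrite (_ : [set t | _] = [set _ | False]); first exact: definable_false.
  by apply/seteqP; split=> t // [].
have [j jo e] := b; rewrite (_ : [set t | _] =
  [set t : 2.-tuple nat | H (f j) (tnth t ord0) (tnth t ord_max)]).
  exact: definable_mono (h j jo).
by apply/seteqP; split=> t /=; rewrite /level_oracle -e => // -[].
Qed.

Lemma level_definable o k (X : (nat -> nat) -> Prop) : level_ok o ->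
  dfn B (fun _ : unit => Zo o) (fun _ v => X v) ->
  definable (M o) [set t : k.-tuple nat | X (nth 0 t)].
Proof.
move=> ok; apply: definable_of_dfn; first exact: N_sub_M.
by move=> d; exact: level_rows_definable.
Qed.

Lemma level_dfn o k (X : set (k.-tuple nat)) : level_ok o -> definable (M o) X ->
  dfn B (fun _ : unit => Zo o) (fun _ v => X (vtup k v)).
Proof. by move=> [h _]; exact: dfn_definable. Qed.

Lemma universal_row o (P : set (2.-tuple nat)) (X : nat -> Prop) : level_ok o ->
  universal (M o) P -> dfn B (fun _ : unit => Zo o) (fun _ v => X (v 0)) ->
  exists n, forall m, P [tuple n; m] <-> X m.
Proof.
move=> ok uP hX.
have D : definable_sets (M o) X.
  have := @level_definable o 1 (fun v => X (v 0)) ok hX.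
  rewrite /definable_sets /=; congr definable; apply/seteqP; split=> t /=;
    by rewrite /thead (tnth_nth 0).
have [n _ e] := uP _ D; exists n => m.
by rewrite -e.
Qed.

(** The truth predicate over the rows below [o] is not definable in [M o], and for
    a limit [o] neither is the sequence of these rows.  But their bounded parts
    are definable there, and therefore occur as sections of [P].
    The inductive clauses recognize sections that are correct, so the parts can
    be put together by quantifying over the index of a section. *)
Lemma level_truth_definable o (P : set (2.-tuple nat)) : le0 o -> level_ok o ->
  universal (M o) P ->
  definable (add_pred (M o) P) [set t : 2.-tuple nat |
    truth (rows B (Zo o)) (tnth t ord0) (env (tnth t ord_max))].
Proof.
move=> oo ok uP.
pose ZP : oracle := fun _ a b => P [tuple a; b].
have hlt := dfn_ndef2 (ndef2_strict hrho).
have hbelow := dfn_below oo.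
have hP I (Zf : I -> oracle) F G : Zf = (fun _ => ZP) -> dff B Zf F -> dff B Zf G ->
    dfn B Zf (fun i v => P [tuple F i v; G i v]).
  by move=> e hF hG; have := dfn_oracle 0 hF hG; rewrite e.
(* Stage one recovers the rows below [o] from [P]. *)
pose T w := below o (p1 w) /\
  exists n, hgood lt (fun w => P [tuple n; w]) (p1 w) /\ P [tuple n; w].
have TE : oracle_of T = Zo o.
  apply/funext=> c; apply/funext=> a; apply/funext=> b; apply/propext.
  rewrite /oracle_of /T /level_oracle p1K; split.
    move=> [bc [n [g Pn]]]; split=> //; move: Pn; rewrite -/(oracle_of _ c a b).
    have := @hier_unique B lt H (fun w => P [tuple n; w]) (pair_set lt)
      (fun d => d = c \/ lt d c) lt_wf hH.
    move=> U; rewrite U //.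
    - by move=> d e; rewrite pair_setE.
    - move=> d e de [ec|ec]; right; first by rewrite -ec.
      exact: lt_trans de ec.
    - by left.
  move=> [bc Hc]; split=> //; have [j jo ej] := bc; subst c.
  pose X w := (p1 w = f j \/ lt (p1 w) (f j)) /\ triple_set H w.
  have [|n hn] := @universal_row o P X ok uP.
    apply: (@dfn_ext _ _ _ (fun _ v =>
      (p1 (v 0) = f j /\ Zo o (f j) (p1 (p2 (v 0))) (p2 (p2 (v 0)))) \/
      (lt (p1 (v 0)) (f j) /\ Zo o (f j) (row_atom (p1 (v 0)))
         (cns (p1 (p2 (v 0))) (cns (p2 (p2 (v 0))) 0))))).
      move=> _ v; rewrite /X /triple_set /level_oracle (hierarchy_row _ _ _ _ hH).
      split=> [[[-> [_ h]]|[h [_ [_ h']]]]|[[e|h] h']].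
      - by split=> //; left.
      - by split=> //; right.
      - by left; rewrite e in h' *.
      - by right.
    apply: dfn_or; apply: dfn_and; dfn_tac.
    + by apply: (@dfn_oracle _ _ (fun _ : unit => Zo o) (f j)); dfn_tac.
    + by apply: hlt; dfn_tac.
    + by apply: (@dfn_oracle _ _ (fun _ : unit => Zo o) (f j));
        rewrite /row_atom /catm; dfn_tac.
  exists n; split; last by apply/hn; rewrite /X p1K triple_setE; split=> //; left.
  move=> d hd; have -> : (fun w => P [tuple n; w]) = X.
    by apply/funext=> w; apply/propext.
  have dj e : lt e d -> lt e (f j).
    by move=> ed; case: hd => [<- //|]; exact: lt_trans.
  apply/hier_atP => e x; rewrite /X p1K triple_setE hH.
  suff -> : level lt H d = (fun d0 a b => pair_set lt (pr d0 d) /\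
    (p1 (pr d0 (pr a b)) = f j \/ lt (p1 (pr d0 (pr a b))) (f j)) /\
      triple_set H (pr d0 (pr a b))) by split=> [[]|].
  apply/funext=> d'; apply/funext=> a'; apply/funext=> b'; apply/propext.
  rewrite /level pair_setE p1K triple_setE; split=> [[h h']|[h [_ h']]] //.
  by split=> //; split=> //; right; exact: dj.
(* Stage two recovers truth over these rows, one bound on the codes at a time. *)
have V e x : truth (rows B (Zo o)) e (env x) <->
    exists n, tarski_set B (fun w => P [tuple n; w]) T e /\ P [tuple n; pr e x].
  split=> [h|[n [t Pn]]]; last first.
    by move: t; rewrite /tarski_set TE => t; apply/(tarski_truth t x (leqnn e)).
  have [n hn] := @universal_row o P (fun w => p1 w <= e /\
    truth (rows B (Zo o)) (p1 w) (env (p2 w))) ok uP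
    (dfn_truth_upto (fun _ : unit => Zo o) e).
  exists n; split; last by apply/hn; rewrite p1K p2K.
  rewrite /tarski_set TE; apply: truth_tarski => d y le.
  by rewrite hn p1K p2K; split=> [[]|].
have := @definable_of_dfn (add_binary (M o) P) ZP
  (fun v => truth (rows B (Zo o)) (v 0) (env (v 1))) 2 _ _ _.
move=> D; move: (D); rewrite (_ : [set t : 2.-tuple nat | _] = [set t : 2.-tuple nat |
    truth (rows B (Zo o)) (tnth t ord0) (env (tnth t ord_max))]); last first.
  by apply/seteqP; split=> t /=; rewrite !(tnth_nth 0).
apply.
- exact: subset_trans (@N_sub_M o) (@subsetUl _ _ _).
- move=> d; rewrite /ZP.
  rewrite (_ : [set t | _] = P); first by apply: definable_symbol; right.
  by apply/seteqP; split=> t /=; rewrite tuple2_eta.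
apply: (@dfn_ext _ _ _ (fun _ v => exists n, tarski_set B (fun w => P [tuple n; w]) T (v 0)
  /\ P [tuple n; pr (v 0) (v 1)])); first by move=> _ v; rewrite V.
apply: dfn_ex; apply: dfn_and; last by apply: hP; dfn_tac.
apply: (@dfn_sets _ _ _ (fun W T e => tarski_set B W T e)
  (fun _ v w => P [tuple v 0; w]) (fun _ _ => T)); try by dfn_tac.
- exact: udfn_tarski_set.
- by apply: hP; dfn_tac.
rewrite /T; apply: dfn_and; first by apply: hbelow; dfn_tac.
apply: dfn_ex; apply: dfn_and; last by apply: hP; dfn_tac.
apply: (@dfn_hgood lt _ _ (fun _ v w => P [tuple v 0; w])); try by dfn_tac.
  exact: ndef2_strict.
by apply: hP; dfn_tac.
Qed.


(** The rows that [o'] has in addition must not be used: atoms about them, which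
    are false over the rows below [o], are replaced by a contradiction. *)
Lemma level_oracle_mono o o' X : idx_lt o o' ->
  dfn B (fun _ : unit => Zo o) X -> dfn B (fun _ : unit => Zo o') X.
Proof.
move=> oo' [e he]; apply: dfn_ext (fun i v => iff_sym (he i v)) _.
apply: (@dfn_subst_oracle _ _ _ (fun Z v => truth (rows B Z) e v) (fun _ _ => Zo o)).
  exact: dfn_truth.
move=> c; case: (pselect (below o c)) => bc; last first.
  by apply: dfn_ext (dfn_false _ _) => _ v; split=> // [[]].
have bc' : below o' c by have [j jo e'] := bc; exists j => //; exact: idx_trans oo'.
apply: dfn_ext (dfn_oracle c (dff_var _ _ 0) (dff_var _ _ 1)) => _ v.
by rewrite /level_oracle; split=> -[].
Qed.

Definition level_universal (o : option lambda) : set (2.-tuple nat) :=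
  [set t | truth (rows B (Zo o)) (tnth t ord0) (env (cns (tnth t ord_max) 0))].

Lemma level_canonic o : le0 o -> level_ok o ->
  canonic_universal (M o) (level_universal o).
Proof.
move=> oo ok; split=> [X DX|P uP].
  have [e he] := level_dfn ok DX; exists e => //.
  apply/predeqP => m; rewrite /section /level_universal /= !(tnth_nth 0) /= -(he tt).
  by rewrite /= /thead tnth_mktuple env_cns.
have D := level_truth_definable oo ok uP.
pose V : oracle := fun _ a b => truth (rows B (Zo o)) a (env b).
have := @definable_of_dfn (add_binary (M o) P) V
  (fun v => truth (rows B (Zo o)) (v 0) (env (cns (v 1) 0))) 2 _ (fun=> D) _.
rewrite (_ : [set t | _] = level_universal o); last first.
  by apply/seteqP; split=> t; rewrite /level_universal /= !(tnth_nth 0).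
apply; first exact: subset_trans (@N_sub_M o) (@subsetUl _ _ _).
by apply: (@dfn_oracle _ _ (fun _ : unit => V) 0); dfn_tac.
Qed.

(** At successors the canonic predicate that the hierarchy adds and the truth
    predicate of the level are definable from each other, since both are
    canonic. *)
Lemma level_ok_all o : le0 o -> level_ok o.
Proof.
elim/(well_founded_ind (@idx_wf lambda)): o => k IH ko.
have IH' i : idx_lt i k -> level_ok i.
  by move=> ik; apply: IH => //; right; exact: le0_lt ik ko.
case: (idx_cases k) => [z|[i ik]|lim].
- split=> [s|j jk]; last by case: (z _ jk).
  by rewrite (th_zero hM z) => Ns; exact: base_symbol_dfn.
- have [ik' no] := ik.
  have [P [canP eP]] := th_succ hM ik; have oki := IH' _ ik'.
  have io : le0 (Some i) by right; exact: le0_lt ik' ko.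
  have io' : idx_lt (Some i) o0 by exact: le0_lt ik' ko.
  have old s : symbols (M (Some i)) s ->
      dfn B (fun _ : unit => Zo k) (fun _ v => symbol_rel s v).
    by move=> Ms; apply: (level_oracle_mono ik'); exact: oki.1.
  split=> [s|j jk].
    rewrite eP => -[|->]; first exact: old.
    have DP := canP.2 _ (level_canonic io oki).1.
    apply: (dfn_definable _ DP) => s' [|->]; first exact: old.
    have hrow := dfn_oracle (f i) (dff_var _ _ 0) (@dff_cns B _
      (fun _ : unit => Zo k) _ _ (dff_var _ _ 1) (dff_const _ _ 0)).
    apply: dfn_ext hrow => _ v; rewrite /symbol_rel /level_universal /= !tnth_mktuple.
    rewrite -H_truth // /level_oracle; split=> [[]|] // h; split=> //.
    by exists i.
  have sub : M (Some i) `<=` M k by exact: M_mono.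
  case: (idx_total (Some j) (Some i)) => [ji|[->]|ij]; last by case: (no (Some j)).
    exact: definable_mono sub (oki.2 _ ji).
  have := level_truth_definable io oki canP.1; rewrite -eP.
  congr definable; apply/seteqP; split=> t /=; by rewrite -H_truth.
- split=> [s|j jk].
    rewrite (th_limit hM lim) => -[i ik Ms].
    by apply: (level_oracle_mono ik); exact: (IH' i ik).1.
  have [m [jm mk]] := lim.2 _ jk.
  exact: definable_mono (M_mono mk) ((IH' m mk).2 _ jm).
Qed.


End Represented.

End Levels.

(** * Definable ordinals *)

(** The relation [R] below matches [x] with the least [y] that is not matched with
    an element below [x]. *)
Lemma ord_compare (a b : ord_type) : ord_le b a \/
  exists (i : b) (f : a -> b), (forall x y, olt x y <-> olt (f x) (f y)) /\
    (forall z, olt z i <-> exists x, z = f x).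
Proof.
pose step (x : a) (rec : forall x', olt x' x -> b -> Prop) (y : b) :=
  (forall x' (h : olt x' x), ~ rec x' h y) /\
  (forall y', olt y' y -> exists x', exists h : olt x' x, rec x' h y').
pose R := Fix (@olt_wf a) (fun _ => b -> Prop) step.
have RE x y : R x y <-> (forall x', olt x' x -> ~ R x' y) /\
    (forall y', olt y' y -> exists2 x', olt x' x & R x' y').
  rewrite {1}/R Fix_eq -/R => [|{}x f g fg]; last first.
    have -> : f = g by apply: functional_extensionality_dep => d;
      apply: functional_extensionality_dep => h.
    by [].
  rewrite /step; split=> -[h h']; split=> // y' /h'.
    by move=> [x' [l r]]; exists x'.
  by move=> [x' l r]; exists x', l.
have inj x x' y : R x y -> R x' y -> x = x'.
  move=> r r'; case: (olt_total x x') => // h.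
    by have [n _] := (RE x' y).1 r'; case: (n x h r).
  by have [n _] := (RE x y).1 r; case: (n x' h r').
have mono x y x' y' : R x y -> R x' y' -> (olt x x' <-> olt y y').
  have half u v u' v' : R u v -> R u' v' -> olt v v' -> olt u u'.
    move=> r r' h; have [u'' h' r''] := ((RE u' v').1 r').2 _ h.
    by rewrite (inj _ _ _ r r'').
  move=> r r'; split; last exact: half.
  move=> h; case: (olt_total y y') => // [e|h'].
    by rewrite e in r; move: h; rewrite (inj _ _ _ r r') => /olt_irr.
  by case: (olt_irr (olt_trans h (half _ _ _ _ r' r h'))).
have dom x y x' : R x y -> olt x' x -> exists y', R x' y'.
  move=> r h.
  have [|y' [h1 h2]] := @wf_min _ _ (fun y => forall x'', olt x'' x' -> ~ R x'' y)
    (@olt_wf b).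
    by exists y => x'' h'; apply: ((RE x y).1 r).1; exact: olt_trans h.
  exists y'; apply/RE; split=> // z /h2 n.
  by apply: contrapT => H; apply: n => x'' l r''; apply: H; exists x''.
case: (pselect (forall y, exists x, R x y)) => [/choice [h hh]|/existsNP n].
  left; exists h; split=> [y y'|y z lt]; first by rewrite (mono _ _ _ _ (hh y) (hh y')).
  by have [y' r] := dom _ _ _ (hh y) lt; exists y'; exact: inj r (hh y').
have [i [ni mi]] := wf_min (@olt_wf b) n.
have tot x : exists y, R x y.
  have [|y [h1 h2]] := @wf_min _ _ (fun y => forall x', olt x' x -> ~ R x' y)
    (@olt_wf b).
    by exists i => x' _ r; apply: ni; exists x'.
  exists y; apply/RE; split=> // z /h2 k.
  by apply: contrapT => H; apply: k => x'' l r''; apply: H; exists x''.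
have [f hf] := choice tot.
right; exists i, f; split=> [x y|z]; first exact: mono.
split=> [lt|[x ->]].
  have [x r] := contrapT (mi z lt); exists x.
  case: (olt_total z (f x)) => // h.
    have [x' h' r'] := ((RE _ _).1 (hf x)).2 _ h.
    by move: h'; rewrite (inj _ _ _ r r') => /olt_irr.
  have [x' h' r'] := ((RE _ _).1 r).2 _ h.
  by move: h'; rewrite (inj _ _ _ r' (hf x)) => /olt_irr.
case: (olt_total (f x) i) => // [e|h]; first by case: ni; exists x; rewrite -e.
by case: ni; have [x' _ r'] := ((RE _ _).1 (hf x)).2 _ h; exists x'.
Qed.

Section DefinableOrdinals.
Variables (N : structure) (lambda : ord_type) (M : option lambda -> structure).
Hypothesis hM : tarski_hierarchy N M.
Variable B : base.
Hypothesis NB : base_for N B.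

Definition odef (o : option lambda) : Prop :=
  exists rho f, ord_copy o rho f /\ ndef2 B rho.

Lemma odef_canonic o : odef o -> exists P, canonic_universal (M o) P.
Proof.
move=> [rho [f [hr hd]]].
have [H hH] := hierarchy_exists B (lt_wf hr).
exists (level_universal B f H o); apply: (level_canonic hM NB hr hd hH); first by left.
by apply: (level_ok_all hM NB hr hd hH); left.
Qed.

Lemma odef_zero o : is_zero o -> odef o.
Proof.
move=> z; exists (fun _ _ => False), (fun _ => 0); split; last exact: dfn_false.
by split=> // j k h; case: (z _ h).
Qed.

Lemma odef_below i o : idx_lt i o -> odef o -> odef i.
Proof.
case: i => [i|] // io [rho [f [hr hd]]].
exists (fun c d => rho c d /\ strict rho d (f i)), f; split; last first.
  by rewrite /ndef2; have h := dfn_ndef2 (ndef2_strict hd); have h' := dfn_ndef2 hd;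
    dfn_tac; apply: h; dfn_tac.
have jo j : olt j i -> idx_lt (Some j) o by move=> ji; exact: (@idx_trans _ _ (Some i)).
split=> [j k ji ki|c d [cd /(lt_below hr _ io) [k ki e]]].
  have E := copy_le hr (jo _ ji) (jo _ ki).
  split=> [[/E //]|/E h]; split=> //.
  by apply/(lt_below hr _ io); exists k.
have [j [k' [h1 h2 ec ed]]] := copy_field hr cd.
have ek : k' = k by apply: (copy_inj hr) => //; [exact: jo | rewrite -ed].
exists j, k; split=> //=; move: cd; rewrite ec ed ek (copy_le hr) //; last exact: jo.
by move=> [-> //|jk]; exact: olt_trans ki.
Qed.

Lemma odef_succ i k : is_succ (Some i) k -> odef (Some i) -> odef k.
Proof.
move=> [ik no] [rho [f [hr hd]]].
(* All points are shifted by one; 0 becomes the new greatest element. *)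
pose f' j := if pselect (olt j i) then (f j).+1 else 0.
pose rho' c d := (d = 0 /\ (c = 0 \/ exists c', c = c'.+1 /\ rho c' c')) \/
  (exists c' d', c = c'.+1 /\ d = d'.+1 /\ rho c' d').
exists rho', f'; split; last first.
  rewrite /ndef2 /rho'; have h := dfn_ndef2 hd; dfn_tac; apply: h; dfn_tac.
have kP j : idx_lt (Some j) k <-> olt j i \/ j = i.
  split=> [jk|[ji|-> //]]; last exact: (@idx_trans _ _ (Some i)).
  by case: (olt_total j i) => h; [left|right|case: (no (Some j))].
have f'l j : olt j i -> f' j = (f j).+1 by rewrite /f'; case: pselect.
have f'i : f' i = 0 by rewrite /f'; case: pselect => // h; case: (olt_irr h).
have rr j : olt j i -> rho (f j) (f j) by move=> ji; apply/(copy_le hr) => //; left.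
split=> [j j'|c d].
  rewrite !kP => -[ji|->] [ji'|->]; rewrite /rho' ?f'i ?f'l //.
  - split=> [[[//]|[c [d [[<-] [[<-]]]]]]|/(copy_le hr ji ji') h].
      by move/(copy_le hr ji ji').
    by right; exists (f j), (f j').
  - split=> _; first by right.
    by left; split=> //; right; exists (f j); split=> //; exact: rr.
  - split=> [[[//]|[c [d [//]]]]|[e|ij]].
      by case: (@olt_irr lambda i); rewrite {1}e.
    by case: (@olt_irr lambda i); exact: olt_trans ij ji'.
  - by split=> _; left; split=> //; left.
move=> [[-> [->|[c' [-> h]]]]|[c' [d' [-> [-> h]]]]].
- by exists i, i; rewrite f'i; split=> //; apply/kP; right.
- have [j [_ [ji _ e _]]] := copy_field hr h.
  by exists j, i; rewrite f'i f'l // -e; split=> //; apply/kP; left.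
- have [j [j' [ji ji' e e']]] := copy_field hr h.
  by exists j, j'; rewrite !f'l // -e -e'; split=> //; apply/kP; left.
Qed.

(** The empty ordering is definable, and a definable ordering can be prolonged by
    one point. *)
Lemma odef_limit o : ~ odef o -> (forall i, idx_lt i o -> odef i) -> is_limit o.
Proof.
move=> no h; case: (idx_cases o) => // [z|[i io]]; first by case: no; exact: odef_zero.
by case: no; apply: odef_succ io (h _ io.1).
Qed.

(** Otherwise [o] would be isomorphic to an initial segment of the well-ordering,
    and such a segment is definable. *)
Lemma wellorder_below o (S : nat -> Prop) (lt : nat -> nat -> Prop) : ~ odef o ->
  ndef B (fun v => S (v 0)) -> ndef2 B lt -> well_founded lt ->
  (forall c d, lt c d -> S c /\ S d) ->
  (forall c d e, lt c d -> lt d e -> lt c e) ->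
  (forall c d, S c -> S d -> [\/ lt c d, c = d | lt d c]) ->
  exists i f, idx_lt (Some i) o /\
    ord_copy (Some i) (fun c d => S c /\ S d /\ (c = d \/ lt c d)) f.
Proof.
move=> no hS hlt wf ltS tr tot.
pose rho c d := S c /\ S d /\ (c = d \/ lt c d).
have irr c : ~ lt c c.
  by elim/(well_founded_ind wf): c => c IH h; exact: (IH c h h).
have hrho : ndef2 B rho.
  rewrite /ndef2 /rho; have h := dfn_ndef2 hlt.
  by dfn_tac; exact: (dfn_pred1 hS (dff_var _ _ _)).
pose T := {c : nat | S c}.
have oT_trans (x y z : T) : lt (sval x) (sval y) -> lt (sval y) (sval z) ->
  lt (sval x) (sval z) by exact: tr.
have oT_tot (x y : T) : [\/ lt (sval x) (sval y), x = y | lt (sval y) (sval x)].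
  case: (tot _ _ (svalP x) (svalP y)) => h; [constructor 1 | constructor 2 |
    constructor 3] => //.
  by case: x y h => [c hc] [d hd] /= e; subst; congr exist; exact: Prop_irrelevance.
have oT_wf : well_founded (fun x y : T => lt (sval x) (sval y)).
  move=> x; move: {2}(sval x) (erefl (sval x)) => c; move: x.
  elim/(well_founded_ind wf): c => c IH x e; apply: Acc_intro => y h.
  by apply: (IH (sval y)) => //; rewrite -e.
pose oT := OrdType oT_trans oT_tot oT_wf.
have noN : ~ odef None.
  by move=> h; apply: no; case: o => // i; exact: odef_below h.
have None_repr (f : lambda -> nat) (rho' : nat -> nat -> Prop) :
    ord_copy None rho' f -> ndef2 B rho' -> False by move=> r d; apply: noN; exists rho', f.
case: (ord_compare lambda oT) => [[f [f_mono f_init]]|[m [f [f_mono f_init]]]];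
  last first.
  have Ef (j : lambda) : lt (sval (f j)) (sval m) by apply/f_init; exists j.
  case: (@None_repr (fun j => sval (f j)) (fun c d => rho c d /\ lt d (sval m))).
    split=> [j k _ _|c d [[Sc [Sd cd]] dm]].
      split=> [[[_ [_ [e|h]]] _]|h].
      - left; case: (olt_total j k) => // /f_mono /= h; move: h; rewrite e => /irr [].
      - by right; apply/f_mono.
      - split=> //; split; [exact: svalP | split; [exact: svalP|]].
        by case: h => [->|/f_mono h]; [left | right].
    have cm : lt c (sval m) by case: cd => [-> //|h]; exact: tr dm.
    have [j ej] := (f_init (exist _ c Sc)).1 cm.
    have [k ek] := (f_init (exist _ d Sd)).1 dm.
    by exists j, k; rewrite -ej -ek.
  by rewrite /ndef2; have h := dfn_ndef2 hrho; have h' := dfn_ndef2 hlt; dfn_tac;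
    apply: h'; dfn_tac.
have f_inj x y : f x = f y -> x = y.
  move=> e; case: (oT_tot x y) => // h.
    by have /f_mono := (h : olt (x : oT) y); rewrite e => /olt_irr.
  by have /f_mono := (h : olt (y : oT) x); rewrite e => /olt_irr.
pose inv (j : lambda) : nat := if pselect (exists x : oT, j = f x) is left e
  then sval (projT1 (cid e)) else 0.
have invE x : inv (f x) = sval x.
  rewrite /inv; case: pselect => [e|[]]; last by exists x.
  by case: (cid e) => y /= /f_inj ->.
pose seg (o' : option lambda) := forall j, idx_lt (Some j) o' <-> exists x, j = f x.
have [o' ho'] : exists o', seg o'.
  case: (pselect (forall j, exists x, j = f x)) => [h|/existsNP h].
    by exists None => j; split=> // _; exact: h.
  have [i [ni mi]] := wf_min (@olt_wf lambda) h; exists (Some i) => j.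
  split=> /= [ji|[x e]]; first exact: contrapT (mi j ji).
  case: (olt_total j i) => // [e'|ij]; first by case: ni; exists x; rewrite -e'.
  by rewrite e in ij; have [y e'] := f_init _ _ ij; case: ni; exists y.
have ho : ord_copy o' rho inv.
  split=> [j k /ho' [x ->] /ho' [y ->]|c d [Sc [Sd h]]]; last first.
    exists (f (exist _ c Sc)), (f (exist _ d Sd)); rewrite !invE.
    by split=> //; apply/ho'; [exists (exist _ c Sc) | exists (exist _ d Sd)].
  rewrite !invE; split=> [[_ [_ [e|h]]]|h].
  - left; congr f; case: (oT_tot x y) => //; rewrite e => /irr //.
  - by right; apply/(f_mono x y).
  - split; [exact: svalP | split; [exact: svalP|]].
    by case: h => [/f_inj ->|/f_mono h]; [left | right].
case: (idx_total o' o) => h.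
- case: o' ho' ho h => [i|] ho' ho h; last by case: o h {no}.
  by exists i, inv.
- by case: no; rewrite -h; exists rho, inv.
- by case: no; apply: odef_below h _; exists rho, inv.
Qed.

Lemma definable_ordinal_odef : definable_ordinal N lambda -> odef None.
Proof.
move=> [rho [hd [lin [f [finj fran fP]]]]].
have [lr lt_ la _] := lin.
have fR j : rho [tuple f j; f j].
  have : Rng rho (f j) by rewrite -fran; exists j.
  by move=> [x /lr []].
exists (fun c d => rho [tuple c; d]), f; split.
  split=> [j k _ _|c d cd].
    split=> [h|[->|/fP []]] //.
    case: (pselect (f j = f k)) => [/finj|ne]; first by left.
    by right; apply/fP.
  have [cc dd] := lr _ _ cd.
  have [j _ ej] : range f c by rewrite fran; exists c.
  have [k _ ek] : range f d by rewrite fran; exists c.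
  by exists j, k.
have := dfn_definable (Zf := id) (fun s => @base_symbol_dfn N B NB s oracle id) hd.
by apply: dfn_ext => _ v; rewrite vtup2.
Qed.

Lemma odef_definable_ordinal (b : ord_type) (i : lambda) (g : b -> lambda) :
  (forall x y, olt x y <-> olt (g x) (g y)) ->
  (forall z, olt z i <-> exists x, z = g x) ->
  odef (Some i) -> definable_ordinal N b.
Proof.
move=> gm gi [rho [f [hr hd]]].
have lti x : olt (g x) i by apply/gi; exists x.
have field c d : rho c d -> exists x y, c = f (g x) /\ d = f (g y).
  move=> /(copy_field hr) [j [k [/gi [x ->] /gi [y ->] -> ->]]].
  by exists x, y.
have rhoE x y : rho (f (g x)) (f (g y)) <-> g x = g y \/ olt (g x) (g y).
  exact: (copy_le hr (lti x) (lti y)).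
exists [set t | rho (tnth t ord0) (tnth t ord_max)]; split.
  have := @definable_of_dfn N B NB N (fun _ _ _ => False)
    (fun v => rho (v 0) (v 1)) 2 (fun s h => h) (fun _ => definable_false _ _).
  rewrite (_ : [set t | _] = [set t : 2.-tuple nat | rho (tnth t ord0) (tnth t ord_max)]).
    by apply; exact: (dfn_ndef2 hd (dff_var _ _ 0) (dff_var _ _ 1)).
  by apply/seteqP; split=> t /=; rewrite !(tnth_nth 0).
have T2 c d : [set t | rho (tnth t ord0) (tnth t ord_max)] [tuple c; d] = rho c d.
  by rewrite /= !(tnth_nth 0).
have Rn y : Rng [set t | rho (tnth t ord0) (tnth t ord_max)] y <->
    exists x, y = f (g x).
  split=> [[x]|[x ->]].
    by rewrite T2 => /field [_ [y' [_ ->]]]; exists y'.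
  by exists (f (g x)); rewrite T2; apply/rhoE; left.
have ginj x y : g x = g y -> x = y.
  move=> e; case: (olt_total x y) => // /gm; rewrite e => /olt_irr //.
have finj x y : f (g x) = f (g y) -> x = y.
  by move=> e; apply: ginj; exact: (copy_inj hr (lti x) (lti y)).
split.
  split=> [c d|c d e|c d|c d]; rewrite ?T2.
  - by move=> /field [x [y [-> ->]]]; split; apply/rhoE; left.
  - move=> h h'; have [x [y [ex ey]]] := field _ _ h.
    have [_ [z [_ ez]]] := field _ _ h'; subst.
    move: h h'; rewrite !rhoE => -[->|h] [<-|h']; [by left|by right|by right|].
    by right; exact: olt_trans h'.
  - move=> h h'; have [x [y [ex ey]]] := field _ _ h; subst.
    move: h h'; rewrite !rhoE => -[-> //|h] [-> //|h'].
    by case: (olt_irr (olt_trans h h')).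
  - move=> /Rn [x ->] /Rn [y ->]; rewrite ?T2 !rhoE.
    by case: (olt_total (g x) (g y)) => h; [left; right|left; left|right; right].
exists (fun x => f (g x)); split.
- exact: finj.
- by apply/seteqP; split=> [y [x _ <-]|y /Rn [x ->]]; [apply/Rn; exists x | exists x].
- move=> x y; rewrite T2 rhoE gm; split=> [h|[[/ginj ->|//]] //].
  by split; [right | move=> /finj e; rewrite e in h; exact: olt_irr h].
Qed.

End DefinableOrdinals.

(** * First-order recursion along a definable well-ordering *)

Section Recursion.
Variables (N : structure) (lambda : ord_type) (M : option lambda -> structure).
Hypothesis hM : tarski_hierarchy N M.
Variable B : base.
Hypothesis NB : base_for N B.

Definition local_step (r : nat -> nat -> Prop)
    (Theta : (nat -> Prop) -> nat -> nat -> Prop) : Prop :=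
  forall W W' c w, (forall d u, r d c -> (W (pr d u) <-> W' (pr d u))) ->
    (Theta W c w <-> Theta W' c w).

Lemma recursion_exists r Theta : well_founded r -> local_step r Theta ->
  exists T : nat -> nat -> Prop, forall c w, T c w <-> Theta (pair_set T) c w.
Proof.
move=> wf loc.
pose step c (rec : forall d, r d c -> nat -> Prop) w :=
  Theta (fun z => exists h : r (p1 z) c, rec (p1 z) h (p2 z)) c w.
exists (Fix wf (fun _ => nat -> Prop) step) => c w.
rewrite Fix_eq /step => [|{}c f g fg].
  apply: loc => d u h; rewrite pair_setE; split=> [[h']|k]; rewrite ?p1K ?p2K //.
have -> : f = g by apply: functional_extensionality_dep => d;
  apply: functional_extensionality_dep => h.
by [].
Qed.

Variables (i : lambda) (rho : nat -> nat -> Prop) (f : lambda -> nat).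
Hypotheses (hrep : ord_copy (Some i) rho f) (hrho : ndef2 B rho).
Notation lt := (strict rho).
Variable Theta : (nat -> Prop) -> nat -> nat -> Prop.
Hypothesis loc : local_step lt Theta.
Hypothesis hTheta :
  udfn B (fun Z v => Theta (fun w => Z 0 w 0) (v 0) (v 1)).
Variable T : nat -> nat -> Prop.
Hypothesis hT : forall c w, T c w <-> Theta (pair_set T) c w.

Definition rec_good (W : nat -> Prop) (c : nat) : Prop :=
  forall d u, d = c \/ lt d c -> (W (pr d u) <-> Theta W d u).

Lemma rec_good_unique W c : rec_good W c -> forall u, W (pr c u) <-> T c u.
Proof.
elim/(well_founded_ind (lt_wf hrep)): c => c IH g u.
rewrite g ?hT; last by left.
apply: loc => d v dc; rewrite pair_setE; apply: IH => // d' v' h.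
by apply: g; right; case: h => [->|h] //; exact: (lt_trans hrep) h dc.
Qed.

Lemma dfn_rec_good I (Zf : I -> oracle) (Y : I -> (nat -> nat) -> nat -> Prop) F :
  dfn B Zf (fun i v => Y i (fun k => v k.+1) (v 0)) -> dff B Zf F ->
  dfn B Zf (fun i v => rec_good (Y i v) (F i v)).
Proof.
move=> hY hF.
apply: (@dfn_sets _ _ _ (fun W _ c => rec_good W c) Y Y F) => //.
rewrite /rec_good; have h := dfn_ndef2 (ndef2_strict hrho).
by dfn_tac; [apply: h; dfn_tac | exact: (dfn_rename (fun k => 1 - k) hTheta)].
Qed.

Definition rec_set (o : option lambda) : set (2.-tuple nat) :=
  [set t | below f o (tnth t ord0) /\ T (tnth t ord0) (tnth t ord_max)].

(** The same mechanism as for iterated truth: the proper initial parts of the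
    recursion of length [j] are sections of a universal predicate for [M j], where
    [rec_good] recognizes them, so their union is definable one level higher. *)
Lemma rec_definable j k : j = i \/ olt j i -> idx_lt (Some j) k ->
  definable (M k) (rec_set (Some j)).
Proof.
elim/(well_founded_ind (@olt_wf lambda)): j k => j IH k ji jk.
have [j1 sj] := idx_succ j.
have [P [canP eP]] := th_succ hM sj.
suff D : definable (M j1) (rec_set (Some j)).
  by case: (succ_le sj jk) => [<- //|h]; exact: definable_mono (M_mono hM h) D.
have j_le : le0 (Some i) (Some j) by case: ji => [->|h]; [left | right].
have olti m : olt m j -> olt m i by case: ji => [-> //|h] h'; exact: olt_trans h.
have hlt := dfn_ndef2 (ndef2_strict hrho).
have upto m : olt m j -> exists n, forall w, P [tuple n; w] <->
    (p1 w = f m \/ lt (p1 w) (f m)) /\ T (p1 w) (p2 w).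
  move=> mj; have mi := olti m mj.
  pose X w := (p1 w = f m \/ lt (p1 w) (f m)) /\ T (p1 w) (p2 w).
  pose Z : oracle := fun _ a b => below f (Some m) a /\ T a b.
  have Xdef : definable_sets (M (Some j)) X.
    have hZ : forall d, definable (M (Some j))
        [set t : 2.-tuple nat | Z d (tnth t ord0) (tnth t ord_max)].
      by move=> d; exact: (IH m mj (Some j) (or_intror mi) mj).
    have bm c : lt c (f m) <-> below f (Some m) c by rewrite (lt_below hrep).
    have := @definable_of_dfn N B NB (M (Some j)) Z (fun v => X (v 0)) 1
      (@N_sub_M _ _ _ hM _) hZ.
    rewrite /definable_sets /= (_ : [set t : 1.-tuple nat | X (nth 0 t 0)] =
      [set t | X (thead t)]); last first.
      by apply/seteqP; split=> t /=; rewrite /thead (tnth_nth 0).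
    apply; apply: (@dfn_ext _ _ _ (fun _ v =>
      (p1 (v 0) = f m /\ Theta (fun z => Z 0 (p1 z) (p2 z)) (f m) (p2 (v 0))) \/
      Z 0 (p1 (v 0)) (p2 (v 0)))).
      move=> _ v; rewrite /X /Z bm; split.
        move=> [[e h]|[h h']]; [|by split=> //; right].
        split; first by left.
        rewrite e; apply/hT; apply: iffLR h; apply: loc => d u dm.
        by rewrite pair_setE p1K p2K; split=> [[]|] // h; split=> //; apply/bm.
      move=> [[e|h] h']; [left|by right].
      rewrite e in h' *; split=> //; apply: iffLR ((hT _ _).1 h').
      apply: loc => d u dm.
      by rewrite pair_setE p1K p2K; split=> [h|[]] //; split=> //; apply/bm.
    have hZ' F G : dff B (fun _ : unit => Z) F -> dff B (fun _ : unit => Z) G ->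
      dfn B (fun _ : unit => Z) (fun i v => Z 0 (F i v) (G i v)).
      exact: dfn_oracle.
    apply: dfn_or; last by apply: hZ'; dfn_tac.
    apply: dfn_and; first by dfn_tac.
    have hTh : dfn B (fun _ : unit => Z) (fun i v =>
        Theta (fun z => Z 0 (p1 z) (p2 z)) (v 0) (v 1)).
      apply: (@dfn_subst_oracle B _ (fun _ : unit => Z)
        (fun Z v => Theta (fun w => Z 0 w 0) (v 0) (v 1))
        (fun _ _ _ a _ => Z 0 (p1 a) (p2 a)) hTheta) => c.
      by apply: hZ'; dfn_tac.
    pose F k (_ : unit) (v : nat -> nat) := if k is 0 then f m else p2 (v 0).
    by apply: (dfn_subst (F := F) hTh) => -[|l]; rewrite /F; dfn_tac.
  by have [n _ e] := canP.1 _ Xdef; exists n => w; rewrite -/(X w) -e.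
have E c w : below f (Some j) c -> (T c w <-> exists n,
    rec_good (fun z => P [tuple n; z]) c /\ P [tuple n; pr c w]).
  move=> [m mj ->]; split=> [Tw|[n [g]]]; last by rewrite (rec_good_unique g).
  have [n hn] := upto m mj; exists n; split; last first.
    by apply/hn; rewrite p1K p2K; split=> //; left.
  move=> d u dm; rewrite hn p1K p2K hT.
  have -> : (fun z => P [tuple n; z]) = fun z =>
    (p1 z = f m \/ lt (p1 z) (f m)) /\ T (p1 z) (p2 z).
    by apply/funext=> z; apply/propext.
  have L : Theta (pair_set T) d u <-> Theta (fun z =>
    (p1 z = f m \/ lt (p1 z) (f m)) /\ T (p1 z) (p2 z)) d u.
    apply: loc => d' u' h; rewrite pair_setE p1K p2K; split=> [h'|[]] //; split=> //.
    by right; case: dm => [<- //|h2]; exact: (lt_trans hrep) h h2.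
  by rewrite -L; split=> [[]|].
pose ZP : oracle := fun _ a b => P [tuple a; b].
have hP I (Zf : I -> oracle) F G : Zf = (fun _ => ZP) ->
    dff B Zf F -> dff B Zf G -> dfn B Zf (fun i v => P [tuple F i v; G i v]).
  by move=> e hF hG; have := dfn_oracle 0 hF hG; rewrite e.
have hZ d : definable (M j1) [set t : 2.-tuple nat |
    ZP d (tnth t ord0) (tnth t ord_max)].
  rewrite (_ : [set t | _] = P); first by apply: definable_symbol; rewrite eP; right.
  by apply/seteqP; split=> t; rewrite /ZP /= tuple2_eta.
have := @definable_of_dfn N B NB (M j1) ZP
  (fun v => below f (Some j) (v 0) /\ T (v 0) (v 1)) 2 (@N_sub_M _ _ _ hM _) hZ.
rewrite (_ : [set t | _] = rec_set (Some j)); last first.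
  by apply/seteqP; split=> t; rewrite /rec_set /= !(tnth_nth 0).
apply; apply: (@dfn_ext _ _ _ (fun _ v => below f (Some j) (v 0) /\
  exists n, rec_good (fun z => P [tuple n; z]) (v 0) /\ P [tuple n; pr (v 0) (v 1)])).
  by move=> _ v; split=> -[b h]; split=> //; apply/E.
apply: dfn_and.
  by apply: (dfn_below hrep hrho j_le); dfn_tac.
apply: dfn_ex; apply: dfn_and; last by apply: hP; dfn_tac.
apply: (@dfn_rec_good _ _ (fun _ v z => P [tuple v 0; z])); last by dfn_tac.
by apply: hP; dfn_tac.
Qed.

End Recursion.

(** * Trees and the Kleene-Brouwer order *)

Definition is_tree (T : nat -> Prop) : Prop :=
  forall f n m, T (pre f n) -> m <= n -> T (pre f m).

Definition branch (T : nat -> Prop) (f : nat -> nat) : Prop := forall n, T (pre f n).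

Definition extends (x y : nat) : Prop :=
  len y < len x /\ forall k, k < len y -> env x k = env y k.

Definition kb (T : nat -> Prop) (x y : nat) : Prop :=
  T x /\ T y /\ (extends x y \/ exists i, i < len x /\ i < len y /\
    (forall k, k < i -> env x k = env y k) /\ env x i < env y i).

Lemma kb_trans T x y z : kb T x y -> kb T y z -> kb T x z.
Proof.
move=> [Tx [_ h]] [_ [Tz h']]; split=> //; split=> //.
case: h => [[l e]|[i [ix [iy [e lt]]]]]; case: h' => [[l' e']|[j [jy [jz [e' lt']]]]].
- by left; split=> [|k kz]; [lia | rewrite e ?e' //; lia].
- right; exists j; split; first lia.
  split=> //; split=> [k kj|]; last by rewrite e.
  by rewrite e ?e' //; lia.
- case: (ltnP i (len z)) => h; last first.
    by left; split=> [|k kz]; [lia | rewrite e ?e' //; lia].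
  right; exists i; split=> //; split=> //.
  split=> [k ki|]; last by rewrite -e'.
  by rewrite e // e' //; lia.
right; case: (ltngtP i j) => h.
- exists i; split=> //; split; first lia.
  split=> [k ki|]; last by rewrite -e'.
  by rewrite e // e' //; lia.
- exists j; split; first lia; split=> //.
  split=> [k kj|]; last by rewrite e.
  by rewrite e ?e' //; lia.
exists i; split=> //; split; first by rewrite h.
split=> [k ki|]; first by rewrite e // e' // -h.
by apply: ltn_trans lt _; rewrite h.
Qed.

Lemma kb_total T x y : T x -> T y -> [\/ kb T x y, x = y | kb T y x].
Proof.
move=> Tx Ty.
case: (pselect (exists i, i < minn (len x) (len y) /\ env x i <> env y i)) => [h|h].
  have h' : exists i, (i < minn (len x) (len y)) && (env x i != env y i).
    by case: h => i [lt /eqP ne]; exists i; rewrite lt.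
  case: (ex_minnP h') => i /andP [lt ne] mi.
  have e k : k < i -> env x k = env y k.
    move=> ki; apply/eqP; apply: contraT => ne'.
    by have := mi k; rewrite ne' andbT; lia.
  move: ne; rewrite neq_ltn => /orP [l|l]; [constructor 1|constructor 3];
    split=> //; split=> //; right; exists i; do 2! [split; first lia];
    by split=> // k ki; rewrite e.
have e k : k < len x -> k < len y -> env x k = env y k.
  move=> kx ky; apply: contrapT => ne; apply: h; exists k; split=> //; lia.
case: (ltngtP (len x) (len y)) => l.
- by constructor 3; split=> //; split=> //; left; split=> // k kx; rewrite e //; lia.
- by constructor 1; split=> //; split=> //; left; split=> // k kx; rewrite e //; lia.
- constructor 2; rewrite -(pre_env x) -(pre_env y) l; apply: eq_pre => k kx.
  by rewrite e // l.
Qed.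

Lemma min_wf (X : Type) (R : X -> X -> Prop) :
  (forall D : X -> Prop, (exists x, D x) -> exists x, D x /\ forall y, R y x -> ~ D y) ->
  well_founded R.
Proof.
move=> h x; apply: contrapT => nA.
have [y [ny my]] := h (fun x => ~ Acc R x) (ex_intro _ x nA).
by apply: ny; apply: Acc_intro => z /my /contrapT.
Qed.

(** A nonempty set of nodes without least element has a leftmost branch, which
    is found one value at a time. *)
Lemma kb_wf T : is_tree T -> (forall f, ~ branch T f) -> well_founded (kb T).
Proof.
move=> hT no; apply: min_wf => D [x0 Dx0]; apply: contrapT => nomin.
have {nomin} down x : D x -> exists y, D y /\ kb T y x.
  move=> Dx; apply: contrapT => H; apply: nomin; exists x; split=> // y yx Dy.
  by apply: H; exists y.
have DT x : D x -> T x by move=> /down [y [_ [_ []]]].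
(* [inv s]: some node of [D] passes through [s], and none passes to its left. *)
pose agree (s : seq nat) x := forall k, k < size s -> env x k = nth 0 s k.
pose inv (s : seq nat) := (exists x, D x /\ size s <= len x /\ agree s x) /\
  (forall y, D y -> ~ exists i, i < size s /\ i < len y /\
     (forall k, k < i -> env y k = nth 0 s k) /\ env y i < nth 0 s i).
have step s : exists a, inv s -> inv (rcons s a).
  case: (pselect (inv s)) => [[[x [Dx [lx ax]]] left]|ni]; last by exists 0.
  have [y [Dy [ly ay]]] : exists y, D y /\ size s < len y /\ agree s y.
    move: lx; rewrite leq_eqVlt => /orP [/eqP lx|lx]; last by exists x.
    have [y [Dy [_ [_ [[l e]|[i [iy [ix [e lt]]]]]]]]] := down x Dx.
      exists y; split=> //; split; first by rewrite lx.
      by move=> k ks; rewrite e -?lx // ax.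
    case: (left y Dy); exists i; rewrite lx; split=> //; split=> //.
    split=> [k ki|]; first by rewrite e // ax // lx; lia.
    by rewrite -ax // lx.
  pose V a := exists y, D y /\ size s < len y /\ agree s y /\ env y (size s) = a.
  have hV : exists a, `[< V a >] by exists (env y (size s)); apply/asboolP; exists y.
  case: (ex_minnP hV) => a /asboolP [z [Dz [lz [az ez]]]] mina.
  exists a => _; split.
    exists z; split=> //; rewrite size_rcons; split=> // k.
    rewrite size_rcons ltnS leq_eqVlt nth_rcons => /orP [/eqP ->|ks].
      by rewrite ltnn eqxx.
    by rewrite ks az.
  move=> u Du [i]; rewrite size_rcons ltnS leq_eqVlt.
  move=> [/orP [/eqP ei|is_] [iu [e lt]]].
    move: lt; rewrite ei nth_rcons ltnn eqxx ltnNge => /negP; apply; apply: mina.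
    apply/asboolP; exists u; split=> //; split; first by rewrite -ei.
    split=> // k ks; rewrite e ?ei // nth_rcons ks //.
  case: (left u Du); exists i; split=> //; split=> //.
  split=> [k ki|]; last by move: lt; rewrite nth_rcons is_.
  rewrite e // nth_rcons; have -> // : k < size s by lia.
have [g hg] := choice step.
pose S n := iter n (fun s => rcons s (g s)) [::].
have invS n : inv (S n).
  elim: n => [|n IH]; last exact: hg.
  by split=> [|y _ [i []] //]; exists x0; split=> //; split=> // k.
pose f n := g (S n).
have SE n : S n = mkseq f n.
  by elim: n => //= n IH; rewrite /S /= -/(S n) mkseqS -IH.
case: (no f) => n.
have [[x [Dx [lx ax]]] _] := invS n.
have szn : size (S n) = n by rewrite SE size_mkseq.
have -> : pre f n = pre (env x) n.
  apply: eq_pre => k kn; rewrite ax ?szn // SE nth_mkseq //.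
by apply: (hT _ (len x)); [rewrite pre_env; exact: DT | rewrite -szn].
Qed.

(** Baire category for the closed set of branches: otherwise one could build
    a branch in stages, at stage [e] fixing a finite part that refutes the
    condition number [e]. *)
Lemma baire (T : nat -> Prop) (X : nat -> Prop) (pos : nat -> nat -> nat) f0 :
  branch T f0 ->
  (forall f, branch T f -> exists e, forall m, X m <-> f (pos e m) <> 0) ->
  exists e n g, branch T g /\ forall f, branch T f ->
    (forall k, k < n -> f k = g k) -> forall m, X m <-> f (pos e m) <> 0.
Proof.
move=> p0 cover; apply: contrapT => H.
have step (x : nat * (nat * (nat -> nat))) : exists y : nat * (nat -> nat),
    branch T x.2.2 -> [/\ branch T y.2, x.2.1 <= y.1, x.1 < y.1,
      (forall k, k < x.2.1 -> y.2 k = x.2.2 k) &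
      exists m, pos x.1 m < y.1 /\ ~ (X m <-> y.2 (pos x.1 m) <> 0)].
  case: x => e [n g] /=; case: (pselect (branch T g)) => pg; last by exists (0, g).
  have [g' [pg' ag [m hm]]] : exists g', [/\ branch T g',
      (forall k, k < n -> g' k = g k) & exists m, ~ (X m <-> g' (pos e m) <> 0)].
    apply: contrapT => H'; apply: H; exists e, n, g; split=> // f pf af m.
    by apply: contrapT => nm; apply: H'; exists f; split=> //; exists m.
  exists (maxn n (maxn e.+1 (pos e m).+1), g') => _ /=.
  by split=> //; [lia | lia | exists m; split=> //; lia].
have [F hF] := choice step.
(* A stage consists of a branch and of the length up to which it is fixed. *)
pose seq := fix seq (e : nat) : nat * (nat -> nat) :=
  if e is e'.+1 then F (e', seq e') else (0, f0).
have ps e : branch T (seq e).2.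
  by elim: e => //= e IH; have [] := hF (e, seq e) IH.
have S e := hF (e, seq e) (ps e).
have mono e d : e <= d -> (seq e).1 <= (seq d).1 /\
    forall k, k < (seq e).1 -> (seq d).2 k = (seq e).2 k.
  elim: d => [|d IH]; first by rewrite leqn0 => /eqP ->.
  rewrite leq_eqVlt => /orP [/eqP -> //|ed].
  have [l h] := IH ed; have [_ /= l' _ h' _] := S d.
  by split=> [|k ke]; [lia | rewrite h' ?h //; lia].
pose f k := (seq k.+1).2 k.
have fE e k : k < (seq e).1 -> f k = (seq e).2 k.
  move=> ke; rewrite /f; have [_ /= _ l _ _] := S k.
  case: (leqP k.+1 e) => h; first by have [_ ->] := mono _ _ h.
  by have [_ <-] := mono e k.+1 (ltnW h).
have pf : branch T f.
  move=> n; have [_ _ l _ _] := S n; have {}l : n < (seq n.+1).1 := l.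
  have -> : pre f n = pre (seq n.+1).2 n by apply: eq_pre => k kn; apply: fE; lia.
  exact: ps.
have [e he] := cover f pf.
have [_ _ _ _ [m [lm nm]]] := S e.
by apply: nm; rewrite he (fE e.+1).
Qed.

(** * A basis theorem for definable trees *)

Section TreeBasis.
Variables (N : structure) (lambda : ord_type) (M : option lambda -> structure).
Hypothesis hM : tarski_hierarchy N M.
Variable B : base.
Hypothesis NB : base_for N B.
Variables (T : nat -> Prop) (X : nat -> Prop) (pos : nat -> nat).
Hypotheses (hT : is_tree T) (Tdef : ndef B (fun v => T (v 0))).
Hypothesis pos_def : ndef B (fun v => v 0 = pos (v 1)).
Variables (n0 : nat) (g : nat -> nat).
Hypotheses (pg : branch T g)
  (Xpos : forall f, branch T f -> (forall k, k < n0 -> f k = g k) ->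
     forall m, X m <-> f (pos m) <> 0).

Let s := pre g n0.

(** Nodes in the neighbourhood of [g] whose answer about [m], if they have one, is
    [b].  By [Xpos] they have a branch through them only if [b] is right. *)
Definition side (b : bool) (m x : nat) : Prop :=
  T x /\ (forall k, k < len x -> k < n0 -> env x k = env s k) /\
  (pos m < len x -> (env x (pos m) <> 0 <-> b)).

Lemma side_pre b m f n : side b m (pre f n) <->
  T (pre f n) /\ (forall k, k < n -> k < n0 -> f k = g k) /\
  (pos m < n -> (f (pos m) <> 0 <-> b)).
Proof.
rewrite /side len_pre; split=> -[h [h1 h2]]; split=> //; split.
- by move=> k kn k0; have := h1 k kn k0; rewrite /s !env_pre.
- by move=> pn; have := h2 pn; rewrite env_pre.
- by move=> k kn k0; rewrite /s !env_pre // h1.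
- by move=> pn; rewrite env_pre //; exact: h2.
Qed.

Lemma side_tree b m : is_tree (side b m).
Proof.
move=> f n k /side_pre [h [h1 h2]] kn; apply/side_pre; split; first exact: hT h kn.
by split=> [j jk|pk]; [apply: h1; lia | apply: h2; lia].
Qed.

Lemma side_branch b m f : branch (side b m) f -> X m <-> b.
Proof.
move=> pf; rewrite (Xpos (f := f)).
- by have /side_pre [_ [_ h]] := pf (pos m).+1; exact: h.
- by move=> n; have /side_pre [] := pf n.
- by move=> k kn; have /side_pre [_ [h _]] := pf n0; exact: h.
Qed.

Lemma side_g m : branch (side `[< X m >] m) g.
Proof.
move=> n; apply/side_pre; split; first exact: pg.
split=> // _; rewrite -Xpos //; by split=> /asboolP.
Qed.

Lemma dff_pos I (Zf : I -> oracle) F :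
  dff B Zf F -> dff B Zf (fun i v => pos (F i v)).
Proof. exact: dff_fun1. Qed.

Lemma dfn_side b I (Zf : I -> oracle) F G : dff B Zf F -> dff B Zf G ->
  dfn B Zf (fun i v => side b (F i v) (G i v)).
Proof.
apply: (@dfn_rel2 _ _ _ (fun m x => side b m x)); rewrite /side.
dfn_tac; try by apply: dff_pos; dfn_tac.
by apply: (dfn_pred1 Tdef); dfn_tac.
Qed.

(** Attempts to build, for the number in front, branches on both sides.  They
    cannot succeed, since only one of the two answers is right. *)
Definition conflict (u : nat) : Prop :=
  len u = 0 \/ exists x y, len u = (len x).+1 /\ len y = len x /\
    (forall k, k < len x -> env u k.+1 = pr (env x k) (env y k)) /\
    side false (env u 0) x /\ side true (env u 0) y.

Definition merge (m : nat) (f h : nat -> nat) : nat -> nat :=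
  scons m (fun k => pr (f k) (h k)).

Lemma conflict_pre F n : conflict (pre F n.+1) <->
  side false (F 0) (pre (fun k => p1 (F k.+1)) n) /\
  side true (F 0) (pre (fun k => p2 (F k.+1)) n).
Proof.
rewrite /conflict len_pre env_pre //; split=> [[//|[x [y [[lx] [ly [e [hx hy]]]]]]]|[hx hy]].
  have -> : pre (fun k => p1 (F k.+1)) n = x.
    rewrite -(pre_env x) -lx; apply: eq_pre => k kn.
    by have := e k; rewrite -lx env_pre // => -> //; rewrite p1K.
  have -> // : pre (fun k => p2 (F k.+1)) n = y.
  rewrite -(pre_env y) ly -lx; apply: eq_pre => k kn.
  by have := e k; rewrite -lx env_pre // => -> //; rewrite p2K.
right; exists (pre (fun k => p1 (F k.+1)) n), (pre (fun k => p2 (F k.+1)) n).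
rewrite !len_pre; do 2! split=> //; split=> // k kn.
by rewrite !env_pre // prK.
Qed.

Lemma conflict_tree : is_tree conflict.
Proof.
move=> F [|n] [|m] //; first by move=> _ _; left; rewrite len_pre.
move=> /conflict_pre [h h'] mn; apply/conflict_pre.
by split; [exact: side_tree h _ | exact: side_tree h' _].
Qed.

Lemma conflict_no_branch F : ~ branch conflict F.
Proof.
move=> pF.
have p0 : branch (side false (F 0)) (fun k => p1 (F k.+1)).
  by move=> n; have /conflict_pre [] := pF n.+1.
have p1' : branch (side true (F 0)) (fun k => p2 (F k.+1)).
  by move=> n; have /conflict_pre [] := pF n.+1.
by have := (side_branch p1').2 isT => /(side_branch p0).1.
Qed.

Lemma conflict_def : ndef B (fun v => conflict (v 0)).
Proof. by rewrite /conflict; dfn_tac; apply: dfn_side; dfn_tac. Qed.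

Lemma kb_conflict_def : ndef2 B (kb conflict).
Proof.
by rewrite /ndef2 /kb /extends; dfn_tac; apply: (dfn_pred1 conflict_def); dfn_tac.
Qed.

(** The recursion states that the rank of a node on the side [false] is at most
    the position of [u] in the Kleene-Brouwer order of the attempts; [w] codes
    [m] together with the node. *)
Definition rank_step (W : nat -> Prop) (u w : nat) : Prop :=
  forall y, side false (p1 w) y -> len y = (len (p2 w)).+1 ->
    (forall k, k < len (p2 w) -> env y k = env (p2 w) k) ->
    exists d, kb conflict d u /\ W (pr d (pr (p1 w) y)).

Lemma rank_step_local : local_step (kb conflict) rank_step.
Proof.
move=> W W' c w h; split=> H y sy ly ay; have [d [dc Wd]] := H y sy ly ay;
  exists d; split=> //; by apply/(h d _ dc).
Qed.

Lemma rank_step_def :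
  udfn B (fun Z v => rank_step (fun w => Z 0 w 0) (v 0) (v 1)).
Proof.
rewrite /rank_step; dfn_tac; first by apply: dfn_side; dfn_tac.
by apply: (dfn_ndef2 kb_conflict_def); dfn_tac.
Qed.

Section Rank.
Variable Q : nat -> nat -> Prop.
Hypothesis QE : forall c w, Q c w <-> rank_step (pair_set Q) c w.

(** Nodes with a rank are in the well-founded part of their side. *)
Lemma rank_sound u m y : Q u (pr m y) ->
  forall f, branch (side false m) f -> pre f (len y) = y -> False.
Proof.
elim/(well_founded_ind (kb_wf conflict_tree conflict_no_branch)): u y => u IH y.
rewrite QE => h f pf fy.
have [|||d [du]] := h (pre f (len y).+1); rewrite ?p1K ?p2K ?len_pre //.
  by move=> k ky; have := env_pre f ky; rewrite fy => ->; rewrite env_pre //; lia.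
rewrite pair_setE => Qd; apply: (IH d du _ Qd f) => //.
by rewrite len_pre.
Qed.

(** If [X m] holds, the branch [g] pairs each node of the side [false] with one of
    the side [true]; longer nodes give longer attempts, which are smaller in the
    Kleene-Brouwer order. *)
Lemma rank_complete m : X m -> forall y, side false m y ->
  Q (pre (merge m (env y) g) (len y).+1) (pr m y).
Proof.
move=> Xm.
have no f : ~ branch (side false m) f by move=> /side_branch [/(_ Xm)].
have node y : side false m y -> conflict (pre (merge m (env y) g) (len y).+1).
  move=> sy; apply/conflict_pre; rewrite /merge /=; split.
    by under eq_fun do rewrite p1K; rewrite pre_env.
  under eq_fun do rewrite p2K.
  have := side_g m (len y); by move: Xm => /asboolP ->.
move=> y; elim/(well_founded_ind (kb_wf (@side_tree false m) no)): y => y IH sy.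
apply/QE => y'; rewrite p1K p2K => sy' ly ay.
have ext : extends y' y by split=> [|k ky]; [lia | exact: ay].
exists (pre (merge m (env y') g) (len y').+1); split; last first.
  rewrite pair_setE; apply: IH => //.
  by split=> //; split=> //; left.
split; first exact: node.
split; first exact: node.
left; split; first by rewrite !len_pre; lia.
rewrite len_pre => k ky; rewrite !env_pre //; last lia.
by case: k ky => //= k ky; rewrite ay.
Qed.

Lemma rank_root m : conflict (cns m 0) /\ (X m <-> Q (cns m 0) (pr m 0)).
Proof.
have len0 : len 0 = 0 by [].
have root h : pre (merge m h g) 1 = cns m 0 by [].
have root_side b : side b m 0.
  have := side_g m 0 => /side_pre [h _].
  by split; [exact: h | split=> [k|]; rewrite len0].
split.
  rewrite -(root (env 0)); apply/conflict_pre; split; exact: root_side.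
split=> [Xm|Qm]; first by have := rank_complete Xm (root_side _).
apply: contrapT => nX; apply: (rank_sound Qm (f := g)) => //.
by have := side_g m; move: nX => /asboolPn/negbTE ->.
Qed.

End Rank.

Lemma neighbourhood_basis o : ~ odef B o -> definable_sets (M o) X.
Proof.
move=> no.
have wf := kb_wf conflict_tree conflict_no_branch.
have [i [f [io hrep]]] := wellorder_below no conflict_def kb_conflict_def wf
  (fun c d h => conj h.1 h.2.1) (@kb_trans conflict) (@kb_total conflict).
set rho := (fun c d => _) in hrep.
have irr c : ~ kb conflict c c.
  by elim/(well_founded_ind wf): c => c IH h; exact: (IH c h h).
have strictE : strict rho = kb conflict.
  apply/funext=> c; apply/funext=> d; apply/propext; rewrite /strict /rho.
  split=> [[[_ [_ [e|]]]] //|h]; split; last by move=> e; rewrite e in h; exact: irr h.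
  by have [hc [hd _]] := h; split=> //; split=> //; right.
have hrho : ndef2 B rho.
  rewrite /ndef2 /rho; have h := dfn_ndef2 kb_conflict_def.
  by dfn_tac; first [apply: h | apply: (dfn_pred1 conflict_def)]; dfn_tac.
have [Q QE] := recursion_exists wf rank_step_local.
have loc : local_step (strict rho) rank_step.
  by rewrite strictE; exact: rank_step_local.
have D := rec_definable hM NB hrep hrho loc rank_step_def QE (or_introl erefl) io.
pose Z : oracle := fun _ a b => below f (Some i) a /\ Q a b.
have := @definable_of_dfn N B NB (M o) Z (fun v => X (v 0)) 1
  (@N_sub_M _ _ _ hM _) (fun=> D).
rewrite /definable_sets /= (_ : [set t : 1.-tuple nat | X (nth 0 t 0)] =
  [set t | X (thead t)]); last first.
  by apply/seteqP; split=> t /=; rewrite /thead (tnth_nth 0).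
apply; apply: (@dfn_ext _ _ _ (fun _ v => Z 0 (cns (v 0) 0) (pr (v 0) 0))).
  move=> _ v; have [c ->] := rank_root QE (v 0); rewrite /Z.
  split=> [[]|h] //; split=> //.
  have : rho (cns (v 0) 0) (cns (v 0) 0) by split=> //; split=> //; left.
  by move=> /(copy_field hrep) [j [_ [ji _ e _]]]; exists j.
by apply: (@dfn_oracle _ _ (fun _ : unit => Z) 0); dfn_tac.
Qed.

End TreeBasis.

Lemma tree_basis (N : structure) (lambda : ord_type) (M : option lambda -> structure)
    (B : base) o (T X : nat -> Prop) (pos : nat -> nat -> nat) f0 :
  tarski_hierarchy N M -> base_for N B -> ~ odef B o ->
  is_tree T -> ndef B (fun v => T (v 0)) ->
  (forall e, ndef B (fun v => v 0 = pos e (v 1))) ->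
  branch T f0 ->
  (forall f, branch T f -> exists e, forall m, X m <-> f (pos e m) <> 0) ->
  definable_sets (M o) X.
Proof.
move=> hM NB no hT Td pd p0 cover.
have [e [n [g [pg h]]]] := baire p0 cover.
exact: (neighbourhood_basis hM NB hT Td (pd e) pg h no).
Qed.

(** * A basis theorem for first-order classes of sets *)

Definition set_oracle (W : nat -> Prop) : oracle := fun _ a _ => W a.

Section TruthTree.
Variables (B : base) (e0 : nat).

(** The position that holds the answer to [y \in W]. *)
Definition ask (y : nat) : nat := pr (catm 1 (code [:: 1])) (cns y 0).

(** A branch [f] stores at [<e, x>] the truth value of [e] at [x], in a structure
    with an additional set; true existential formulas come with the successor of
    a witness.  This makes each condition concern finitely many values. *)
Definition truth_node (n : nat) (f : nat -> nat) : Prop :=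
  (forall x, pr 0 x < n -> f (pr 0 x) = 0) /\
  (forall q x, pr (cneg q) x < n -> pr q x < n ->
    (f (pr (cneg q) x) <> 0 <-> f (pr q x) = 0)) /\
  (forall a b x, pr (cand a b) x < n -> pr a x < n -> pr b x < n ->
    (f (pr (cand a b) x) <> 0 <-> f (pr a x) <> 0 /\ f (pr b x) <> 0)) /\
  (forall q x a, pr (cex q) x < n -> pr q (cns a x) < n ->
    (f (pr (cex q) x) = 0 -> f (pr q (cns a x)) = 0) /\
    (f (pr (cex q) x) = a.+1 -> f (pr q (cns a x)) <> 0)) /\
  (forall c l x, pr (catm (c + c) l) x < n ->
    (f (pr (catm (c + c) l) x) <> 0 <-> brow B c (dec (lookup l x)))) /\
  (forall c l x, pr (catm (c + c).+1 l) x < n -> ask (env (lookup l x) 0) < n ->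
    (f (pr (catm (c + c).+1 l) x) <> 0 <-> f (ask (env (lookup l x) 0)) <> 0)) /\
  (pr e0 0 < n -> f (pr e0 0) <> 0).

Definition truth_tree (x : nat) : Prop := truth_node (len x) (env x).

Lemma truth_node_sub n f m g : truth_node n f -> m <= n ->
  (forall k, k < m -> f k = g k) -> truth_node m g.
Proof.
move=> [h0 [hn [ha [hx [hb [ho he]]]]]] mn e.
split=> [x l|]; first by rewrite -e // h0 //; lia.
split=> [q x l l'|]; first by rewrite -!e // hn //; lia.
split=> [a b x l l' l''|]; first by rewrite -!e // ha //; lia.
split=> [q x a l l'|]; first by rewrite -!e //; apply: hx; lia.
split=> [c l x k|]; first by rewrite -!e // hb //; lia.
split=> [c l x k k'|k]; first by rewrite -!e // ho //; lia.
by rewrite -e //; apply: he; lia.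
Qed.

Lemma truth_tree_pre f n : truth_tree (pre f n) <-> truth_node n f.
Proof.
rewrite /truth_tree len_pre; split=> h; apply: truth_node_sub h (leqnn n) _ => k kn;
  by rewrite env_pre.
Qed.

Lemma truth_tree_tree : is_tree truth_tree.
Proof.
move=> f n m /truth_tree_pre h mn; apply/truth_tree_pre.
exact: truth_node_sub h mn _.
Qed.

Lemma truth_tree_def : ndef B (fun v => truth_tree (v 0)).
Proof.
by rewrite /truth_tree /truth_node /ask /cneg /cand /cex /catm; dfn_tac.
Qed.

Lemma branch_truth f : branch truth_tree f ->
  forall e x, f (pr e x) <> 0 <->
    truth (rows B (set_oracle (fun y => f (ask y) <> 0))) e (env x).
Proof.
move=> bf; have H n : truth_node n f by apply/truth_tree_pre.
elim/code_ind=> [|q IH|a b IHa IHb|q IH|c l] x; rewrite truthE.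
- by have [h _] := H (pr 0 x).+1; rewrite h.
- have [_ [h _]] := H (pr (cneg q) x + pr q x).+1.
  rewrite h; [|lia|lia]; rewrite -IH; split=> [-> //|].
  by case: (f _) => // k [].
- have [_ [_ [h _]]] := H (pr (cand a b) x + pr a x + pr b x).+1.
  by rewrite h ?IHa ?IHb //; lia.
- have h a : (f (pr (cex q) x) = 0 -> f (pr q (cns a x)) = 0) /\
    (f (pr (cex q) x) = a.+1 -> f (pr q (cns a x)) <> 0).
    have [_ [_ [_ [h _]]]] := H (pr (cex q) x + pr q (cns a x)).+1.
    by apply: h; lia.
  split=> [|[a]].
    case e: (f _) => [|a] // _; exists a; rewrite -env_cns -IH; exact: (h a).2.
  by rewrite -env_cns -IH => n e; apply: n; exact: (h a).1.
have := odd_double_half c; case: (odd c); rewrite -addnn => <-.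
  rewrite add1n rows_odd -dec_lookup /set_oracle.
  set d := c./2; set y := nth 0 _ 0.
  have [_ [_ [_ [_ [_ [h _]]]]]] := H (pr (catm (d + d).+1 l) x + ask y).+1.
  by rewrite h //; [lia | rewrite /y -/(env _ _); lia].
rewrite add0n rows_even -dec_lookup.
have [_ [_ [_ [_ [h _]]]]] := H (pr (catm (c./2 + c./2) l) x).+1.
by rewrite h.
Qed.

Lemma truth_branch W : truth (rows B (set_oracle W)) e0 (env 0) ->
  exists f, branch truth_tree f.
Proof.
move=> W0; pose tr e x := truth (rows B (set_oracle W)) e (env x).
have val w : exists k, (k <> 0 <-> tr (p1 w) (p2 w)) /\
    (forall q a, p1 w = cex q -> k = a.+1 -> tr q (cns a (p2 w))).
  case: (pselect (tr (p1 w) (p2 w))) => t; last by exists 0; split=> //; split.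
  case: (pselect (exists q, p1 w = cex q)) => [[q e]|n]; last first.
    by exists 1; split=> // q a e; case: n; exists q.
  move: (t); rewrite /tr e truthE -/(cex q) => -[a ta].
  exists a.+1; split=> [|q' a']; first by split=> // _; exists a.
  rewrite /cex => e' [<-]; have -> : q' = q by lia.
  by rewrite /tr env_cns.
have [f hf] := choice val.
have fE e x : f (pr e x) <> 0 <-> tr e x.
  by have [h _] := hf (pr e x); rewrite h p1K p2K.
have f0 e x : f (pr e x) = 0 <-> ~ tr e x.
  by rewrite -fE; split=> [-> //|/contrapT].
exists f => n; apply/truth_tree_pre; split=> [x _|]; first by apply/f0; rewrite /tr truthE.
split=> [q x _ _|]; first by rewrite fE f0 /tr truthE.
split=> [a b x _ _ _|]; first by rewrite !fE /tr truthE.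
split=> [q x a _ _|].
  split; first by rewrite !f0 /tr truthE env_cns => h t; apply: h; exists a.
  move=> e; apply/fE; have [_ h] := hf (pr (cex q) x).
  by have := h q a; rewrite p1K p2K; apply.
split=> [c l x _|]; first by rewrite fE /tr truthE rows_even dec_lookup.
split=> [c l x _ _|_]; last exact/fE.
rewrite !fE /tr /ask !truthE -[1]/(0 + 0).+1 !rows_odd codeK /set_oracle /=.
by rewrite -dec_lookup env_cns.
Qed.

End TruthTree.

(** The members of the class are the sets that the branches of a truth tree
    describe, and such a branch also holds the answers that a definition of [X]
    from the set gives. *)
Lemma class_basis (N : structure) (lambda : ord_type) (M : option lambda -> structure)
    (B : base) o (Phi : (nat -> Prop) -> Prop) (X W0 : nat -> Prop) :
  tarski_hierarchy N M -> base_for N B -> ~ odef B o ->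
  udfn B (fun Z _ => Phi (fun w => Z 0 w 0)) -> Phi W0 ->
  (forall W, Phi W -> dfn B (fun _ : unit => set_oracle W) (fun _ v => X (v 0))) ->
  definable_sets (M o) X.
Proof.
move=> hM NB no [e0 he0] P0 hX.
have PhiE W : Phi W <-> truth (rows B (set_oracle W)) e0 (env 0).
  by rewrite -he0.
have [f0 bf0] := truth_branch ((PhiE W0).1 P0).
apply: (tree_basis (pos := fun e m => pr e (cns m 0)) hM NB no
  (@truth_tree_tree B e0) (@truth_tree_def B e0) _ bf0).
  by move=> e; dfn_tac.
move=> f bf; have ft := branch_truth bf.
have PW : Phi (fun y => f (ask y) <> 0).
  apply/PhiE/ft; have := (truth_tree_pre B e0 f (pr e0 0).+1).1 (bf _).
  by move=> [_ [_ [_ [_ [_ [_ h]]]]]]; exact: h.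
have [e he] := hX _ PW; exists e => m.
by rewrite ft -(he tt) env_cns.
Qed.

(** * The length of the hierarchy and the implicitly definable sets *)

Lemma dff_pre B I (Zf : I -> oracle) n : dff B Zf (fun _ v => pre v n).
Proof.
elim: n => [|n IH]; first exact: dff_const.
have E v : pre v n.+1 = cns (v 0) (pre (fun k => v k.+1) n).
  by rewrite /pre /mkseq /= -[1]/(1 + 0) iotaDl -map_comp.
apply: (@dfn_ext _ _ _ (fun _ v => v 0 = cns (v 1) (pre (fun k => v k.+2) n))).
  by move=> i v; rewrite E.
apply: dfn_eq; first exact: dff_var.
by apply: dff_cns; [exact: dff_var | exact: (dff_lift (dff_lift IH))].
Qed.

Lemma code_vtup n v : code (vtup n v) = pre v n.
Proof.
congr code; apply: (@eq_from_nth _ 0); rewrite size_tuple ?size_mkseq // => i lt.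
by rewrite nth_vtup // nth_mkseq.
Qed.

Lemma vtup_env_code n (t : n.-tuple nat) : vtup n (env (code t)) = t.
Proof. by rewrite env_code vtup_nth. Qed.

Section Final.
Variables (N : structure) (lambda : ord_type) (M : option lambda -> structure).
Hypothesis hM : tarski_hierarchy N M.
Variable B : base.
Hypothesis NB : base_for N B.

Lemma definable_of_set (L : structure) (X : nat -> Prop) (Y : (nat -> nat) -> Prop) k :
  N `<=` L -> definable_sets L X ->
  dfn B (fun _ : unit => set_oracle X) (fun _ v => Y v) ->
  definable L [set t : k.-tuple nat | Y (nth 0 t)].
Proof.
move=> NL LX; apply: (definable_of_dfn NB) => // d.
apply/scheme_definable.
have := @scheme_vars L [::] (@arithmetic_sub L) 1 _ 2 (fun _ => 1)
  ((scheme_definable L _).2 LX).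
apply: scheme_iff => A t.
by rewrite /set_oracle /= /thead tnth_mktuple /= (tnth_nth 0).
Qed.

(** A formula has finitely many symbols, and the levels increase. *)
Lemma definable_bounded o k (X : set (k.-tuple nat)) : is_limit o ->
  definable (M o) X -> exists2 j, idx_lt (Some j) o & definable (M (Some j)) X.
Proof.
move=> lim [phi [h eX]].
have [j0 j0o] := not_zero lim.1.
have up j j' : idx_lt (Some j) o -> idx_lt (Some j') o ->
    exists k, [/\ idx_lt (Some k) o, M (Some j) `<=` M (Some k) &
                  M (Some j') `<=` M (Some k)].
  move=> jo jo'; case: (olt_total j j') => [l|->|l].
  - by exists j'; split=> //; exact: (M_mono hM).
  - by exists j'; split.
  - by exists j; split=> //; exact: (M_mono hM).
have fin n (Q : 'I_n -> set symbol -> Prop) :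
    (forall i (L L' : set symbol), L `<=` L' -> Q i L -> Q i L') ->
    (forall i, exists2 j, idx_lt (Some j) o & Q i (M (Some j))) ->
    exists2 j, idx_lt (Some j) o & forall i, Q i (M (Some j)).
  move=> mQ hQ.
  suff [j jo hj] : exists2 j, idx_lt (Some j) o &
      forall i, i \in enum 'I_n -> Q i (M (Some j)).
    by exists j => // i; apply: hj; rewrite mem_enum.
  elim: (enum 'I_n) => [|i s [j jo hj]]; first by exists j0.
  have [j' jo' hj'] := hQ i.
  have [k' [ko s1 s2]] := up j j' jo jo'; exists k' => // i'.
  rewrite inE => /orP [/eqP ->|/hj]; [exact: mQ hj' | exact: mQ].
have sym s : symbols (M o) s -> exists2 j, idx_lt (Some j) o & symbols (M (Some j)) s.
  by rewrite (th_limit hM lim) => -[[j|] //= jo hs]; exists j.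
have t_bd m (t : term m) : term_over (M o) t ->
    exists2 j, idx_lt (Some j) o & term_over (M (Some j)) t.
  elim: t => [i _|n f args IH /= [Lf ha]]; first by exists j0.
  have [j jo hj] := fin n (fun i L => term_over L (args i))
    (fun i L L' => @term_over_mono L L' m (args i)) (fun i => IH i (ha i)).
  have [j' jo' hj'] := sym _ Lf.
  have [k' [ko s1 s2]] := up j j' jo jo'; exists k' => //; split; first exact: s2.
  by move=> i; exact: term_over_mono (hj i).
suff [j jo hj] : exists2 j, idx_lt (Some j) o & formula_over (M (Some j)) phi.
  by exists j => //; exists phi.
elim: phi h {eX X} => /= {k} [m n A args [LA ha]|m i args ha|m p IH h|
    m p IH q IH' [h h']|m p IH h].
- have [j jo hj] := fin n (fun i L => term_over L (args i))
    (fun i L L' => @term_over_mono L L' m (args i)) (fun i => t_bd m _ (ha i)).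
  have [j' jo' hj'] := sym _ LA.
  have [k' [ko s1 s2]] := up j j' jo jo'; exists k' => //; split; first exact: s2.
  by move=> i; exact: term_over_mono (hj i).
- exact: (fin _ (fun i L => term_over L (args i))
    (fun i L L' => @term_over_mono L L' m (args i)) (fun i => t_bd m _ (ha i))).
- exact: IH.
- have [j jo hj] := IH h; have [j' jo' hj'] := IH' h'.
  have [k' [ko s1 s2]] := up j j' jo jo'; exists k' => //.
  by split; [exact: formula_over_mono hj | exact: formula_over_mono hj'].
- exact: IH.
Qed.

(** Definability at a level below [o] becomes membership in a single row [c] of an
    iterated truth predicate; since [o] is a limit, there is a definable ordering
    long enough to have a point [c] at height [j]. *)
Lemma level_coded o j : is_limit o -> (forall i, idx_lt i o -> odef B i) ->
  idx_lt (Some j) o -> exists r H c Z,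
  [/\ well_founded r, ndef2 B r, hierarchy B r H,
    forall e x, H c e x <-> truth (rows B Z) e (env x) &
    forall s, symbols (M (Some j)) s ->
      dfn B (fun _ : unit => Z) (fun _ v => symbol_rel s v)].
Proof.
move=> lim hd jo; have [k [jk ko]] := lim.2 _ jo.
have [rho [f [hr hrho]]] := hd _ ko.
have [H hH] := hierarchy_exists B (lt_wf hr).
exists (strict rho), H, (f j), (level_oracle f H (Some j)); split.
- exact: lt_wf hr.
- exact: ndef2_strict.
- exact: hH.
- by move=> e x; exact: (H_truth hr hH _ _ jk).
- have [h _] := level_ok_all hM NB hr hrho hH (or_intror jk).
  exact: h.
Qed.

(** Row 0 is the truth predicate of the ground structure, and for each relation
    definable there some row is a nonempty set without minimal element or else an
    iterated truth predicate along the relation.  For well-founded relations only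
    the second case is possible, although well-foundedness is not first-order. *)
Definition universal_class (W : nat -> Prop) : Prop :=
  (forall n, tarski_set B (fun w => W (pr 0 w)) (fun _ => False) n) /\
  forall e,
    (exists n, (exists c, W (pr n c)) /\ forall c, W (pr n c) ->
       exists d, W (pr n d) /\ W (pr 0 (pr e (cns d (cns c 0))))) \/
    (exists n, forall c, hier_at B (fun w => W (pr n w))
       (fun z => W (pr 0 (pr e (cns (p1 z) (cns (p2 z) 0))))) c).

Lemma universal_class_def :
  udfn B (fun Z _ => universal_class (fun w => Z 0 w 0)).
Proof.
rewrite /universal_class; dfn_tac.
  apply: (@dfn_sets _ _ _ (fun W T n => tarski_set B W T n)
    (fun Z v w => Z 0 (pr 0 w) 0) (fun _ _ _ => False)); try by dfn_tac.
  exact: udfn_tarski_set.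
apply: (@dfn_sets _ _ _ (fun W T c => hier_at B W T c)
  (fun Z v w => Z 0 (pr (v 1) w) 0)
  (fun Z v z => Z 0 (pr 0 (pr (v 2) (cns (p1 z) (cns (p2 z) 0)))) 0));
  try by dfn_tac.
exact: udfn_hier_at.
Qed.

Definition ground_truth (e x : nat) : Prop :=
  truth (rows B (fun _ _ _ => False)) e (env x).

Lemma universal_class_nonempty : exists W, universal_class W.
Proof.
pose r e c d := ground_truth e (cns c (cns d 0)).
have row e : exists V : nat -> Prop,
    ((exists c, V c) /\ forall c, V c -> exists d, V d /\ r e d c) \/
    (forall c, hier_at B V (pair_set (r e)) c).
  case: (pselect (well_founded (r e))) => wf.
    have [H hH] := hierarchy_exists B wf; exists (triple_set H); right=> c.
    by apply: (hierarchy_hier_at _ hH) => d c'; rewrite pair_setE.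
  exists (fun c => ~ Acc (r e) c); left; split; first exact/existsNP.
  move=> c nc; apply: contrapT => H; apply: nc; apply: Acc_intro => d dc.
  by apply: contrapT => nd; apply: H; exists d.
have [V hV] := choice row.
exists (fun w => if p1 w is e.+1 then V e (p2 w)
                 else ground_truth (p1 (p2 w)) (p2 (p2 w))).
split=> [n|e].
  by rewrite /tarski_set; apply: truth_tarski => e x _; rewrite !(p1K, p2K).
have E0 d c : (if p1 (pr 0 (pr e (cns d (cns c 0)))) is e'.+1
    then V e' (p2 (pr 0 (pr e (cns d (cns c 0)))))
    else ground_truth (p1 (p2 (pr 0 (pr e (cns d (cns c 0))))))
                      (p2 (p2 (pr 0 (pr e (cns d (cns c 0))))))) = r e d c.
  by rewrite !(p1K, p2K).
have EV w : (if p1 (pr e.+1 w) is e'.+1 then V e' (p2 (pr e.+1 w))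
    else ground_truth (p1 (p2 (pr e.+1 w))) (p2 (p2 (pr e.+1 w)))) = V e w.
  by rewrite !(p1K, p2K).
case: (hV e) => [[[c Vc] h]|h]; [left|right]; exists e.+1.
  split; first by exists c; rewrite EV.
  move=> c'; rewrite EV => /h [d [Vd rd]]; exists d.
  by rewrite EV E0.
move=> c; have := h c.
congr hier_at; apply/funext=> w; first by rewrite EV.
by rewrite E0.
Qed.

Lemma universal_class_row W r H : universal_class W -> well_founded r ->
  ndef2 B r -> hierarchy B r H ->
  exists n, forall c e x, W (pr n (pr c (pr e x))) <-> H c e x.
Proof.
move=> [W0 hW] wf [e he] hH.
have rE c d : W (pr 0 (pr e (cns c (cns d 0)))) <-> r c d.
  rewrite (tarski_truth (W0 e) _ (leqnn e)).
  by rewrite (he (fun _ _ _ => False) (scons c (scons d (env 0)))) !env_cns.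
case: (hW e) => [[n [[c Wc] h]]|[n h]].
  have [c' [Wc' mc]] := wf_min wf (ex_intro (fun c => W (pr n c)) c Wc).
  by have [d [Wd /rE /mc]] := h c' Wc'.
exists n => c d x.
apply: (@hier_unique B r H (fun w => W (pr n w)) _ (fun _ => True) wf hH _ _ _ c I)
  => // d' c'.
by rewrite /= p1K p2K.
Qed.

(** Every member of [universal_class] would define a canonic universal predicate
    [P], so by [class_basis] the level itself would define [P], which is excluded
    by diagonalization. *)
Lemma undefinable_no_canonic o : ~ odef B o -> (forall i, idx_lt i o -> odef B i) ->
  ~ exists P, canonic_universal (M o) P.
Proof.
move=> no hd [P [uP cP]].
have lim := odef_limit no hd.
pose X m := P [tuple p1 m; p2 m].
have DX : definable_sets (M o) X.
  have [W0 hW0] := universal_class_nonempty.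
  apply: (class_basis hM NB no universal_class_def hW0) => W hW.
  have hWd F : dff B (fun _ : unit => set_oracle W) F ->
      dfn B (fun _ : unit => set_oracle W) (fun i v => W (F i v)).
    by move=> hF; exact: (dfn_oracle 0 hF hF).
  (* A section of [G] is given by a row of [W], a point of the ordering and
     a code. *)
  pose G : set (2.-tuple nat) := [set t | W (pr (p1 (tnth t ord0))
    (pr (p1 (p2 (tnth t ord0))) (pr (p2 (p2 (tnth t ord0))) (cns (tnth t ord_max) 0))))].
  have uG : universal (M o) G.
    move=> Y DY; have [j jo DY'] := definable_bounded lim DY.
    have [r [H [c [Z [wf hr hH HZ hs]]]]] := level_coded lim hd jo.
    have [n hn] := universal_class_row hW wf hr hH.
    have [e he] := dfn_definable hs DY'.
    exists (pr n (pr c e)) => //; apply/predeqP => m.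
    rewrite /section /G /= !(tnth_nth 0) /= !(p1K, p2K) hn HZ -(he tt).
    by rewrite /= /thead tnth_mktuple env_cns.
  have symW s : add_pred (M o) G s ->
      dfn B (fun _ : unit => set_oracle W) (fun _ v => symbol_rel s v).
    move=> [|->]; last first.
      apply: (@dfn_ext _ _ _ (fun _ v => W (pr (p1 (v 0))
        (pr (p1 (p2 (v 0))) (pr (p2 (p2 (v 0))) (cns (v 1) 0)))))).
        by move=> _ v; rewrite /symbol_rel /G /= !tnth_mktuple.
      by apply: hWd; dfn_tac.
    rewrite (th_limit hM lim) => -[[j|] //= jo Ms].
    have [r [H [c [Z [wf hr hH HZ hs]]]]] := level_coded lim hd jo.
    have [n hn] := universal_class_row hW wf hr hH.
    have [e he] := hs _ Ms.
    apply: dfn_ext (fun i v => iff_sym (he i v)) _.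
    apply: (@dfn_subst_oracle B _ _ (fun Z v => truth (rows B Z) e v) (fun _ _ => Z)).
      exact: dfn_truth.
    move=> d; apply: (@dfn_ext _ _ _ (fun _ v =>
      W (pr n (pr c (pr (row_atom d) (cns (v 0) (cns (v 1) 0))))))).
      by move=> _ v; rewrite hn HZ truth_row_atom !env_cns.
    by apply: hWd; rewrite /row_atom /catm; dfn_tac.
  have := dfn_definable symW (cP G uG) => hP.
  pose F k (_ : unit) (v : nat -> nat) := if k is 0 then p1 (v 0) else p2 (v 0).
  apply: dfn_ext (dfn_subst (F := F) hP _) => [u v|[|k]]; rewrite /F; try by dfn_tac.
  by rewrite vtup2.
have Ddiag : definable_sets (M o) (fun m => ~ X (pr m m)).
  have := @definable_of_set (M o) X (fun v => ~ X (pr (v 0) (v 0))) 1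
    (@N_sub_M _ _ _ hM _) DX.
  rewrite /definable_sets /= (_ : [set t : 1.-tuple nat | ~ X (pr (nth 0 t 0) (nth 0 t 0))] =
    [set t | ~ X (pr (thead t) (thead t))]); last first.
    by apply/seteqP; split=> t /=; rewrite /thead (tnth_nth 0).
  apply; apply: dfn_not.
  by apply: (@dfn_oracle _ _ (fun _ : unit => set_oracle X) 0 _ (fun _ _ => 0)); dfn_tac.
have [n _ e] := uP _ Ddiag.
have E m : P [tuple n; m] <-> ~ P [tuple m; m].
  have : section P n m <-> ~ X (pr m m) by rewrite e.
  by rewrite /X p1K p2K.
by have [h h'] := E n; have nP : ~ P [tuple n; n] by [move=> p; exact: h]; exact: nP (h' nP).
Qed.

Lemma odef_index (i : lambda) : odef B (Some i).
Proof.
apply: contrapT => ni.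
have [j [nj mj]] := wf_min (@olt_wf lambda) (ex_intro (fun i => ~ odef B (Some i)) i ni).
apply: (undefinable_no_canonic nj) => [[k|] //= kj|]; first exact: contrapT (mj k kj).
have [k jk] := idx_succ j; have [P [cP _]] := th_succ hM jk.
by exists P.
Qed.

Lemma odef_None : ~ odef B (@None lambda).
Proof. by move=> /(odef_canonic hM NB); exact: th_maximal hM. Qed.

Lemma odef_below_None (i : option lambda) : idx_lt i None -> odef B i.
Proof. by case: i => // i _; exact: odef_index. Qed.

Lemma limit_None : is_limit (@None lambda).
Proof. exact: odef_limit odef_None odef_below_None. Qed.

(** A definable copy determines its ordinal, since different initial segments of
    a well-ordering are not isomorphic, and there are countably many codes. *)
Lemma index_countable : countable [set: lambda].
Proof.
have ch (i : lambda) : exists e : nat, exists2 rho, (exists f, ord_copy (Some i) rho f) &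
    forall Z v, rho (v 0) (v 1) <-> truth (rows B Z) e v.
  have [rho [f [hr [e he]]]] := odef_index i.
  by exists e, rho; [exists f | ].
have [g hg] := choice ch.
apply/countable_injP; exists g => i j _ _ e.
(* [h] below would map the segment of [b] into that of [a], hence [a] below
   itself. *)
have rigid (a b : lambda) : g a = g b -> ~ olt a b.
  move=> gab ab; have [rho [f hf] hrho] := hg a; have [rho' [f' hf'] hrho'] := hg b.
  have E c d : rho c d <-> rho' c d.
    have := hrho (fun _ _ _ => False) (scons c (scons d (fun _ => 0))).
    have := hrho' (fun _ _ _ => False) (scons c (scons d (fun _ => 0))).
    by rewrite gab /= => -> ->.
  have ex x : exists y, olt x b -> olt y a /\ f' x = f y.
    case: (pselect (olt x b)) => xb; last by exists a.
    have : rho' (f' x) (f' x) by apply/(copy_le hf' xb xb); left.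
    by move=> /E /(copy_field hf) [y [_ [ya _ ey _]]]; exists y.
  have [h hh] := choice ex.
  have mono x y : olt x b -> olt y b -> olt x y -> olt (h x) (h y).
    move=> xb yb xy; have [hx ex'] := hh x xb; have [hy ey] := hh y yb.
    have : strict rho' (f' x) (f' y) by apply/(copy_lt hf' xb yb).
    by rewrite ex' ey => -[/E r n]; apply/(copy_lt hf hx hy).
  have no x : olt x b -> ~ olt (h x) x.
    elim/(well_founded_ind (@olt_wf lambda)): x => x IH xb hx.
    have hb : olt (h x) b by exact: olt_trans hx xb.
    exact: (IH (h x) hx hb (mono _ _ hb xb hx)).
  by apply: (no a ab); have [] := hh a ab.
by case: (olt_total i j) => // h; [case: (rigid _ _ e h) | case: (rigid _ _ (esym e) h)].
Qed.

Lemma is_Ord_length : is_Ord N lambda.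
Proof.
split=> [/(definable_ordinal_odef NB)|b nb]; first exact: odef_None.
case: (ord_compare b lambda) => // -[i [g [gm gi]]].
by case: nb; exact: (odef_definable_ordinal NB gm gi (odef_index i)).
Qed.

Definition decode_relations lam (W : nat -> Prop) : relations lam :=
  fun i => [set t | W (pr i (code t))].

(** Coded by sets, the solutions of the scheme form a first-order class with
    exactly one tuple of relations. *)
Lemma implicit_definable k (B0 : set (k.-tuple nat)) :
  implicitly_definable N B0 -> definable (M None) B0.
Proof.
move=> [lam [A [phi [hphi uA DB]]]].
pose Phi W := sat (@decode_relations lam W) phi [tuple].
have Phi_def : udfn B (fun Z _ => Phi (fun w => Z 0 w 0)).
  have := @dfn_sat B _ id N (fun s => @base_symbol_dfn N B NB s oracle id) lam
    (fun Z => decode_relations (fun w => Z 0 w 0)) _ 0 phi hphi.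
  move=> H; apply: dfn_ext (H _) => [Z v|j].
    by rewrite (_ : vtup 0 v = [tuple]) //; exact: tuple0.
  rewrite /decode_relations /=.
  apply: (@dfn_ext _ _ _ (fun Z v => Z 0 (pr j (pre v (nth 0 lam j))) 0)).
    by move=> Z v; rewrite code_vtup.
  by apply: dfn_oracle_id; [apply: dff_pr; [exact: dff_const | exact: dff_pre] |
    exact: dff_const].
(* A code of the solution [A]. *)
pose W0 w := if insub (p1 w) is Some i then A i (vtup _ (env (p2 w))) else False.
have W0E : decode_relations W0 = A.
  apply: functional_extensionality_dep => i; apply/seteqP; split=> t;
    by rewrite /decode_relations /W0 /= p1K p2K valK vtup_env_code.
pose X x := B0 (vtup k (env x)).
have DX : definable_sets (M None) X.
  apply: (class_basis hM NB odef_None Phi_def (W0 := W0)).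
    by rewrite /Phi W0E; apply/uA.
  move=> W /uA WA.
  have DB' : dfn B (fun _ : unit => set_oracle W) (fun _ v => B0 (vtup k v)).
    apply: (dfn_definable _ DB) => s [Ns|[i _ <-]]; first exact: (base_symbol_dfn NB).
    rewrite -WA /symbol_rel /decode_relations.
    apply: (@dfn_ext _ _ _ (fun _ v => W (pr i (pre v (nth 0 lam i))))).
      by move=> _ v; rewrite /= code_vtup.
    apply: (@dfn_oracle _ _ (fun _ : unit => set_oracle W) 0 _ (fun _ _ => 0));
      last exact: dff_const.
    by apply: dff_pr; [exact: dff_const | exact: dff_pre].
  by apply: (dfn_subst (F := fun l _ v => env (v 0) l) DB') => l; dfn_tac.
have := @definable_of_set (M None) X (fun v => X (pre v k)) k (@N_sub_M _ _ _ hM _) DX.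
rewrite (_ : [set t : k.-tuple nat | X (pre (nth 0 t) k)] = B0); last first.
  by apply/seteqP; split=> t; rewrite /= /X -code_vtup vtup_nth vtup_env_code.
apply; apply: (@dfn_oracle _ _ (fun _ : unit => set_oracle X) 0 _ (fun _ _ => 0)).
  exact: dff_pre.
exact: dff_const.
Qed.

(** The iterated truth predicate along a definable well-ordering is the unique
    solution of its inductive clauses. *)
Lemma top_implicit (X : set nat) : definable_sets (M None) X ->
  implicitly_definable N [set t : 1.-tuple nat | X (thead t)].
Proof.
move=> DX; have [j jo DX'] := definable_bounded limit_None DX.
have [r [H [c [Z [wf hr hH HZ hs]]]]] := level_coded limit_None odef_below_None jo.
have [e he] := dfn_definable hs DX'.
have XE m : X m <-> triple_set H (pr c (pr e (cns m 0))).
  rewrite triple_setE HZ -(he tt) env_cns.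
  by rewrite /= /thead tnth_mktuple.
pose Zf (A : relations [:: 1]) : oracle := set_oracle (fun w => A ord0 [tuple w]).
pose good W := forall c, hier_at B W (pair_set r) c.
have good_def : udfn B (fun Z _ => good (fun w => Z 0 w 0)).
  rewrite /good; dfn_tac.
  apply: (@dfn_sets _ _ _ (fun W T c => hier_at B W T c)
    (fun Z v w => Z 0 w 0) (fun _ _ => pair_set r)); try by dfn_tac.
    exact: udfn_hier_at.
  by rewrite /pair_set; apply: (dfn_ndef2 hr); dfn_tac.
have [phi hphi phiE] : scheme_def N (fun (A : relations [:: 1]) (t : 0.-tuple nat) =>
    good (fun w => A ord0 [tuple w])).
  have := @dfn_scheme B N N [:: 1] Zf NB (fun s h => h) (@arithmetic_sub N) _
    (fun A _ => good (fun w => A ord0 [tuple w])) 0 (dfn_pull Zf good_def).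
  apply=> d; rewrite /Zf /set_oracle.
  exists (@RelVar [:: 1] 2 ord0 (fun _ => Var ord0)) => // A t /=.
  rewrite (_ : [tuple tnth t ord0 | _ < 1] = [tuple tnth t ord0]) //.
  by apply: eq_from_tnth => i; rewrite tnth_mktuple (tnth_nth 0) ord1.
pose A : relations [:: 1] := fun i => [set t | triple_set H (nth 0 t 0)].
exists [:: 1], A, phi; split=> // [A'|].
  rewrite phiE; split=> [g|->]; last first.
    move=> d; have := hierarchy_hier_at d hH (fun d c => _ : pair_set r (pr d c) <-> r d c).
    by apply=> d' c'; rewrite pair_setE.
  apply: functional_extensionality_dep => i; rewrite (ord1 i).
  have U w : A' ord0 [tuple w] <-> triple_set H w.
    rewrite -(prK w) -(prK (p2 w)) triple_setE.
    apply: (@hier_unique B r H (fun w => A' ord0 [tuple w]) (pair_set r)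
      (fun _ => True) wf hH) => // d d'; by rewrite pair_setE.
  have T1 (t : 1.-tuple nat) : t = [tuple nth 0 t 0].
    by apply: eq_from_tnth => l; rewrite !(tnth_nth 0) ord1.
  by apply/seteqP; split=> t; rewrite /A /=; [rewrite {1}(T1 t)|rewrite {2}(T1 t)]; move/U.
have sub : N `<=` add_relations N A by exact: subsetUl.
have := @definable_dfn B N (add_relations N A) (set_oracle (triple_set H))
  (fun v => X (v 0)) 1 NB sub (subset_trans (@arithmetic_sub N) sub).
rewrite (_ : [set t : 1.-tuple nat | X (nth 0 t 0)] = [set t | X (thead t)]); last first.
  by apply/seteqP; split=> t /=; rewrite /thead (tnth_nth 0).
apply=> [d|].
  exists (Atom [::] (A ord0) (fun _ => Var ord0)); split.
    by split=> //; right; exists ord0.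
  have E (t : 2.-tuple nat) : nth 0 [tuple tnth t ord0 | _ < 1] 0 = tnth t ord0.
    by rewrite -[X in nth 0 _ X]/(nat_of_ord (@ord0 0)) -tnth_nth tnth_mktuple.
  by apply/seteqP; split=> t; rewrite /set_oracle /A /= E.
apply: (@dfn_ext _ _ _ (fun _ v => triple_set H (pr c (pr e (cns (v 0) 0))))).
  by move=> _ v; rewrite XE.
by apply: (@dfn_oracle _ _ (fun _ : unit => set_oracle (triple_set H)) 0 _
  (fun _ _ => 0)); dfn_tac.
Qed.

End Final.

Theorem theorem1 (N : structure) (lambda : ord_type)
    (M : option lambda -> structure)
    (hN : L_finite N)
    (hM : tarski_hierarchy N M) :
  [/\ countable [set: lambda],
      is_Ord N lambda,
      forall k (B : set (k.-tuple nat)),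
        implicitly_definable N B -> definable (M None) B &
      forall M' : structure,
        (forall k (B : set (k.-tuple nat)),
           implicitly_definable N B -> definable M' B) ->
        definable_sets (M None) `<=` definable_sets M'].
Proof.
have [B NB] := base_for_exists hN; split.
- exact: (index_countable hM NB).
- exact: (is_Ord_length hM NB).
- exact: (implicit_definable hM NB).
- by move=> M' h X DX; apply: h; exact: (top_implicit hM NB DX).
Qed.
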